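(* Let $(Q,S)$ be any quiver with potential and let $k,\ell\in Q_0$ be distinct vertices such that $k$ is not incident to any $2$-cycle of $Q$. If the indecomposable projective $P_{(Q,S)}(\ell)$ is finite-dimensional, then so is the indecomposable projective $P_{\mu_k(Q,S)}(\ell)$, and the decorated representations $\mu_k(P_{(Q,S)}(\ell),0)$ and $(P_{\mu_k(Q,S)}(\ell),0)$ of the Jacobian algebra $\Lambda(\mu_k(Q,S))$ are isomorphic.
   Context: Quivers $Q=(Q_0,Q_1,h,t)$ are finite and loop-free; an arrow $a$ goes from $t(a)$ to $h(a)$. Paths are composed like functions: in a path $a_1\cdots a_d$ one has $t(a_j)=h(a_{j+1})$. Let $A^d$ be the $\mathbb{C}$-vector space with basis the paths of length $d$ (for $d=0$ the idempotents $e_i$, $i\in Q_0$). The complete path algebra is $\mathbb{C}\langle\langle Q\rangle\rangle=\prod_{d\ge0}A^d$ with multiplication induced by concatenation; $\mathfrak m=\prod_{d\ge1}A^d$, and the topology is $\mathfrak m$-adic. A potential $S$ is an element of $\mathbb{C}\langle\langle Q\rangle\rangle$ all of whose terms are cyclic paths of positive length; a quiver with potential (QP) is a pair $(Q,S)$. For an arrow $a$, $\partial_a(a_1\cdots a_d)=\sum_i\delta_{a,a_i}a_{i+1}\cdots a_da_1\cdots a_{i-1}$, extended linearly and continuously. $J(S)$ is the closure of the two-sided ideal generated by all $\partial_a(S)$; the Jacobian algebra is $\Lambda(Q,S)=\mathbb{C}\langle\langle Q\rangle\rangle/J(S)$ (not assumed finite-dimensional). $P_{(Q,S)}(\ell)=\Lambda(Q,S)e_\ell$.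 Two potentials are cyclically equivalent if their difference lies in the closure of the span of all $a_1\cdots a_d-a_2\cdots a_da_1$ with $a_1\cdots a_d$ cyclic. A right-equivalence $(Q,S)\to(Q',S')$ (same vertex set) is an algebra isomorphism $\mathbb{C}\langle\langle Q\rangle\rangle\to\mathbb{C}\langle\langle Q'\rangle\rangle$ fixing all $e_i$ and sending $S$ to a potential cyclically equivalent to $S'$; it induces an isomorphism of Jacobian algebras. $(Q,S)$ is trivial if $S\in A^2$ and the $\partial_a(S)$ span $A^1$; reduced if $S$ has no degree-$2$ component. By the Splitting Theorem every QP is right-equivalent to a direct sum $(Q_{\rm red},S_{\rm red})\oplus(C,T)$ (disjoint union of arrows, sum of potentials) of a reduced QP, its reduced part, and a trivial QP, unique up to right-equivalence; via the right-equivalence and the inclusion $\mathbb{C}\langle\langle Q_{\rm red}\rangle\rangle\to\mathbb{C}\langle\langle Q_{\rm red}\oplus C\rangle\rangle$ one gets $\Lambda(Q_{\rm red},S_{\rm red})\cong\Lambda(Q,S)$. QP mutation at $k$ (not incident to $2$-cycles): a $k$-hook is a path $ab$ of length two with $t(a)=k=h(b)$. $\widetilde\mu_k(Q)$ is obtained from $Q$ by adding an arrow $[ab]:t(b)\to h(a)$ for each $k$-hook and replacing each arrow $c$ incident to $k$ by an opposite arrow $c^*$. Replace $S$ by a cyclically equivalent potential none of whose terms begins at $k$; $[S]$ is obtained by replacing each $k$-hook $ab$ by $[ab]$, and $\widetilde\mu_k(S)=[S]+\sum a^*[ab]b^*$ (sum over $k$-hooks). The premutation is $\widetilde\mu_k(Q,S)=(\widetilde\mu_k(Q),\widetilde\mu_k(S))$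 and the mutation $\mu_k(Q,S)$ is its reduced part (well defined up to right-equivalence). A decorated representation of $(Q,S)$ is a pair $\mathcal M=(M,\mathbf v)$ with $M$ a finite-dimensional left $\Lambda(Q,S)$-module and $\mathbf v\in\mathbb{Z}_{\ge0}^{Q_0}$; write $M_j=e_jM$ and $a_M:M_{t(a)}\to M_{h(a)}$ for the action of an arrow. Let $a_1,\ldots,a_s$ (resp. $b_1,\ldots,b_r$) be the arrows of $Q$ ending (resp. starting) at $k$, $M_{\rm in}=\bigoplus_iM_{t(a_i)}$, $M_{\rm out}=\bigoplus_jM_{h(b_j)}$, $\alpha=[(a_1)_M\cdots(a_s)_M]:M_{\rm in}\to M_k$, $\beta=[(b_1)_M\cdots(b_r)_M]^T:M_k\to M_{\rm out}$, and $\gamma:M_{\rm out}\to M_{\rm in}$ with entries $\gamma_{i,j}=\partial_{b_ja_i}(S)_M$, where $\partial_{b_ja_i}(S)$ sums, over all occurrences of $b_ja_i$ as consecutive arrows in the cyclic terms of $S$, the complementary path (read cyclically starting right after $b_ja_i$). One has $\alpha\gamma=0$, $\gamma\beta=0$. Define $\overline M_j=M_j$, $\overline v_j=v_j$ for $j\ne k$, $\overline M_k=\operatorname{coker}\beta\oplus\frac{\ker\alpha}{\operatorname{im}\gamma}\oplus\mathbb{C}^{v_k}$, $\overline v_k=\dim\frac{\ker\beta}{\ker\beta\cap\operatorname{im}\alpha}$. Arrows of $Q$ not incident to $k$ act as before, $[b_ja_i]$ acts as $(b_j)_M(a_i)_M$, the $a_i^*$ act through $[\overline\gamma\ \ \iota\sigma\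 \ 0]:\overline M_k\to M_{\rm in}$, and the $b_j^*$ act through $[-p\ \ 0\ \ 0]^T:M_{\rm out}\to\overline M_k$, where $p:M_{\rm out}\to\operatorname{coker}\beta$ is the projection, $\overline\gamma$ is induced by $\gamma$, $\iota:\ker\alpha\to M_{\rm in}$ is the inclusion, and $\sigma:\ker\alpha/\operatorname{im}\gamma\to\ker\alpha$ is a linear section of the projection. The premutation $\widetilde\mu_k(\mathcal M)=(\overline M,\overline{\mathbf v})$ is a decorated representation of $\widetilde\mu_k(Q,S)$, and $\mu_k(\mathcal M)$ is the decorated representation of $\mu_k(Q,S)$ obtained by restricting the action along $\Lambda(\mu_k(Q,S))\cong\Lambda(\widetilde\mu_k(Q,S))$. Decorated representations $(M,\mathbf v)$, $(M',\mathbf v')$ of the same algebra are isomorphic if $M\cong M'$ as modules and $\mathbf v=\mathbf v'$. *)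

(* Defs.v *)
From HB Require Import structures.
From mathcomp Require Import all_boot all_order all_algebra generic_quotient ring_quotient.
From mathcomp Require Import boolp classical_sets functions reals.
From mathcomp Require Import complex.

Set Implicit Arguments.
Unset Strict Implicit.
Unset Printing Implicit Defensive.

Import GRing.Theory.
Local Open Scope ring_scope.
Local Open Scope classical_set_scope.
Local Open Scope quotient_scope.

Section LinearAlgebra.
Variable K : fieldType.

Definition lin_span (M : lmodType K) (X : set M) : set M :=
  [set u | exists2 s : seq (K * M),
     {in s, forall t, X t.2} & u = \sum_(t <- s) t.1 *: t.2].

Definition ideal_gen (A : pzRingType) (G : set A) : set A :=
  [set u | exists2 s : seq (A * A * A),
     {in s, forall t, G t.1.2} & u = \sum_(t <- s) t.1.1 * t.1.2 * t.2].

Definition finite_dim (W : lmodType K) : Prop :=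
  exists (n : nat) (f : W -> 'rV[K]_n), linear f /\ bijective f.

Lemma finite_dim_axiom (W : lmodType K) (fin : finite_dim W) :
  {n : nat & Vector.axiom n W}.
Proof.
have [n /cid [f [lf bf]]] := cid fin.
by exists n; exists f.
Qed.

Definition fd_vectType (W : lmodType K) (fin : finite_dim W) : vectType K :=
  HB.pack_for (vectType K) (GRing.Lmodule.sort W)
    (Lmodule_hasFinDim.Build K (GRing.Lmodule.sort W)
       (projT2 (finite_dim_axiom fin))).

Lemma linfun_linearE (aT rT : vectType K) (f : aT -> rT) :
  linear f -> linfun f =1 f.
Proof.
move=> lf; pose m := GRing.isLinear.Build K aT rT _ f lf.
pose g : {linear aT -> rT} := HB.pack_for {linear aT -> rT} f m.
exact: (lfunE g).
Qed.

Definition fam_space (I : finType) (W : vectType K) (U : I -> {vspace W}) :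
    {vspace {ffun I -> W}} :=
  (\bigcap_i (linfun (fun f : {ffun I -> W} => f i) @^-1: U i))%VS.

Lemma fam_spaceP (I : finType) (W : vectType K) (U : I -> {vspace W})
    (f : {ffun I -> W}) :
  reflect (forall i, f i \in U i) (f \in fam_space U).
Proof.
have ev i g : linfun (fun f : {ffun I -> W} => f i) g = g i.
  by apply: linfun_linearE => c x y; rewrite !ffunE.
apply: (iffP idP) => [fU i|fU]; last first.
  by rewrite memvE; apply/subv_bigcapP => i _; rewrite -memvE -memv_preim ev.
by move/subv_bigcapP: fU => /(_ i isT); rewrite -memvE -memv_preim ev.
Qed.

Section Quotient.
Variables (W : lmodType K) (U : submodClosed W).

Definition submod_pred : {pred W} := fun x => x \in U.

Lemma submod_zmod_closed : zmod_closed submod_pred.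
Proof.
split=> [|x y Ux Uy]; rewrite unfold_in ?rpred0 // -scaleN1r.
by rewrite rpredD ?rpredZ.
Qed.
HB.instance Definition _ :=
  GRing.isZmodClosed.Build W submod_pred submod_zmod_closed.

Definition lquot : Type := Quotient.quot submod_pred.
HB.instance Definition _ := GRing.Zmodule.on lquot.

Definition lproj (x : W) : lquot := \pi_(Quotient.quot submod_pred) x.
Definition lrepr (y : lquot) : W := repr (y : Quotient.quot submod_pred).

Lemma lreprK y : lproj (lrepr y) = y.
Proof. exact: reprK. Qed.

Lemma lprojP x y : lproj x = lproj y <-> x - y \in U.
Proof.
rewrite /lproj -[x - y \in U]/(Quotient.equiv submod_pred x y).
by split=> [/eqP|e]; last apply/eqP; rewrite piE.
Qed.

Lemma lprojB x y : lproj (x - y) = lproj x - lproj y.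
Proof. by rewrite /lproj raddfB. Qed.

Lemma lprojD x y : lproj (x + y) = lproj x + lproj y.
Proof. by rewrite /lproj raddfD. Qed.

Definition lquot_scale (c : K) (y : lquot) : lquot := lproj (c *: lrepr y).

Lemma lquot_scaleE c x : lquot_scale c (lproj x) = lproj (c *: x).
Proof.
apply/lprojP; rewrite -scalerBr rpredZ //; apply/lprojP; exact: lreprK.
Qed.

Lemma lquot_scaleA a b y :
  lquot_scale a (lquot_scale b y) = lquot_scale (a * b) y.
Proof. by rewrite -[y]lreprK !lquot_scaleE scalerA. Qed.

Lemma lquot_scale1 y : lquot_scale 1 y = y.
Proof. by rewrite -[y]lreprK lquot_scaleE scale1r. Qed.

Lemma lquot_scaleDr c : {morph lquot_scale c : x y / x + y}.
Proof.
move=> x y; rewrite -[x]lreprK -[y]lreprK -lprojD !lquot_scaleE scalerDr.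
by rewrite lprojD.
Qed.

Lemma lquot_scaleDl y : {morph lquot_scale^~ y : a b / a + b}.
Proof.
by move=> a b; rewrite -[y]lreprK !lquot_scaleE scalerDl lprojD.
Qed.

HB.instance Definition _ := GRing.Zmodule_isLmodule.Build K lquot
  lquot_scaleA lquot_scale1 lquot_scaleDr lquot_scaleDl.

Lemma lproj_is_linear : linear lproj.
Proof. by move=> c x y; rewrite lprojD -lquot_scaleE. Qed.
HB.instance Definition _ := GRing.isLinear.Build K W lquot _ lproj lproj_is_linear.

End Quotient.
End LinearAlgebra.

Record quiver (V : finType) := Quiver {
  arrow : finType;
  hd : arrow -> V;
  tl : arrow -> V
}.

Section PathAlgebra.
Variables (K : fieldType) (V : finType) (Q : quiver V).
Local Notation Q1 := (arrow Q).

Definition loop_free : Prop := forall a : Q1, hd a != tl a.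

Definition no_2cycle_at (k : V) : Prop :=
  forall a b : Q1, ~ [/\ hd a = tl b, hd b = tl a & (hd a == k) || (tl a == k)].

(* A path is a pair (i, a_1 ... a_d) with h(a_1) = i and t(a_j) = h(a_{j+1});
   its starting vertex (the tail of the last arrow, or i) is [src i w]. *)
Fixpoint pathb (i : V) (w : seq Q1) : bool :=
  if w is a :: w' then (hd a == i) && pathb (tl a) w' else true.

Definition src (i : V) (w : seq Q1) : V := last i (map (@tl V Q) w).

Definition qpath := {x : V * seq Q1 | pathb x.1 x.2}.

Definition ptgt (x : qpath) : V := (val x).1.
Definition pword (x : qpath) : seq Q1 := (val x).2.
Definition plen (x : qpath) : nat := size (pword x).
Definition psrc (x : qpath) : V := src (ptgt x) (pword x).

(* The complete path algebra, the product over d of the spaces spanned by the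
   paths of length d: formal, possibly infinite, combinations of paths. *)
Definition cpa : Type := qpath -> K.
HB.instance Definition _ := GRing.Lmodule.copy cpa (qpath -> K^o).

Definition coef (u : cpa) (i : V) (w : seq Q1) : K :=
  if insub (i, w) is Some x then u x else 0.

Definition conv (f g : V -> seq Q1 -> K) (i : V) (w : seq Q1) : K :=
  \sum_(n < (size w).+1) f i (take n w) * g (src i (take n w)) (drop n w).

Definition cpa_mul (u v : cpa) : cpa :=
  fun x => conv (coef u) (coef v) (ptgt x) (pword x).

Definition cpa_one : cpa := fun x => (pword x == [::])%:R.

(* the basis element of a path, and 0 for a word which is not a path *)
Definition mono (i : V) (w : seq Q1) : cpa := fun x => (val x == (i, w))%:R.

Definition idem (i : V) : cpa := mono i [::].
Definition arr (a : Q1) : cpa := mono (hd a) [:: a].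

Lemma coefE (u : cpa) (x : qpath) : coef u (ptgt x) (pword x) = u x.
Proof.
rewrite /coef /ptgt /pword -surjective_pairing; case: insubP => [y _ /val_inj ->//|].
by rewrite (valP x).
Qed.

Lemma coef_out (u : cpa) i w : ~~ pathb i w -> coef u i w = 0.
Proof. by move=> nw; rewrite /coef insubN. Qed.

Lemma cpaP (u v : cpa) : (forall i w, coef u i w = coef v i w) -> u = v.
Proof. by move=> e; apply/funext => x; rewrite -!coefE e. Qed.

Lemma pathb_cat i w1 w2 :
  pathb i (w1 ++ w2) = pathb i w1 && pathb (src i w1) w2.
Proof.
by elim: w1 i => [|a w1 IH] i //=; rewrite IH andbA.
Qed.

Lemma coefF (u : qpath -> K) i w (p : pathb i w) : coef u i w = u (exist _ (i, w) p).
Proof.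
by rewrite -[RHS]coefE.
Qed.

Lemma coefD (u v : cpa) i w : coef (u + v) i w = coef u i w + coef v i w.
Proof. by rewrite /coef; case: insub => //; rewrite addr0. Qed.

Lemma coefN (u : cpa) i w : coef (- u) i w = - coef u i w.
Proof. by rewrite /coef; case: insub => //; rewrite oppr0. Qed.

Lemma coefZ c (u : cpa) i w : coef (c *: u) i w = c * coef u i w.
Proof. by rewrite /coef; case: insub => //; rewrite mulr0. Qed.

Lemma coef_mono i w j z : pathb i w -> coef (mono i w) j z = ((j, z) == (i, w))%:R.
Proof.
move=> p; rewrite /coef; case: insubP => [x _ <-//|np].
by case: eqP np => // -[-> ->]; rewrite p.
Qed.

Lemma coef_mul (u v : cpa) i w : coef (cpa_mul u v) i w = conv (coef u) (coef v) i w.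
Proof.
have [p|np] := boolP (pathb i w); first by rewrite coefF.
rewrite coef_out // /conv big1 // => n _.
rewrite -(cat_take_drop n w) pathb_cat negb_and in np.
by case/orP: np => /coef_out ->; rewrite ?mul0r ?mulr0.
Qed.

Lemma coef_one i w : coef cpa_one i w = (w == [::])%:R.
Proof.
have [p|np] := boolP (pathb i w); first by rewrite coefF.
by rewrite coef_out //; case: w np.
Qed.

Lemma conv_nil f g i : conv f g i [::] = f i [::] * g i [::].
Proof. by rewrite /conv big_ord_recl big_ord0 addr0. Qed.

Lemma conv_cons f g i a w :
  conv f g i (a :: w) =
  f i [::] * g i (a :: w) + conv (fun _ u => f i (a :: u)) g (tl a) w.
Proof. by rewrite /conv big_ord_recl. Qed.

Lemma eq_conv f f' g g' i w : f i =1 f' i -> (forall j, g j =1 g' j) ->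
  conv f g i w = conv f' g' i w.
Proof. by move=> ef eg; apply: eq_bigr => n _; rewrite ef eg. Qed.

Lemma convDl f f' g i w :
  conv (fun j u => f j u + f' j u) g i w = conv f g i w + conv f' g i w.
Proof. by rewrite -big_split; apply: eq_bigr => n _; rewrite mulrDl. Qed.

Lemma convDr f g g' i w :
  conv f (fun j u => g j u + g' j u) i w = conv f g i w + conv f g' i w.
Proof. by rewrite -big_split; apply: eq_bigr => n _; rewrite mulrDr. Qed.

Lemma convZl c f g i w :
  conv (fun j u => c * f j u) g i w = c * conv f g i w.
Proof. by rewrite /conv mulr_sumr; apply: eq_bigr => n _; rewrite mulrA. Qed.

Lemma convZr c f g i w :
  conv f (fun j u => c * g j u) i w = c * conv f g i w.
Proof. by rewrite /conv mulr_sumr; apply: eq_bigr => n _; rewrite mulrCA. Qed.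

Lemma convA f g h i w : conv f (conv g h) i w = conv (conv f g) h i w.
Proof.
elim: w i f g => [|a w IH] i f g; first by rewrite !conv_nil mulrA.
rewrite !conv_cons IH conv_nil mulrDr mulrA -addrA; congr (_ + _).
rewrite -(convZl (f i [::])) -convDl; apply: eq_conv => // u.
by rewrite conv_cons.
Qed.

Lemma conv1l f i w : conv (fun _ u => (u == [::])%:R) f i w = f i w.
Proof.
case: w => [|a w]; first by rewrite conv_nil mul1r.
rewrite conv_cons mul1r /conv big1 ?addr0 // => n _.
by rewrite mul0r.
Qed.

Lemma conv1r f i w : conv f (fun _ u => (u == [::])%:R) i w = f i w.
Proof.
elim: w i f => [|a w IH] i f; first by rewrite conv_nil mulr1.
by rewrite conv_cons IH mulr0 add0r.
Qed.

Lemma cpa_mulA : associative cpa_mul.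
Proof.
move=> u v w; apply: cpaP => i z; rewrite !coef_mul.
transitivity (conv (coef u) (conv (coef v) (coef w)) i z).
  by apply: eq_conv => // j y; rewrite coef_mul.
by rewrite convA; apply: eq_conv => // y; rewrite coef_mul.
Qed.

Lemma cpa_mul1r : left_id cpa_one cpa_mul.
Proof.
move=> u; apply: cpaP => i z; rewrite coef_mul -[RHS]conv1l.
by apply: eq_conv => // y; rewrite coef_one.
Qed.

Lemma cpa_mulr1 : right_id cpa_one cpa_mul.
Proof.
move=> u; apply: cpaP => i z; rewrite coef_mul -[RHS]conv1r.
by apply: eq_conv => // j y; rewrite coef_one.
Qed.

Lemma cpa_mulDl : left_distributive cpa_mul +%R.
Proof.
move=> u v w; apply: cpaP => i z; rewrite coefD !coef_mul -convDl.
by apply: eq_conv => // y; rewrite coefD.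
Qed.

Lemma cpa_mulDr : right_distributive cpa_mul +%R.
Proof.
move=> u v w; apply: cpaP => i z; rewrite coefD !coef_mul -convDr.
by apply: eq_conv => // j y; rewrite coefD.
Qed.

HB.instance Definition _ := GRing.Zmodule_isPzRing.Build cpa
  cpa_mulA cpa_mul1r cpa_mulr1 cpa_mulDl cpa_mulDr.

Lemma cpa_scalerAl c (u v : cpa) : c *: (u * v) = (c *: u) * v.
Proof.
apply: cpaP => i z; rewrite coefZ !coef_mul -convZl.
by apply: eq_conv => // y; rewrite coefZ.
Qed.

Lemma cpa_scalerAr c (u v : cpa) : c *: (u * v) = u * (c *: v).
Proof.
apply: cpaP => i z; rewrite coefZ !coef_mul -convZr.
by apply: eq_conv => // j y; rewrite coefZ.
Qed.

(* The n-th power of the ideal generated by the arrows consists of the series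
   supported on paths of length at least n. *)
Definition mpow (n : nat) : set cpa :=
  [set u | forall x, (plen x < n)%N -> u x = 0].

Definition madic_closure (X : set cpa) : set cpa :=
  [set u | forall n, exists2 x, X x & mpow n (u - x)].

Definition homogeneous (d : nat) : set cpa :=
  [set u | forall x, u x != 0 -> plen x = d].

Definition potential : set cpa :=
  [set u | forall x, u x != 0 -> (0 < plen x)%N /\ psrc x = ptgt x].

Definition rotation_differences : set cpa :=
  [set u | exists (a : Q1) (w : seq Q1),
     [/\ pathb (hd a) (a :: w), src (hd a) (a :: w) = hd a &
         u = mono (hd a) (a :: w) - mono (tl a) (rcons w a)]].

Definition cyclically_equivalent (S S' : cpa) : Prop :=
  madic_closure (lin_span rotation_differences) (S - S').

Definition wcoef (u : cpa) (w : seq Q1) : K :=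
  if w is a :: _ then coef u (hd a) w else 0.

(* [cyc_deriv p S] is the sum, over the terms a_1 ... a_d of S and the cyclic
   occurrences of the nonempty word p in them, of the complementary paths read
   cyclically starting right after the occurrence. For p = a this is the usual
   cyclic derivative, and for p = ba the second-order one. The term
   a_1 ... a_d and the occurrence of p at position i contribute to
   the coefficient of the path q iff a_i ... a_d a_1 ... a_{i-1} = p q, i.e.,
   a_1 ... a_d is the rotation of p q by some n < d. The vertex test matters
   only when q has length 0. *)
Definition cyc_deriv (p : seq Q1) (S : cpa) : cpa := fun q =>
  if src (ptgt q) p == ptgt q then
    \sum_(n < size (p ++ pword q)) wcoef S (rot n (p ++ pword q))
  else 0.

Lemma coef_idemM i (u : cpa) j w : coef (idem i * u) j w = (j == i)%:R * coef u j w.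
Proof.
rewrite coef_mul /conv big_ord_recl take0 drop0 coef_mono // xpair_eqE andbT.
rewrite big1 ?addr0 // => n _; rewrite coef_mono // xpair_eqE; case: w n => [|a w].
  by case.
by move=> n; rewrite andbF mul0r.
Qed.

Lemma idemM i (u : cpa) : (forall x, u x != 0 -> ptgt x = i) -> idem i * u = u.
Proof.
move=> hu; apply: cpaP => j w; rewrite coef_idemM.
have [p|/coef_out->] := boolP (pathb j w); last by rewrite mulr0.
rewrite (coefF _ p); case: eqP => [_|ne]; first by rewrite mul1r.
by case: (eqVneq (u (exist _ (j, w) p)) 0) => [->|/hu //]; rewrite mulr0.
Qed.

Lemma arr_tgt a x : arr a x != 0 -> ptgt x = hd a.
Proof. by rewrite /arr /mono /ptgt; case: (val x =P _) => [->|]; rewrite ?eqxx. Qed.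

Lemma cyc_deriv_tgt b a S x : cyc_deriv [:: b; a] S x != 0 -> ptgt x = tl a.
Proof. by rewrite /cyc_deriv; case: (src _ _ =P _) => [//|]; rewrite ?eqxx. Qed.

Definition jacobian_ideal (S : cpa) : set cpa :=
  madic_closure (ideal_gen [set cyc_deriv [:: a] S | a in [set: Q1]]).

Definition reduced_pot (S : cpa) : Prop := forall x, plen x = 2%N -> S x = 0.

Definition trivial_pot (S : cpa) : Prop :=
  homogeneous 2 S /\
  lin_span [set cyc_deriv [:: a] S | a in [set: Q1]] = homogeneous 1.

Definition is_QP (S : cpa) : Prop := loop_free /\ potential S.

Lemma mpowD n u v : mpow n u -> mpow n v -> mpow n (u + v).
Proof. by move=> hu hv x lx; rewrite -[LHS]/(u x + v x) (hu x lx) (hv x lx) addr0. Qed.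

Lemma mpowZ n c u : mpow n u -> mpow n (c *: u).
Proof. by move=> hu x lx; rewrite -[LHS]/(c * u x) (hu x lx) mulr0. Qed.

Lemma mpow_coefP n u :
  mpow n u <-> forall i w, (size w < n)%N -> coef u i w = 0.
Proof.
split=> h; last by move=> x lx; rewrite -coefE h.
move=> i w lw; have [p|/coef_out->//] := boolP (pathb i w).
by rewrite (coefF _ p) h.
Qed.

Lemma mpowMl n u v : mpow n v -> mpow n (u * v).
Proof.
move=> /mpow_coefP hv; apply/mpow_coefP => i w lw.
rewrite coef_mul /conv big1 // => j _; rewrite hv ?mulr0 //.
by rewrite size_drop (leq_ltn_trans (leq_subr _ _)).
Qed.

Lemma mpowMr n u v : mpow n u -> mpow n (u * v).
Proof.
move=> /mpow_coefP hu; apply/mpow_coefP => i w lw.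
rewrite coef_mul /conv big1 // => j _; rewrite hu ?mul0r //.
by rewrite size_take_min (leq_ltn_trans (geq_minr _ _)).
Qed.

Section Jacobian.
Variable S : cpa.

Definition jac_pred : {pred cpa} := fun u => `[< jacobian_ideal S u >].

Lemma jac_predP u : reflect (jacobian_ideal S u) (u \in jac_pred).
Proof. exact: asboolP. Qed.

Lemma jac_pred_submod : submod_closed jac_pred.
Proof.
split=> [|c u v /jac_predP hu /jac_predP hv]; apply/jac_predP => n.
  exists 0; first by exists [::]; rewrite ?big_nil //.
  by rewrite subrr.
have [x [s hs ->] hx] := hu n; have [y [t ht ->] hy] := hv n.
set x0 := \sum_(_ <- s) _ in hx *; set y0 := \sum_(_ <- t) _ in hy *.
exists (c *: x0 + y0); last first.
  by rewrite opprD addrACA -scalerBr; apply: mpowD => //; apply: mpowZ.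
exists ([seq (c *: z.1.1, z.1.2, z.2) | z <- s] ++ t).
  by move=> z; rewrite mem_cat => /orP[/mapP[z0 zs ->]|zt]; [exact: hs zs | exact: ht].
rewrite big_cat big_map scaler_sumr; congr (_ + _); apply: eq_bigr => z _ /=.
by rewrite !cpa_scalerAl.
Qed.
HB.instance Definition _ :=
  GRing.isSubmodClosed.Build K cpa jac_pred jac_pred_submod.

Lemma jac_predMl u v : v \in jac_pred -> u * v \in jac_pred.
Proof.
move=> /jac_predP hv; apply/jac_predP => n.
have [y [t ht ->] hy] := hv n; exists (u * \sum_(z <- t) z.1.1 * z.1.2 * z.2).
  exists [seq (u * z.1.1, z.1.2, z.2) | z <- t].
    by move=> z /mapP[z0 zs ->]; exact: ht zs.
  by rewrite big_map mulr_sumr; apply: eq_bigr => z _ /=; rewrite !mulrA.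
by rewrite -mulrBr; apply: mpowMl.
Qed.

Lemma jac_predMr u v : u \in jac_pred -> u * v \in jac_pred.
Proof.
move=> /jac_predP hu; apply/jac_predP => n.
have [y [t ht ->] hy] := hu n; exists ((\sum_(z <- t) z.1.1 * z.1.2 * z.2) * v).
  exists [seq (z.1.1, z.1.2, z.2 * v) | z <- t].
    by move=> z /mapP[z0 zs ->]; exact: ht zs.
  by rewrite big_map mulr_suml; apply: eq_bigr => z _ /=; rewrite !mulrA.
by rewrite -mulrBl; apply: mpowMr.
Qed.

Definition jac : Type := lquot jac_pred.
HB.instance Definition _ := GRing.Lmodule.on jac.

Definition jpi (u : cpa) : jac := lproj jac_pred u.
Lemma jpi_is_linear : linear jpi.
Proof. exact: linearP. Qed.
HB.instance Definition _ := GRing.isLinear.Build K cpa jac _ jpi jpi_is_linear.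

Lemma jpi_surj (x : jac) : {u | x = jpi u}.
Proof. by exists (lrepr x); rewrite /jpi lreprK. Qed.

Definition jac_mul (x y : jac) : jac := jpi (lrepr x * lrepr y).
Definition jac_one : jac := jpi 1.

Lemma jac_mulE u v : jac_mul (jpi u) (jpi v) = jpi (u * v).
Proof.
apply/lprojP; set u' := lrepr _; set v' := lrepr _.
have /lprojP hu : lproj jac_pred u' = lproj jac_pred u by rewrite lreprK.
have /lprojP hv : lproj jac_pred v' = lproj jac_pred v by rewrite lreprK.
have -> : u' * v' - u * v = u' * (v' - v) + (u' - u) * v.
  by rewrite mulrBr mulrBl addrA subrK.
by apply: rpredD; [exact: jac_predMl | exact: jac_predMr].
Qed.

Lemma jac_mulA : associative jac_mul.
Proof.
move=> x y z; case: (jpi_surj x) (jpi_surj y) (jpi_surj z) => u -> [v ->] [w ->].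
by rewrite !jac_mulE mulrA.
Qed.

Lemma jac_mul1r : left_id jac_one jac_mul.
Proof. by move=> x; case: (jpi_surj x) => u ->; rewrite jac_mulE mul1r. Qed.

Lemma jac_mulr1 : right_id jac_one jac_mul.
Proof. by move=> x; case: (jpi_surj x) => u ->; rewrite jac_mulE mulr1. Qed.

Lemma jac_mulDl : left_distributive jac_mul +%R.
Proof.
move=> x y z; case: (jpi_surj x) (jpi_surj y) (jpi_surj z) => u -> [v ->] [w ->].
by rewrite -[jpi u + jpi v]raddfD !jac_mulE mulrDl raddfD.
Qed.

Lemma jac_mulDr : right_distributive jac_mul +%R.
Proof.
move=> x y z; case: (jpi_surj x) (jpi_surj y) (jpi_surj z) => u -> [v ->] [w ->].
by rewrite -[jpi v + jpi w]raddfD !jac_mulE mulrDr raddfD.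
Qed.

HB.instance Definition _ := GRing.Zmodule_isPzRing.Build jac
  jac_mulA jac_mul1r jac_mulr1 jac_mulDl jac_mulDr.

Lemma jpiM u v : jpi (u * v) = jpi u * jpi v.
Proof. by rewrite -jac_mulE. Qed.

Lemma jpiZ c u : jpi (c *: u) = c *: jpi u.
Proof. exact: linearZ. Qed.

Lemma jac_scalerAl c (x y : jac) : c *: (x * y) = (c *: x) * y.
Proof.
case: (jpi_surj x) (jpi_surj y) => u -> [v ->].
by rewrite -jpiM -!jpiZ -jpiM cpa_scalerAl.
Qed.

Lemma jac_scalerAr c (x y : jac) : c *: (x * y) = x * (c *: y).
Proof.
case: (jpi_surj x) (jpi_surj y) => u -> [v ->].
by rewrite -jpiM -!jpiZ -jpiM cpa_scalerAr.
Qed.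

End Jacobian.
End PathAlgebra.

Arguments cpa K {V} Q.
Arguments idem K {V Q} i.
Arguments arr K {V Q} a.
Arguments mono K {V Q} i w.

Section RightEquivalence.
Variables (K : fieldType) (V : finType).

Definition is_right_equivalence (Q Q' : quiver V) (S : cpa K Q) (S' : cpa K Q')
    (phi : cpa K Q -> cpa K Q') : Prop :=
  [/\ linear phi, monoid_morphism phi, bijective phi,
      forall i, phi (idem K i) = idem K i &
      cyclically_equivalent (phi S) S'].

Section Unfold.
Variables (Q Q' : quiver V) (f : arrow Q' -> option (seq (arrow Q))).

Fixpoint unfold_word (w : seq (arrow Q')) : option (seq (arrow Q)) :=
  if w is a :: w' then
    if (f a, unfold_word w') is (Some u, Some u') then Some (u ++ u') else None
  else Some [::].

(* The series over Q' whose coefficient at a path is the coefficient of u at the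
   path over Q obtained by replacing each arrow a of Q' by the word f a, and is
   0 if some f a is undefined. *)
Definition unfold_series (u : cpa K Q) : cpa K Q' := fun x =>
  if unfold_word (pword x) is Some w then coef u (ptgt x) w else 0.
End Unfold.

Section DirectSum.
Variables Q C : quiver V.

Definition dsum_quiver : quiver V := {|
  arrow := (arrow Q + arrow C)%type;
  hd := fun a => match a with inl b => hd b | inr c => hd c end;
  tl := fun a => match a with inl b => tl b | inr c => tl c end |}.

Definition dsum_inl : cpa K Q -> cpa K dsum_quiver :=
  @unfold_series Q dsum_quiver
    (fun a => if a is inl b then Some [:: b] else None).

Definition dsum_inr : cpa K C -> cpa K dsum_quiver :=
  @unfold_series C dsum_quiver
    (fun a => if a is inr c then Some [:: c] else None).

Definition dsum_pot (S : cpa K Q) (T : cpa K C) : cpa K dsum_quiver :=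
  dsum_inl S + dsum_inr T.
End DirectSum.
End RightEquivalence.

Section PreMutationQP.
Variables (K : fieldType) (V : finType) (Q : quiver V) (k : V).
Local Notation Q1 := (arrow Q).

Definition kept_arrow := {c : Q1 | (hd c != k) && (tl c != k)}.
Definition in_arrow := {a : Q1 | hd a == k}.
Definition out_arrow := {b : Q1 | tl b == k}.
Definition hook := (out_arrow * in_arrow)%type.

Definition premut_arrow : finType :=
  (kept_arrow + hook + (in_arrow + out_arrow))%type.

Definition kept (c : kept_arrow) : premut_arrow := inl (inl c).
Definition bracket (h : hook) : premut_arrow := inl (inr h).
Definition in_star (a : in_arrow) : premut_arrow := inr (inl a).
Definition out_star (b : out_arrow) : premut_arrow := inr (inr b).

Definition premut_hd (x : premut_arrow) : V :=
  match x with
  | inl (inl c) => hd (val c)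
  | inl (inr h) => hd (val h.1)
  | inr (inl a) => tl (val a)
  | inr (inr b) => tl (val b)
  end.

Definition premut_tl (x : premut_arrow) : V :=
  match x with
  | inl (inl c) => tl (val c)
  | inl (inr h) => tl (val h.2)
  | inr (inl a) => hd (val a)
  | inr (inr b) => hd (val b)
  end.

Definition premut_quiver : quiver V :=
  {| arrow := premut_arrow; hd := premut_hd; tl := premut_tl |}.

Definition unbracket (x : arrow premut_quiver) : option (seq Q1) :=
  match x with
  | inl (inl c) => Some [:: val c]
  | inl (inr h) => Some [:: val h.1; val h.2]
  | inr _ => None
  end.

Definition no_term_at (S : cpa K Q) : Prop := forall x, S x != 0 -> psrc x != k.

(* [S]: a cyclic path not starting at k is in a unique way a product of arrows
   not incident to k and of k-hooks, so replacing the hooks by the arrows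
   [bracket] is inverse to [unbracket]. *)
Definition bracket_pot (S : cpa K Q) : cpa K premut_quiver :=
  @unfold_series K V Q premut_quiver unbracket S.

Definition premut_pot (S : cpa K Q) : cpa K premut_quiver :=
  bracket_pot S +
  \sum_(h : hook)
    mono K (Q := premut_quiver) k [:: out_star h.1; bracket h; in_star h.2].

End PreMutationQP.

Arguments premut_pot {K V Q} k S.

Section Modules.
Variables (K : fieldType) (V : finType).

Record fdmodule (Q : quiver V) (S : cpa K Q) := FDModule {
  fdm_sort :> vectType K;
  act : jac S -> 'End(fdm_sort);
  act_linear : linear act;
  act1 : act 1 = \1%VF;
  actM : forall x y, act (x * y) = (act x \o act y)%VF
}.

Arguments act {Q S} M x : rename.

Record decorated_rep (Q : quiver V) (S : cpa K Q) := DecoratedRep {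
  dmod : fdmodule S;
  dvec : {ffun V -> nat}
}.

Definition decorated_iso (Q : quiver V) (S : cpa K Q) (M N : decorated_rep S) :
    Prop :=
  (exists2 f : 'Hom(dmod M, dmod N),
     bijective f & forall x m, f (act (dmod M) x m) = act (dmod N) x (f m)) /\
  dvec M = dvec N.

Record jac_hom (Q Q' : quiver V) (S : cpa K Q) (S' : cpa K Q') := JacHom {
  jac_hom_fun :> jac S -> jac S';
  jac_hom_linear : linear jac_hom_fun;
  jac_hom_monoid : monoid_morphism jac_hom_fun
}.

Section Restriction.
Variables (Q Q' : quiver V) (S : cpa K Q) (S' : cpa K Q').
Variables (psi : jac_hom S S') (N : fdmodule S').

Lemma restrict_linear : linear (fun x => act N (psi x)).
Proof. by move=> c x y; rewrite jac_hom_linear act_linear. Qed.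

Lemma restrict1 : act N (psi 1) = \1%VF.
Proof. by rewrite (jac_hom_monoid psi).1 act1. Qed.

Lemma restrictM x y :
  act N (psi (x * y)) = (act N (psi x) \o act N (psi y))%VF.
Proof. by rewrite (jac_hom_monoid psi).2 actM. Qed.

Definition restrict : fdmodule S := FDModule restrict_linear restrict1 restrictM.
End Restriction.

Section Projective.
Variables (Q : quiver V) (S : cpa K Q) (l : V).

Definition projective_pred : {pred jac S} :=
  fun x => `[< exists y, x = y * jpi S (idem K l) >].

Lemma projective_predP x :
  reflect (exists y, x = y * jpi S (idem K l)) (x \in projective_pred).
Proof. exact: asboolP. Qed.

Lemma projective_submod : submod_closed projective_pred.
Proof.
split=> [|c _ _ /projective_predP[x ->] /projective_predP[y ->]].
  by apply/projective_predP; exists 0; rewrite mul0r.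
by apply/projective_predP; exists (c *: x + y); rewrite mulrDl jac_scalerAl.
Qed.
HB.instance Definition _ := GRing.isSubmodClosed.Build K (jac S) projective_pred
  projective_submod.

Record projective := Projective {
  projective_val : jac S;
  projective_valP : projective_val \in projective_pred
}.

HB.instance Definition _ := [isSub for projective_val].
HB.instance Definition _ := [Choice of projective by <:].
HB.instance Definition _ := [SubChoice_isSubZmodule of projective by <:].
HB.instance Definition _ := [SubZmodule_isSubLmodule of projective by <:].

Lemma projective_act_subproof x (m : projective) : x * val m \in projective_pred.
Proof.
case: m => _ /= /projective_predP[y ->].
by apply/projective_predP; exists (x * y); rewrite mulrA.
Qed.

Definition projective_act (x : jac S) (m : projective) : projective :=
  Projective (projective_act_subproof x m).

Lemma projective_act_linear x : linear (projective_act x).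
Proof.
move=> c m n; apply: val_inj.
rewrite -[LHS]/(x * (c *: val m + val n)) -[RHS]/(c *: (x * val m) + x * val n).
by rewrite mulrDr jac_scalerAr.
Qed.

Variable fin : finite_dim projective.
Local Notation P := (fd_vectType fin).

HB.instance Definition _ x :=
  GRing.isLinear.Build K P P _ (projective_act x : P -> P)
    (projective_act_linear x).

Definition projective_rho (x : jac S) : 'End(P) :=
  linfun (projective_act x : P -> P).

Lemma projective_rhoE x m : projective_rho x m = projective_act x m.
Proof. exact: lfunE. Qed.

Lemma projective_rho_linear : linear projective_rho.
Proof.
move=> c x y; apply/lfunP => m.
rewrite add_lfunE scale_lfunE !projective_rhoE; apply: val_inj.
rewrite -[LHS]/((c *: x + y) * val m) -[RHS]/(c *: (x * val m) + y * val m).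
by rewrite mulrDl jac_scalerAl.
Qed.

Lemma projective_rho1 : projective_rho 1 = \1%VF.
Proof.
apply/lfunP => m; rewrite projective_rhoE id_lfunE; apply: val_inj.
exact: mul1r.
Qed.

Lemma projective_rhoM x y :
  projective_rho (x * y) = (projective_rho x \o projective_rho y)%VF.
Proof.
apply/lfunP => m; rewrite comp_lfunE !projective_rhoE; apply: val_inj.
exact/esym/mulrA.
Qed.

Definition projective_module : fdmodule S :=
  FDModule projective_rho_linear projective_rho1 projective_rhoM.

End Projective.

Section PreMutation.
Variables (Q : quiver V) (S : cpa K Q) (k : V) (M : fdmodule S).
Local Notation in_arrow := (in_arrow Q k).
Local Notation out_arrow := (out_arrow Q k).
Local Notation act_path u := (act M (jpi S u)).

Definition comp (j : V) : {vspace M} := limg (act_path (idem K j)).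

Definition in_space : {vspace {ffun in_arrow -> M}} :=
  fam_space (fun a : in_arrow => comp (tl (val a))).

Definition out_space : {vspace {ffun out_arrow -> M}} :=
  fam_space (fun b : out_arrow => comp (hd (val b))).

Definition M_k := subvs_of (comp k).
Definition M_in := subvs_of in_space.
Definition M_out := subvs_of out_space.

Definition alpha : 'Hom(M_in, M_k) := linfun (fun x : M_in =>
  vsproj (comp k) (\sum_a act_path (arr K (val a)) (vsval x a))).

Definition beta : 'Hom(M_k, M_out) := linfun (fun m : M_k =>
  vsproj out_space [ffun b => act_path (arr K (val b)) (vsval m)]).

Definition gamma : 'Hom(M_out, M_in) := linfun (fun y : M_out =>
  vsproj in_space
    [ffun a => \sum_b act_path (cyc_deriv [:: val b; val a] S) (vsval y b)]).

Lemma mem_comp j u m : (forall x, u x != 0 -> ptgt x = j) ->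
  act_path u m \in comp j.
Proof.
by move=> /idemM <-; rewrite jpiM actM comp_lfunE /comp memv_img ?memvf.
Qed.

Lemma alphaE x :
  vsval (alpha x) = \sum_a act_path (arr K (val a)) (vsval x a).
Proof.
rewrite /alpha linfun_linearE => [|c y z]; last first.
  have -> : vsval (c *: y + z) = c *: vsval y + vsval z by exact: linearP.
  rewrite -[RHS]linearP /= scaler_sumr -big_split; congr (vsproj _ _).
  by apply: eq_bigr => a _; rewrite !ffunE linearP.
rewrite vsprojK // memv_suml // => a _; apply: mem_comp => y /arr_tgt ->.
exact/eqP/(valP a).
Qed.

Lemma betaE m :
  vsval (beta m) = [ffun b => act_path (arr K (val b)) (vsval m)].
Proof.
rewrite /beta linfun_linearE => [|c y z]; last first.
  have -> : vsval (c *: y + z) = c *: vsval y + vsval z by exact: linearP.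
  rewrite -[RHS]linearP /=; congr (vsproj _ _); apply/ffunP => b.
  by rewrite !ffunE linearP.
rewrite vsprojK //; apply/fam_spaceP => b; rewrite ffunE.
by apply: mem_comp => y /arr_tgt.
Qed.

Lemma gammaE y :
  vsval (gamma y) = [ffun a =>
    \sum_b act_path (cyc_deriv [:: val b; val a] S) (vsval y b)].
Proof.
rewrite /gamma linfun_linearE => [|c x z]; last first.
  have -> : vsval (c *: x + z) = c *: vsval x + vsval z by exact: linearP.
  rewrite -[RHS]linearP /=; congr (vsproj _ _); apply/ffunP => a.
  rewrite !ffunE scaler_sumr -big_split.
  by apply: eq_bigr => b _; rewrite !ffunE linearP.
rewrite vsprojK //; apply/fam_spaceP => a; rewrite ffunE memv_suml // => b _.
by apply: mem_comp => x /cyc_deriv_tgt.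
Qed.

Definition coker_beta := lquot (pred_of_vspace (limg beta)).

(* ker alpha / im gamma *)
Definition ker_alpha := subvs_of (lker alpha).
Definition homology := lquot (pred_of_vspace
  (linfun (vsval : ker_alpha -> M_in) @^-1: limg gamma)%VS).

Definition coker_proj (y : M_out) : coker_beta := lproj _ y.
Definition homology_proj (x : ker_alpha) : homology := lproj _ x.

(* The map induced by gamma on coker beta; it does not depend on the choice of
   representatives because gamma vanishes on the image of beta. *)
Definition gamma_bar (y : coker_beta) : M_in := gamma (lrepr y).

Definition is_section (sigma : {linear homology -> ker_alpha}) : Prop :=
  forall z, homology_proj (sigma z) = z.

Variables (v : {ffun V -> nat}) (sigma : {linear homology -> ker_alpha}).

Definition rest_space : {vspace M} := (\sum_(j | j != k) comp j)%VS.
Definition Mbar_rest := subvs_of rest_space.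
Definition Mbar_k : lmodType K := (coker_beta * homology * 'rV[K]_(v k))%type.

(* the sum of all the spaces Mbar_j, where Mbar_j = M_j for j != k *)
Definition Mbar : lmodType K := (Mbar_rest * Mbar_k)%type.

Definition Mbar_idem (j : V) (x : Mbar) : Mbar :=
  if j == k then (0, x.2)
  else (vsproj rest_space (act_path (idem K j) (vsval x.1)), 0).

Definition in_star_map (y : Mbar_k) : M_in :=
  gamma_bar y.1.1 + vsval (sigma y.1.2).

Definition out_star_map (y : M_out) : Mbar_k := (- coker_proj y, 0, 0).

Definition out_inj (b : out_arrow) (m : M) : M_out :=
  vsproj out_space [ffun b' => if b' == b then m else 0].

Definition Mbar_arrow (c : arrow (premut_quiver Q k)) (x : Mbar) : Mbar :=
  match c with
  | inl (inl c) =>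
      (vsproj rest_space (act_path (arr K (val c)) (vsval x.1)), 0)
  | inl (inr h) =>
      (vsproj rest_space (act_path (arr K (val h.1))
         (act_path (arr K (val h.2)) (vsval x.1))), 0)
  | inr (inl a) => (vsproj rest_space (vsval (in_star_map x.2) a), 0)
  | inr (inr b) =>
      (0, out_star_map
            (out_inj b (act_path (idem K (hd (val b))) (vsval x.1))))
  end.

Definition vbar : {ffun V -> nat} := [ffun j =>
  if j == k then (\dim (lker beta) - \dim (lker beta :&: limg alpha))%N
  else v j].

End PreMutation.

(* Mt is the premutation of (M, v), a decorated representation of the premutation
   of (Q, S): its underlying module is Mbar with the prescribed action of the
   vertices and of the arrows, which determine the action of every series since
   the module is finite-dimensional. The potential S' is cyclically equivalent
   to S without terms starting at k. *)
Definition is_premutation (Q : quiver V) (S : cpa K Q) (k : V)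
    (M : decorated_rep S) (sigma : {linear homology k (dmod M) -> ker_alpha k (dmod M)})
    (S' : cpa K Q) (Mt : decorated_rep (premut_pot k S')) : Prop :=
  (exists f : {linear Mbar k (dmod M) (dvec M) -> dmod Mt},
     [/\ bijective f,
         forall j x, f (Mbar_idem j x) =
           act (dmod Mt) (jpi (premut_pot k S') (idem K j)) (f x) &
         forall c x, f (Mbar_arrow sigma c x) =
           act (dmod Mt) (jpi (premut_pot k S') (arr K c)) (f x)]) /\
  dvec Mt = vbar k (dmod M) (dvec M).

(* phi exhibits (Q', S') as a reduced part of (Qt, St). *)
Definition is_reduced_part (Qt Q' C : quiver V) (St : cpa K Qt) (S' : cpa K Q')
    (T : cpa K C) (phi : cpa K Qt -> cpa K (dsum_quiver Q' C)) : Prop :=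
  [/\ is_QP S', reduced_pot S', is_QP T, trivial_pot T &
      is_right_equivalence St (dsum_pot S' T) phi].

(* psi is induced by the inclusion of Q' into the direct sum followed by the
   inverse of phi. *)
Definition is_induced (Qt Q' C : quiver V) (St : cpa K Qt) (S' : cpa K Q')
    (phi : cpa K Qt -> cpa K (dsum_quiver Q' C)) (psi : jac_hom S' St) : Prop :=
  forall u w, phi w = dsum_inl u -> psi (jpi S' u) = jpi St w.

(* N is the mutation at k of the decorated representation M of (Q, S), where the
   mutation (Q', S') of (Q, S) is the reduced part, along phi, of the
   premutation of (Q, S1). *)
Definition is_mutation (Q Q' C : quiver V) (S S1 : cpa K Q) (k : V)
    (S' : cpa K Q')
    (phi : cpa K (premut_quiver Q k) -> cpa K (dsum_quiver Q' C))
    (M : decorated_rep S)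
    (sigma : {linear homology k (dmod M) -> ker_alpha k (dmod M)})
    (N : decorated_rep S') : Prop :=
  exists (psi : jac_hom S' (premut_pot k S1))
         (Mt : decorated_rep (premut_pot k S1)),
    [/\ is_induced phi psi, is_premutation sigma Mt &
        N = DecoratedRep (restrict psi (dmod Mt)) (dvec Mt)].

End Modules.

(* Main.v *)
(* Write A for the complete path algebra, L = A/J(S), L~ for the Jacobian algebra
   of the premutation and e for the sum of the idempotents other than e_k.
   Replacing hooks by brackets gives a continuous map e A e -> e A~ e, and
   [ba] |-> ba, a* b* |-> - d_{ba} S gives a continuous map back. They respect the
   Jacobian ideals and are mutually inverse modulo them, since
   d_{[ba]} S~ = [d_{ba} S] + a* b*; hence e L e_l = e L~ e_l for l <> k. At the
   vertex k, the map sending the class of (y_b) to - sum b* [y_b] identifies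
   coker beta with e_k L~ e_l. If M = L e_l is finite-dimensional, a power of the
   arrow ideal annihilates e_l, and then M_out -> M_in -> M_k -> 0 is exact for
   gamma and alpha, so the premutation of M has nothing else at k and no
   decoration: it is L~ e_l. The reduction step is restriction along an algebra
   isomorphism fixing the idempotents, obtained from the chain rule for cyclic
   derivatives and from the fact that a trivial summand of a potential puts its
   arrows in the Jacobian ideal. *)

From Pilot Require Import Defs.
From HB Require Import structures.
From mathcomp Require Import all_boot all_order all_algebra.
From mathcomp Require Import boolp classical_sets.
From mathcomp Require Import reals complex.

Set Implicit Arguments.
Unset Strict Implicit.
Unset Printing Implicit Defensive.

Import GRing.Theory Pilot.Defs.
Local Open Scope ring_scope.

(** * Complete path algebras *)

(** The obstacle is that J(S) is a closure: its elements are limits of sums of products x d_a(S) y,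
    not such sums. Linear identities and membership in a Jacobian ideal survive limits, so they are
    checked on paths and extended by continuity. The existence statements behind exactness at M_in
    and injectivity on coker beta need not survive limits. They hold because a power of the arrow
    ideal kills e_l, which leaves finitely many terms to treat; that power exists because the images
    of the powers of the arrow ideal decrease in a finite-dimensional space and have intersection 0.
    Surjectivity onto M_k and onto e_k L~ e_l has another source, l <> k: a series from l to k has
    no constant term and can be divided on the left by arrows. The absence of 2-cycles at k enters
    twice: no [ba] is a loop, and no d_{ba} S has a constant term, so that the substitution for a*
    b* converges. Hooks must not be cut at k, so the maps between algebras are multiplicative only
    on corners; a relation with an end at k is seen there after multiplication by one more arrow at
    k. Continuity of a right-equivalence is derived from the absence of loops. *)

Section LinearFunctions.
Variables (K : pzRingType) (U W : lmodType K) (F : U -> W).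
Hypothesis lF : linear F.

Lemma lin0 : F 0 = 0.
Proof. by have := lF (-1) 0 0; rewrite !scaleN1r oppr0 addr0 addNr. Qed.

Lemma linD u v : F (u + v) = F u + F v.
Proof. by have := lF 1 u v; rewrite !scale1r. Qed.

Lemma linZ c u : F (c *: u) = c *: F u.
Proof. by have := lF c u 0; rewrite lin0 !addr0. Qed.

Lemma linN u : F (- u) = - F u.
Proof. by rewrite -scaleN1r linZ scaleN1r. Qed.

Lemma linB u v : F (u - v) = F u - F v.
Proof. by rewrite linD linN. Qed.

Lemma lin_sum (I : Type) (r : seq I) (P : pred I) (E : I -> U) :
  F (\sum_(i <- r | P i) E i) = \sum_(i <- r | P i) F (E i).
Proof. exact: (big_morph F linD lin0). Qed.
End LinearFunctions.

Section PathAlgebraBasics.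
Variables (K : fieldType) (V : finType) (Q : quiver V).
Local Notation Q1 := (arrow Q).
Local Notation A := (cpa K Q).
Local Notation mono := (@mono K V Q).
Local Notation arr := (@arr K V Q).
Local Notation idem := (@idem K V Q).
Implicit Types (u v : A) (i j : V) (w : seq Q1) (a b c : Q1).

Lemma coef0 i w : coef (0 : A) i w = 0.
Proof. by rewrite /coef; case: insub. Qed.

Lemma coefB u v i w : coef (u - v) i w = coef u i w - coef v i w.
Proof. by rewrite coefD coefN. Qed.

Lemma coef_sum (I : Type) (r : seq I) (P : pred I) (E : I -> A) i w :
  coef (\sum_(t <- r | P t) E t) i w = \sum_(t <- r | P t) coef (E t) i w.
Proof.
exact: (big_morph (fun u => coef u i w) (fun x y => coefD x y i w) (coef0 i w)).
Qed.

Lemma coefM u v i w : coef (u * v) i w = conv (coef u) (coef v) i w.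
Proof. exact: coef_mul. Qed.

Lemma coef1 i w : coef (1 : A) i w = (w == [::])%:R.
Proof. exact: coef_one. Qed.

Lemma coef_idemMr u i j w :
  coef (u * idem i) j w = (src j w == i)%:R * coef u j w.
Proof.
rewrite coefM /conv (bigD1 ord_max) //= take_size drop_size coef_mono //.
rewrite xpair_eqE eqxx andbT mulrC big1 ?addr0 // => n.
rewrite -val_eqE /= => ne.
rewrite coef_mono // xpair_eqE andbC -size_eq0 size_drop subn_eq0 leqNgt.
by rewrite ltn_neqAle ne -ltnS ltn_ord /= mulr0.
Qed.

Lemma pathb_rcons i w a :
  pathb i (rcons w a) = pathb i w && (hd a == src i w).
Proof. by rewrite -cats1 pathb_cat /= andbT. Qed.

Lemma src_cat i w1 w2 : src i (w1 ++ w2) = src (src i w1) w2.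
Proof. by rewrite /src map_cat last_cat. Qed.

Lemma src_rcons i w a : src i (rcons w a) = tl a.
Proof. by rewrite /src map_rcons last_rcons. Qed.

Lemma mono_out i w : ~~ pathb i w -> mono i w = 0.
Proof.
move=> np; apply/funext => x; rewrite /Defs.mono; case: eqP => // e.
by move: (valP x); rewrite e (negPf np).
Qed.

Lemma coef_arrM a u i w :
  coef (arr a * u) i w =
  if w is c :: z then if (c == a) && (i == hd a) then coef u (tl a) z else 0 else 0.
Proof.
have pa : pathb (hd a) [:: a] by rewrite /= eqxx.
rewrite coefM; case: w => [|c z]; rewrite ?conv_nil ?conv_cons.
  by rewrite coef_mono // xpair_eqE andbF mul0r.
rewrite coef_mono // xpair_eqE andbF mul0r add0r /conv big_ord_recl take0 drop0 /=.
rewrite big1 ?addr0; last first.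
  case: z => [[[]]//|d z] n _; rewrite coef_mono //= xpair_eqE eqseq_cons /=.
  by rewrite !andbF mul0r.
rewrite coef_mono // xpair_eqE eqseq_cons andbT andbC.
by case: (c =P a) => [->|_] /=; case: (i =P hd a) => _ /=; rewrite ?mul1r ?mul0r.
Qed.

Lemma mono_arrM a w : mono (hd a) (a :: w) = arr a * mono (tl a) w.
Proof.
have [p|np] := boolP (pathb (tl a) w); last first.
  by rewrite !mono_out ?mulr0 //= eqxx.
apply: cpaP => i [|c z]; rewrite coef_arrM coef_mono /= ?eqxx //.
  by rewrite xpair_eqE andbF.
rewrite xpair_eqE eqseq_cons andbCA andbA.
case: (c =P a) => _ //=; case: (i =P hd a) => _ //=.
by rewrite coef_mono // xpair_eqE eqxx.
Qed.

Lemma mono_cat i w1 w2 :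
  pathb i w1 -> mono i w1 * mono (src i w1) w2 = mono i (w1 ++ w2).
Proof.
elim: w1 i => [|a w IH] i /=.
  move=> _; apply: cpaP => j z; rewrite coef_idemM.
  have [p|np] := boolP (pathb i w2); last by rewrite mono_out // coef0 mulr0.
  by rewrite !coef_mono // xpair_eqE; case: eqP => _; rewrite ?mul1r ?mul0r.
case/andP => /eqP <- p.
by rewrite !mono_arrM -mulrA -[src _ (a :: w)]/(src (tl a) w) IH.
Qed.

Lemma mono_rcons i w a : pathb i w -> src i w = hd a ->
  mono i (rcons w a) = mono i w * arr a.
Proof. by move=> p e; rewrite -cats1 -mono_cat // e. Qed.

Lemma idem_mono i j w : idem j * mono i w = (i == j)%:R *: mono i w.
Proof.
apply: cpaP => h z; rewrite coef_idemM coefZ.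
have [p|np] := boolP (pathb i w); last by rewrite mono_out // coef0 !mulr0.
rewrite coef_mono // xpair_eqE.
by case: (h =P i) => [->//|_]; rewrite /= !mulr0.
Qed.

Lemma mono_idem i j w : mono i w * idem j = (src i w == j)%:R *: mono i w.
Proof.
apply: cpaP => h z; rewrite coef_idemMr coefZ.
have [p|np] := boolP (pathb i w); last by rewrite mono_out // coef0 !mulr0.
rewrite coef_mono // xpair_eqE.
case: (h =P i) => [->|_]; rewrite /= ?mulr0 //.
by case: (z =P w) => [->|_]; rewrite /= ?mulr0.
Qed.

Lemma idem_arr j a : idem j * arr a = (hd a == j)%:R *: arr a.
Proof. exact: idem_mono. Qed.

Lemma arr_idem j a : arr a * idem j = (tl a == j)%:R *: arr a.
Proof. exact: mono_idem. Qed.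

Lemma idem_idem i j : idem i * idem j = (i == j)%:R *: idem i.
Proof. exact: mono_idem. Qed.

Lemma idemK i : idem i * idem i = idem i.
Proof. by rewrite idem_idem eqxx scale1r. Qed.

Lemma idem_arrK a : idem (hd a) * arr a = arr a.
Proof. by rewrite idem_arr eqxx scale1r. Qed.

Lemma arr_idemK a : arr a * idem (tl a) = arr a.
Proof. by rewrite arr_idem eqxx scale1r. Qed.

Lemma cpa_scaleAl (c : K) u v : c *: (u * v) = (c *: u) * v.
Proof. exact: cpa_scalerAl. Qed.

Lemma cpa_scaleAr (c : K) u v : c *: (u * v) = u * (c *: v).
Proof. exact: cpa_scalerAr. Qed.

Lemma arr_arr0 a b : tl a != hd b -> arr a * arr b = 0.
Proof.
move=> ne; rewrite -(arr_idemK a) -mulrA idem_arr eq_sym (negPf ne) scale0r.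
by rewrite mulr0.
Qed.

Lemma mpow0 u : mpow 0 u.
Proof. by []. Qed.

Lemma mpow_le m n u : (m <= n)%N -> mpow n u -> mpow m u.
Proof. by move=> le h x lx; apply: h; apply: leq_trans le. Qed.

Lemma mpow_zero n : mpow n (0 : A).
Proof. by []. Qed.

Lemma mpowN n u : mpow n u -> mpow n (- u).
Proof. by rewrite -scaleN1r; apply: mpowZ. Qed.

Lemma mpowB n u v : mpow n u -> mpow n v -> mpow n (u - v).
Proof. by move=> hu hv; apply: mpowD => //; apply: mpowN. Qed.

Lemma mpow_sum n (I : Type) (r : seq I) (P : pred I) (E : I -> A) :
  (forall t, P t -> mpow n (E t)) -> mpow n (\sum_(t <- r | P t) E t).
Proof.
move=> h; elim/big_rec: _ => [|t x Pt hx]; first exact: mpow_zero.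
by apply: mpowD => //; apply: h.
Qed.

Lemma mpowM m n u v : mpow m u -> mpow n v -> mpow (m + n) (u * v).
Proof.
move=> /mpow_coefP hu /mpow_coefP hv; apply/mpow_coefP => i w lw.
rewrite coefM /conv big1 // => -[t lt] _ /=.
have [ltm|lemt] := ltnP (size (take t w)) m; first by rewrite hu ?mul0r.
rewrite hv ?mulr0 // -(ltn_add2l m) (leq_ltn_trans _ lw) //.
by rewrite -[in X in (_ <= X)%N](cat_take_drop t w) size_cat leq_add2r.
Qed.

Lemma mpow_mono n i w : (n <= size w)%N -> mpow n (mono i w).
Proof.
move=> le x lx; rewrite /Defs.mono; case: eqP => // e.
by move: lx; rewrite /plen /pword e /= ltnNge le.
Qed.

Lemma mpow_arr a : mpow 1 (arr a).
Proof. exact: mpow_mono. Qed.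

Lemma mpow_eq0 u : (forall n, mpow n u) -> u = 0.
Proof. by move=> h; apply/funext => x; apply: (h (plen x).+1). Qed.

(** Left division by [a]: the paths beginning with [a], with that letter removed. The test on
    [ptgt x] matters only for the empty word, which is a path at every vertex. *)
Definition left_quot a u : A :=
  fun x => if ptgt x == tl a then coef u (hd a) (a :: pword x) else 0.

Lemma coef_left_quot a u i w :
  coef (left_quot a u) i w = if i == tl a then coef u (hd a) (a :: w) else 0.
Proof.
have [p|np] := boolP (pathb i w); first by rewrite coefF.
rewrite coef_out //; case: eqP => // ei.
by rewrite coef_out //= eqxx -ei.
Qed.

Lemma mpow_left_quot n a u : mpow n.+1 u -> mpow n (left_quot a u).
Proof.
move=> /mpow_coefP h; apply/mpow_coefP => i w lw; rewrite coef_left_quot.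
by case: eqP => // _; rewrite h.
Qed.

Lemma left_quot_tgt a u : idem (tl a) * left_quot a u = left_quot a u.
Proof.
by apply: idemM => x; rewrite /left_quot; case: (ptgt x =P _) => // _ /eqP.
Qed.

Lemma left_quot_arrM a b u :
  left_quot b (arr a * u) = if a == b then idem (tl a) * u else 0.
Proof.
apply: cpaP => i w; rewrite coef_left_quot coef_arrM [b == a]eq_sym.
case: (a =P b) => [->|_] /=; last by rewrite coef0; case: eqP.
rewrite eqxx coef_idemM; case: eqP => [->|_]; by rewrite ?mul1r ?mul0r.
Qed.

(** The arrow ideal is the direct sum of the right ideals generated by the arrows, and [left_quot]
    gives the components. Both exactness arguments at k compare these components. *)
Lemma left_quotE u : mpow 1 u -> u = \sum_a arr a * left_quot a u.
Proof.
move=> /mpow_coefP h; apply: cpaP => i w; rewrite coef_sum; case: w => [|c z].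
  by rewrite h // big1 // => a _; rewrite coef_arrM.
have [/eqP ei|ne] := boolP (i == hd c); last first.
  rewrite coef_out /=; last by rewrite eq_sym (negPf ne).
  rewrite big1 // => a _; rewrite coef_arrM; case: eqP => //= <-.
  by rewrite (negPf ne).
rewrite (bigD1 c) //= big1 ?addr0; last first.
  by move=> a ne; rewrite coef_arrM eq_sym (negPf ne).
by rewrite coef_arrM eqxx ei eqxx /= coef_left_quot eqxx.
Qed.

Lemma left_quot_linear a : linear (left_quot a).
Proof.
move=> c u v; apply: cpaP => i w; rewrite coefD coefZ !coef_left_quot coefD coefZ.
by case: eqP => _; rewrite ?mulr0 ?addr0.
Qed.

Lemma left_quotM a u v : mpow 1 u -> left_quot a (u * v) = left_quot a u * v.
Proof.
move=> /left_quotE ->; rewrite mulr_suml !(lin_sum (left_quot_linear a)) mulr_suml.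
apply: eq_bigr => b _; rewrite -mulrA !left_quot_arrM.
by case: eqP; rewrite ?mulrA ?mul0r.
Qed.

(** Paths of length 0 join a vertex to itself. For the vertices k and l this lets every series from
    l to k be divided by its leftmost arrows. *)
Lemma mpow_corner i j u : i != j -> mpow 1 (idem i * (u * idem j)).
Proof.
move=> ne; apply/mpow_coefP => h w; rewrite ltnS leqn0 size_eq0 => /eqP ->.
rewrite coef_idemM coef_idemMr /src /=; case: (h =P i) => [->|_]; last by rewrite mul0r.
by rewrite (negPf ne) mul0r mulr0.
Qed.

(** Words of length at most [n] form a finite type, from which the paths are selected by [insub]. *)
Definition paths_lt n : seq (qpath Q) :=
  [seq x <- pmap (fun y : V * n.-bseq Q1 => insub (y.1, bseqval y.2))
      (enum {: V * n.-bseq Q1}) | (plen x < n)%N].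

Lemma mem_paths_lt n (x : qpath Q) : (x \in paths_lt n) = (plen x < n)%N.
Proof.
rewrite /paths_lt mem_filter andb_idr // => lx; rewrite mem_pmap; apply/mapP.
have lx' : (size (val x).2 <= n)%N by apply: ltnW.
exists ((val x).1, Bseq lx'); first by rewrite mem_enum.
by rewrite /= -surjective_pairing valK.
Qed.

Lemma uniq_paths_lt n : uniq (paths_lt n).
Proof.
apply: filter_uniq; apply: (pmap_uniq (g := fun x : qpath Q =>
  (ptgt x, insub_bseq n (pword x)))); last exact: enum_uniq.
move=> [i w] /=; case: insubP => [y _ e|_] //=.
rewrite /ptgt /pword e /=; congr (_, _); apply: val_inj.
by rewrite /insub_bseq insubdK //; apply: size_bseq.
Qed.

Definition qmono (x : qpath Q) : A := mono (ptgt x) (pword x).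

Lemma qmonoE (x y : qpath Q) : qmono x y = (y == x)%:R.
Proof. by rewrite /qmono /Defs.mono -surjective_pairing. Qed.

Lemma sum_cpaE (I : Type) (r : seq I) (P : pred I) (E : I -> A) (x : qpath Q) :
  (\sum_(t <- r | P t) E t) x = \sum_(t <- r | P t) E t x.
Proof. by elim/big_rec2: _ => // t y1 y2 _ <-. Qed.

(** Finite combinations of paths are dense; every passage from paths to series below rests on
    this. *)
Lemma mpow_truncation n u :
  mpow n (u - \sum_(x <- paths_lt n) u x *: qmono x).
Proof.
move=> x lx; have mx : x \in paths_lt n by rewrite mem_paths_lt.
rewrite -[LHS]/(u x - (\sum_(x <- paths_lt n) u x *: qmono x) x) sum_cpaE.
rewrite (bigD1_seq x) ?uniq_paths_lt //= big1 ?addr0 => [|y ne].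
  by rewrite -[X in _ - X]/(u x * qmono x x) qmonoE eqxx mulr1 subrr.
by rewrite -[LHS]/(u y * qmono y x) qmonoE eq_sym (negPf ne) mulr0.
Qed.

End PathAlgebraBasics.

(** * Approximation by finite sums and the closed Jacobian ideal *)

Section Density.
Variables (K : fieldType) (V : finType).

(** Continuity at 0, which for a linear map is continuity. *)
Definition madic_continuous (Q1 Q2 : quiver V) (F : cpa K Q1 -> cpa K Q2) :=
  forall n, exists m, forall u, mpow m u -> mpow n (F u).

Lemma jac_closed (Q : quiver V) (S u : cpa K Q) :
  (forall n, exists2 x, x \in jac_pred S & mpow n (u - x)) -> u \in jac_pred S.
Proof.
move=> h; apply/jac_predP => n; have [x /jac_predP /(_ n)[y yI hy] hx] := h n.
by exists y => //; rewrite -(subrKA x); apply: mpowD.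
Qed.

Lemma jac_gen (Q : quiver V) (S : cpa K Q) a : cyc_deriv [:: a] S \in jac_pred S.
Proof.
apply/jac_predP => n; exists (cyc_deriv [:: a] S); last by rewrite subrr.
exists [:: (1, cyc_deriv [:: a] S, 1)]; first by move=> t; rewrite inE => /eqP ->; exists a.
by rewrite big_seq1 mul1r mulr1.
Qed.

Section Closed.
Variables (Q1 Q2 : quiver V) (S2 : cpa K Q2) (F : cpa K Q1 -> cpa K Q2).
Hypotheses (lF : linear F) (cF : madic_continuous F).

Lemma density_jac (u : cpa K Q1) :
  (forall x, u x != 0 -> F (qmono K x) \in jac_pred S2) -> F u \in jac_pred S2.
Proof.
move=> h; apply: jac_closed => n; have [m hm] := cF n.
set t := \sum_(x <- paths_lt Q1 m) u x *: qmono K x.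
exists (F t); last by rewrite -(linB lF); apply: hm; apply: mpow_truncation.
rewrite (lin_sum lF) rpred_sum // => x _; rewrite (linZ lF).
by have [->|/h hx] := eqVneq (u x) 0; rewrite ?scale0r ?rpred0 ?rpredZ.
Qed.

End Closed.


Lemma cont_comp (Q1 Q2 Q3 : quiver V) (F : cpa K Q1 -> cpa K Q2)
    (G : cpa K Q2 -> cpa K Q3) :
  madic_continuous F -> madic_continuous G -> madic_continuous (fun u => G (F u)).
Proof.
move=> cF cG n; have [m hm] := cG n; have [m' hm'] := cF m.
by exists m' => u /hm'/hm.
Qed.

Lemma cont_mull (Q : quiver V) (p : cpa K Q) : madic_continuous (fun u : cpa K Q => p * u).
Proof. by move=> n; exists n => u; apply: mpowMl. Qed.

Lemma cont_mulr (Q : quiver V) (p : cpa K Q) : madic_continuous (fun u : cpa K Q => u * p).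
Proof. by move=> n; exists n => u; apply: mpowMr. Qed.

Lemma mull_linear (Q : quiver V) (p : cpa K Q) : linear (fun u : cpa K Q => p * u).
Proof. by move=> c u v; rewrite mulrDr -cpa_scaleAr. Qed.

Lemma mulr_linear (Q : quiver V) (p : cpa K Q) : linear (fun u : cpa K Q => u * p).
Proof. by move=> c u v; rewrite mulrDl -cpa_scaleAl. Qed.

Lemma comp_linear (U1 U2 U3 : lmodType K) (F : U1 -> U2) (G : U2 -> U3) :
  linear F -> linear G -> linear (fun u => G (F u)).
Proof. by move=> lF lG c u v; rewrite lF lG. Qed.

(** A linear predicate containing a power of the arrow ideal is open, so it needs to be checked only
    on products of a path, a cyclic derivative and a path. No closedness is asked of [P], which may
    therefore be an existence statement. *)
Lemma jac_span_ind (Q : quiver V) (S : cpa K Q) (P : cpa K Q -> Prop) :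
  (forall c u v, P u -> P v -> P (c *: u + v)) ->
  (exists n, forall u, mpow n u -> P u) ->
  (forall a x y, P (qmono K x * cyc_deriv [:: a] S * qmono K y)) ->
  forall u, u \in jac_pred S -> P u.
Proof.
move=> lP [n Pn] PS u /jac_predP uJ.
have P0 : P 0 by apply: Pn.
(* The series on either side of a derivative are replaced by paths: a tail in [mpow n] stays there
   under multiplication and satisfies [P] by hypothesis. *)
have Pdense (F : cpa K Q -> cpa K Q) : linear F ->
    (forall v, mpow n v -> mpow n (F v)) -> (forall x, P (F (qmono K x))) ->
    forall v, P (F v).
  move=> lF cF PF v; rewrite -(subrK (\sum_(x <- paths_lt Q n) v x *: qmono K x) v).
  rewrite -[_ - _]scale1r lF; apply: (lP); first exact/Pn/cF/mpow_truncation.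
  rewrite (lin_sum lF); elim/big_rec: _ => // x w _ Pw.
  by rewrite (linZ lF); apply: (lP).
have [_ [s sG ->]] := uJ n; set t := \sum_(_ <- s) _ => hs.
rewrite -(subrK t u) -[u - t]scale1r; apply: (lP); first exact: Pn.
rewrite /t big_seq; elim/big_rec: _ => // -[[p d] q] w /sG [a _ /= <-] Pw {d}.
rewrite -[_ * q]scale1r; apply: (lP) => //.
apply: (Pdense (fun v => v * cyc_deriv [:: a] S * q)) => [|v hv|x].
- by move=> e v1 v2; rewrite !mulrDl -!cpa_scaleAl.
- by do 2!apply: mpowMr.
apply: (Pdense (fun v => qmono K x * cyc_deriv [:: a] S * v)) => [|v hv|y].
- exact: mull_linear.
- exact: mpowMl.
exact: PS.
Qed.

Lemma jac_ind (Q1 Q2 : quiver V) (S1 : cpa K Q1) (S2 : cpa K Q2)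
    (F : cpa K Q1 -> cpa K Q2) :
  linear F -> madic_continuous F ->
  (forall a x y,
     F (qmono K x * cyc_deriv [:: a] S1 * qmono K y) \in jac_pred S2) ->
  forall u, u \in jac_pred S1 -> F u \in jac_pred S2.
Proof.
move=> lF cF h u uJ; apply: jac_closed => n.
(* Membership in the ideal need not be an open condition, but lying within [mpow n] of it is, so the
   induction applies for each [n]. *)
pose P u := exists2 x, x \in jac_pred S2 & mpow n (F u - x).
apply: (jac_span_ind (P := P)) uJ => [c v w [x xJ hx] [y yJ hy]||a x y].
- exists (c *: x + y); first by rewrite rpredD // rpredZ.
  by rewrite lF opprD addrACA -scalerBr; apply: mpowD => //; apply: mpowZ.
- have [m hm] := cF n; exists m => v hv; exists 0; first exact: rpred0.
  by rewrite subr0; apply: hm.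
- by exists (F (qmono K x * cyc_deriv [:: a] S1 * qmono K y)); rewrite ?h ?subrr.
Qed.

Lemma density_eq (Q1 Q2 : quiver V) (F G : cpa K Q1 -> cpa K Q2) (u : cpa K Q1) :
  linear F -> linear G -> madic_continuous F -> madic_continuous G ->
  (forall x, u x != 0 -> F (qmono K x) = G (qmono K x)) -> F u = G u.
Proof.
move=> lF lG cF cG h; apply/eqP; rewrite -subr_eq0; apply/eqP/mpow_eq0 => n.
have [m1 h1] := cF n; have [m2 h2] := cG n; set m := maxn m1 m2.
set t := \sum_(x <- paths_lt Q1 m) u x *: qmono K x.
have tE : mpow m (u - t) by apply: mpow_truncation.
have -> : F u - G u = F (u - t) - G (u - t).
  have e : F t = G t.
    rewrite (lin_sum lF) (lin_sum lG); apply: eq_bigr => x _; rewrite (linZ lF) (linZ lG).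
    by have [->|/h ->//] := eqVneq (u x) 0; rewrite !scale0r.
  by rewrite (linB lF) (linB lG) e opprB addrA subrK.
by apply: mpowB; [apply: h1|apply: h2]; apply: mpow_le tE; rewrite ?leq_maxl ?leq_maxr.
Qed.

End Density.

(** * Continuous linear maps defined on paths *)

Section Extension.
Variables (K : fieldType) (V : finType) (Q1 Q2 : quiver V).
Variable F : qpath Q1 -> cpa K Q2.

(* The linear map sending each path x to F x; the sum defining a coefficient
   is finite as soon as F x lies deep in the m-adic filtration when x is long. *)
Definition lin_ext (u : cpa K Q1) : cpa K Q2 :=
  fun y => \sum_(x <- paths_lt Q1 (plen y).+1.*2) u x * F x y.

Lemma lin_ext_linear : linear lin_ext.
Proof.
move=> c u v; apply/funext => y; rewrite /lin_ext.
rewrite -[RHS]/(c * \sum_(x <- paths_lt Q1 (plen y).+1.*2) u x * F x y +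
  \sum_(x <- paths_lt Q1 (plen y).+1.*2) v x * F x y).
rewrite mulr_sumr -big_split; apply: eq_bigr => x _ /=.
by rewrite mulrA -mulrDl.
Qed.

Lemma lin_ext_mpow n u : (forall x, mpow n (F x)) -> mpow n (lin_ext u).
Proof. by move=> h y ly; rewrite /lin_ext big1 // => x _; rewrite h ?mulr0. Qed.

(** Paths of length at least [(plen y).+1.*2] then contribute nothing at [y]. The factor 2 leaves
    room for both uses: removing one letter from a word, and replacing each pair a* b* by a series
    that may start in length 1. *)
Hypothesis growth : forall n x, (n.*2 <= plen x)%N -> mpow n (F x).

Lemma lin_ext_qmono x : lin_ext (qmono K x) = F x.
Proof.
apply/funext => y; rewrite /lin_ext.
under eq_bigr => z _ do rewrite qmonoE.
have [lx|lx] := ltnP (plen x) (plen y).+1.*2.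
  rewrite (bigD1_seq x) ?uniq_paths_lt ?mem_paths_lt //= eqxx mul1r.
  by rewrite big1 ?addr0 // => z /negPf->; rewrite mul0r.
rewrite (growth lx) // big_seq big1 // => z; rewrite mem_paths_lt => lz.
by case: eqP lz => [->|_ _]; rewrite ?mul0r // ltnNge lx.
Qed.

Lemma lin_ext_cont : madic_continuous lin_ext.
Proof.
move=> n; exists n.*2 => u hu y ly; rewrite /lin_ext big_seq big1 // => x.
rewrite mem_paths_lt => lx; rewrite hu ?mul0r //.
by apply: leq_trans lx _; rewrite leq_double.
Qed.
End Extension.

Lemma lin_ext_linear_arg (K : fieldType) (V : finType) (Q1 Q2 : quiver V)
    (F : cpa K Q2 -> qpath Q1 -> cpa K Q2) (u : cpa K Q1) :
  (forall x, linear (fun f => F f x)) -> linear (fun f => lin_ext (F f) u).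
Proof.
move=> lF c f g; apply/funext => y; rewrite /lin_ext.
rewrite -[RHS]/(c * \sum_(x <- paths_lt Q1 (plen y).+1.*2) u x * F f x y +
  \sum_(x <- paths_lt Q1 (plen y).+1.*2) u x * F g x y).
rewrite mulr_sumr -big_split; apply: eq_bigr => x _ /=.
by rewrite lF -[(_ *: F f x + F g x) y]/(c * F f x y + F g x y) mulrDr mulrCA.
Qed.

(** * Sums over the rotations of a word *)

Section RotationSums.
Variables (T : eqType) (Z : nmodType).

Definition rotsum (f : seq T -> Z) (x : seq T) : Z :=
  \sum_(n < size x) f (rot n x).

Lemma rotsum_rot f m x : rotsum f (rot m x) = rotsum f x.
Proof.
have rot1E y : rotsum f (rot 1 y) = rotsum f y.
  rewrite /rotsum size_rot; case: y => [|a z]; first by rewrite !big_ord0.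
  set y := a :: z; rewrite -[size y]/(size z).+1 big_ord_recr big_ord_recl /=.
  rewrite -(rotD (m := size z)) ?addn1 // -[(size z).+1]/(size y) rot_size rot0.
  rewrite addrC; congr (_ + _); apply: eq_bigr => n _; rewrite -rotD addn1 ?ltnS //.
  exact: ltnW.
elim: m => [|m IH]; first by rewrite rot0.
have [lt|le] := ltnP m (size x); first by rewrite rotS // rot1E.
by rewrite rot_oversize // ltnW.
Qed.

Lemma rotsum_comp_rot f m x : rotsum (fun y => f (rot m y)) x = rotsum f x.
Proof.
rewrite -[RHS](rotsum_rot f m) /rotsum size_rot.
by apply: eq_bigr => n _; rewrite rot_rot.
Qed.

End RotationSums.

(** A rotation carries [x] to [y] exactly when the complementary rotation carries [y] back to
    [x]. *)
Lemma rotsum_eq_sym (T : eqType) (R : pzSemiRingType) (x y : seq T) :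
  rotsum (fun z => (z == y)%:R : R) x = rotsum (fun z => (z == x)%:R) y.
Proof.
have [e|ne] := eqVneq (size x) (size y); last first.
  rewrite /rotsum !big1 // => n _; case: eqP => // h; case/eqP: ne.
    by rewrite -h size_rot.
  by rewrite -h size_rot.
(* Reversal turns [n] into [size y - n.+1]; rotating [y] once beforehand makes up for the missing
   step. *)
rewrite -[RHS](rotsum_rot _ 1) /rotsum size_rot -e (reindex_inj rev_ord_inj) /=.
apply: eq_bigr => n _; congr (_%:R); rewrite -rotD addn1 -?e //.
by rewrite (can2_eq (rotK _) (rotrK _)) /rotr -e subKn // eq_sym.
Qed.

(** * Cyclic derivatives *)

Section CyclicWords.
Variables (K : fieldType) (V : finType) (Q : quiver V).
Local Notation Q1 := (arrow Q).
Local Notation A := (cpa K Q).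
Local Notation mono := (@mono K V Q).
Local Notation arr := (@arr K V Q).
Local Notation idem := (@idem K V Q).
Local Notation dd a := (cyc_deriv [:: a]).
Implicit Types (u v S : A) (i j : V) (w y z p q : seq Q1) (a b c : Q1).

Definition composable : rel Q1 := fun a b => tl a == hd b.

Lemma pathb_path a w : pathb (tl a) w = path composable a w.
Proof.
elim: w a => [|b w IH] a //=.
by rewrite IH /composable eq_sym.
Qed.

Lemma src_last a w : src (tl a) w = tl (last a w).
Proof. by rewrite /src (last_map (@tl V Q)). Qed.

(** As a cycle for [composable], a closed path can be rotated freely, without keeping track of base
    points. *)
Lemma cycle_pathb a w :
  cycle composable (a :: w) = pathb (tl a) w && (src (tl a) w == hd a).
Proof. by rewrite /= rcons_path pathb_path src_last. Qed.

Lemma wcoef_linear w (c : K) u v : wcoef (c *: u + v) w = c * wcoef u w + wcoef v w.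
Proof.
by case: w => [|a w] /=; rewrite ?coefD ?coefZ // mulr0 addr0.
Qed.

Lemma potentialP S :
  potential S <-> (forall i w, coef S i w != 0 -> (0 < size w)%N /\ src i w = i).
Proof.
split=> [h i w|h x]; last first.
  by rewrite -coefE => /h; rewrite /plen /psrc.
have [pw|/coef_out->] := boolP (pathb i w); last by rewrite eqxx.
by rewrite (coefF _ pw) => /h; rewrite /plen /psrc.
Qed.

Lemma wcoefB w u v : wcoef (u - v) w = wcoef u w - wcoef v w.
Proof. by case: w => [|a w] /=; rewrite ?subr0 // coefB. Qed.

Lemma wcoef_cycle S w : potential S -> wcoef S w != 0 -> cycle composable w.
Proof.
case: w => [|a w] /potentialP pS; first by rewrite eqxx.
have [pw|/coef_out e] := boolP (pathb (hd a) (a :: w)); last by rewrite /= e eqxx.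
case/pS => _ e; rewrite cycle_pathb; move: pw; rewrite /= => /andP[_ ->].
by apply/eqP.
Qed.

Lemma rotsum_acyclic S x :
  potential S -> ~~ cycle composable x -> rotsum (wcoef S) x = 0.
Proof.
move=> pS nx; rewrite /rotsum big1 // => n _; apply/eqP; apply: contraNT nx.
by move/(wcoef_cycle pS); rewrite rot_cycle.
Qed.

Lemma cyc_derivE p S x : cyc_deriv p S x =
  if src (ptgt x) p == ptgt x then rotsum (wcoef S) (p ++ pword x) else 0.
Proof. by []. Qed.

Lemma cyc_deriv_linear p : linear (cyc_deriv p : A -> A).
Proof.
move=> c u v; apply/funext => x.
rewrite -[RHS]/(c * cyc_deriv p u x + cyc_deriv p v x) !cyc_derivE.
case: eqP => _; last by rewrite mulr0 addr0.
rewrite /rotsum mulr_sumr -big_split; apply: eq_bigr => n _; exact: wcoef_linear.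
Qed.

Lemma cyc_deriv_mpow p n S : mpow (n + size p) S -> mpow n (cyc_deriv p S).
Proof.
move=> /mpow_coefP hS x lx; rewrite cyc_derivE; case: eqP => // _.
rewrite /rotsum big1 // => m _; rewrite /wcoef.
case e: (rot m _) => [//|a w]; rewrite hS // -e size_rot size_cat addnC.
by rewrite ltn_add2r.
Qed.

Lemma cyc_deriv_cont p : madic_continuous (cyc_deriv p : A -> A).
Proof. by move=> n; exists (n + size p)%N => u; apply: cyc_deriv_mpow. Qed.

(** On a word that does not close up the rotation sum already vanishes, so for a potential the
    formula needs no path test. Writing the word as [rcons p a] makes it nonempty, with [tl a] the
    target of the complementary paths. *)
Lemma coef_cyc_deriv p a S i w : potential S ->
  coef (cyc_deriv (rcons p a) S) i w =
    if i == tl a then rotsum (wcoef S) (rcons p a ++ w) else 0.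
Proof.
move=> pS; have [pw|npw] := boolP (pathb i w).
  by rewrite (coefF _ pw) cyc_derivE src_rcons eq_sym.
rewrite coef_out //; case: eqP => // ei; rewrite rotsum_acyclic //.
rewrite -(rot_cycle (size p)) cat_rcons rot_size_cat cat_cons cycle_pathb.
by rewrite pathb_cat -ei (negPf npw).
Qed.

Lemma wcoef_mono a z y : wcoef (mono (hd a) (a :: z)) y =
  (pathb (tl a) z && (y == a :: z))%:R.
Proof.
have [pz|np] := boolP (pathb (tl a) z); last first.
  by rewrite mono_out ?/= ?eqxx //; case: y => [|b y] //=; rewrite coef0.
case: y => [|b y] //=; rewrite coef_mono /= ?eqxx // xpair_eqE.
by rewrite eqseq_cons; case: (b =P a) => [->|]; rewrite ?eqxx ?andbF.
Qed.

(** The two words of a rotation difference are rotations of each other, and a rotation sum does not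
    distinguish them. *)
Lemma cyc_deriv_rotation p S : rotation_differences S -> cyc_deriv p S = 0.
Proof.
case=> a [w [/= /andP[_ pw] cl ->]]; apply/funext => x; rewrite cyc_derivE.
case: eqP => // _; set y := _ ++ _.
set X := a :: w.
have cyX : cycle composable X by rewrite /X cycle_pathb pw -[src _ _]/(src (hd a) (a :: w)) cl eqxx.
have eX : mono (tl a) (rcons w a) = mono (hd (head a w)) (rot 1 X).
  rewrite /X rot1_cons.
  by case: (w) pw cl => [_ e|b v /andP[/eqP e _] _]; [have /= -> : tl a = hd a := e|rewrite /= e].
have eR z : cycle composable z -> (0 < size z)%N ->
    forall t, wcoef (mono (hd (head a z)) z) t = (t == z)%:R.
  case: z => [//|b z]; rewrite cycle_pathb => /andP[pz _] _ t.
  by rewrite wcoef_mono pz.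
have eR1 := eR X cyX isT; rewrite /= in eR1.
have eR2 : forall t, wcoef (mono (tl a) (rcons w a)) t = (t == rot 1 X)%:R.
  move=> t; rewrite eX; have := eR (rot 1 X); rewrite rot_cycle size_rot.
  move/(_ cyX isT t) => <-; congr (wcoef (mono (hd _) _) _).
  by rewrite /X rot1_cons; case: (w).
have eqR : rotsum (fun t => (t == X)%:R : K) y = rotsum (fun t => (t == rot 1 X)%:R) y.
  rewrite -[RHS](rotsum_comp_rot _ 1); apply: eq_bigr => n _.
  by rewrite (inj_eq (@rot_inj 1 _)).
rewrite -[RHS](subrr (rotsum (fun t => (t == X)%:R : K) y)) {2}eqR.
rewrite /rotsum -sumrB; apply: eq_bigr => n _.
by rewrite wcoefB eR1 eR2.
Qed.

(** The derivative lowers degrees by at most [size p], so it vanishes not only on rotation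
    differences but on the closure of their span. *)
Lemma cyc_deriv_equivalent p S S' :
  cyclically_equivalent S S' -> cyc_deriv p S = cyc_deriv p S'.
Proof.
move=> h; apply/eqP; rewrite -subr_eq0 -(linB (cyc_deriv_linear p)); apply/eqP.
apply: mpow_eq0 => n; have [_ [s sR ->]] := h (n + size p)%N.
set t := \sum_(_ <- s) _ => hm.
have <- : cyc_deriv p (S - S' - t) = cyc_deriv p (S - S').
  rewrite (linB (cyc_deriv_linear p)) (lin_sum (cyc_deriv_linear p)) big_seq big1.
    by rewrite subr0.
  move=> z /sR; rewrite (linZ (cyc_deriv_linear p)) => /(cyc_deriv_rotation p) ->.
  by rewrite scaler0.
exact: cyc_deriv_mpow.
Qed.

Lemma jac_pred_equivalent S S' :
  cyclically_equivalent S S' -> jac_pred S =1 jac_pred S'.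
Proof.
move=> h u; rewrite /jac_pred /jacobian_ideal.
by have -> : (fun a => dd a S) = (fun a => dd a S')
  by apply/funext => a; apply: cyc_deriv_equivalent.
Qed.

(** In a cyclic term, [b] is followed by some arrow [a]. A term consisting of [b] alone would be a
    loop, which is where [loop_free] is used. *)
Lemma cyc_deriv_left S b : loop_free Q -> potential S ->
  dd b S = \sum_a arr a * cyc_deriv [:: b; a] S.
Proof.
move=> lf pS; apply: cpaP => i w; rewrite (coef_cyc_deriv [::]) // coef_sum.
case: w => [|c w].
  rewrite rotsum_acyclic ?big1 => [|a _||]; rewrite ?coef_arrM //; first by case: eqP.
  by rewrite /= andbT /composable eq_sym.
rewrite (bigD1 c) //= big1 ?addr0; last first.
  by move=> a ne; rewrite coef_arrM eq_sym (negPf ne).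
rewrite coef_arrM eqxx (coef_cyc_deriv [:: b]) // eqxx /=.
have [cy|ncy] := boolP (cycle composable [:: b, c & w]); last first.
  by rewrite rotsum_acyclic // !if_same.
by move: cy; rewrite /= => /andP[/eqP <- _].
Qed.

Lemma coef_Marr u b i w : coef (u * arr b) i w =
  if w is c :: z then
    if (last c z == b) && (src i (belast c z) == hd b) then coef u i (belast c z) else 0
  else 0.
Proof.
have pb : pathb (hd b) [:: b] by rewrite /= eqxx.
case: w => [|c z]; first by rewrite coefM conv_nil coef_mono // xpair_eqE andbF mulr0.
rewrite coefM /conv lastI; move: (belast _ _) (last _ _) => {c z} z c.
rewrite size_rcons big_ord_recr /= big_ord_recr /= big1 => [|n _]; last first.
  rewrite coef_mono // xpair_eqE; set d := drop _ _; suff: size d != 1%N.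
    by case: d => [|e [|f d]] //= _; rewrite ?eqseq_cons /= ?andbF mulr0.
  by rewrite size_drop size_rcons subSn ?(ltnW (ltn_ord n)) // eqSS subn_eq0 -ltnNge ltn_ord.
rewrite add0r [drop (size z).+1 _]drop_oversize ?size_rcons //.
rewrite [X in _ + _ * X]coef_mono // xpair_eqE andbF mulr0 addr0.
rewrite -cats1 take_size_cat // drop_size_cat // coef_mono // xpair_eqE eqseq_cons.
by rewrite andbT andbC; case: (c =P b) => _; case: eqP => _; rewrite /= ?mulr1 ?mulr0.
Qed.

(** The arrow preceding [a] in a cyclic term is the last letter of the complementary path. *)
Lemma cyc_deriv_right S a : loop_free Q -> potential S ->
  dd a S = \sum_b cyc_deriv [:: b; a] S * arr b.
Proof.
move=> lf pS; apply: cpaP => i w; rewrite (coef_cyc_deriv [::]) // coef_sum.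
case: w => [|c w].
  rewrite rotsum_acyclic ?big1 => [|b _||]; rewrite ?coef_Marr //; first by case: eqP.
  by rewrite /= andbT /composable eq_sym.
rewrite (bigD1 (last c w)) //= big1 ?addr0; last first.
  by move=> b ne; rewrite coef_Marr eq_sym (negPf ne).
rewrite coef_Marr eqxx (coef_cyc_deriv [:: last c w]) //= [c :: w]lastI.
move: (belast c w) (last c w) => {c w} w b.
(* Rotating the last letter to the front places it just before [a], as in the occurrence counted by
   the second-order derivative. *)
have eb : rot (size w).+1 (a :: rcons w b) = [:: b, a & w].
  by rewrite -rcons_cons -cats1 (rot_size_cat (a :: w)).
rewrite -[rotsum _ (a :: _)](rotsum_rot _ (size w).+1) eb.
have [cy|ncy] := boolP (cycle composable [:: b, a & w]); last first.
  by rewrite rotsum_acyclic // !if_same.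
case: eqP => [ei|]; last by rewrite if_same.
move: cy; rewrite -(rot_cycle 1) rot1_cons -[rcons _ _]/(a :: rcons w b).
by rewrite cycle_pathb pathb_rcons -ei => /andP[/andP[_ /eqP->]]; rewrite eqxx.
Qed.

End CyclicWords.
Arguments composable {V Q}.

(** * The chain rule *)

Section DoubleDerivative.
Variables (K : fieldType) (V : finType) (Q : quiver V).
Local Notation Q1 := (arrow Q).
Local Notation A := (cpa K Q).
Local Notation mono := (@mono K V Q).
Local Notation arr := (@arr K V Q).
Local Notation idem := (@idem K V Q).
Local Notation dd a := (cyc_deriv [:: a]).
Implicit Types (f g u v S : A) (i j : V) (w y z p q : seq Q1) (a b c : Q1).

(* The sum of y f x over the factorizations w = x c y. *)
Fixpoint dword c w f : A :=
  if w is a :: w' then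
    (if a == c then mono (tl a) w' * f else 0) + dword c w' (f * arr a)
  else 0.

Lemma dword_linear c w : linear (dword c w).
Proof.
elim: w => [|a w IH] t f g /=; first by rewrite scaler0 addr0.
rewrite mulrDl -cpa_scaleAl IH scalerDr addrACA; congr (_ + _).
by case: eqP => _; rewrite ?scaler0 ?addr0 // mulrDr -cpa_scaleAr.
Qed.

Lemma dword_mpow c w f n : mpow n f -> mpow ((size w).-1 + n) (dword c w f).
Proof.
elim: w n f => [|a w IH] n f hf //=; apply: mpowD.
  by case: eqP => // _; apply: mpowM => //; apply: mpow_mono.
case: w IH => [//|b w] IH.
have := IH n.+1 _ (_ : mpow n.+1 (f * arr a)); rewrite -addn1 => h.
have {}h := h (mpowM hf (mpow_arr K a)).
by apply: mpow_le h; rewrite addn1 addnS /= addSn.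
Qed.

(** An occurrence of [c] in [w1] has all of [w2] after it; one in [w2] has all of [w1] before it. *)
Lemma dword_cat c i w1 w2 f : pathb i (w1 ++ w2) ->
  dword c (w1 ++ w2) (f * idem i) =
  dword c w1 (mono (src i w1) w2 * f * idem i) + dword c w2 (f * mono i w1).
Proof.
elim: w1 i f => [|a w IH] i f /=; first by rewrite add0r.
case/andP => /eqP <- p; rewrite -!mulrA idem_arrK.
have := IH (tl a) (f * arr a) p; rewrite -!mulrA arr_idemK => ->.
rewrite addrA mono_arrM; congr (_ + _ + _).
case: eqP => // _; rewrite !mulrA mono_cat //.
by move: p; rewrite pathb_cat => /andP[].
Qed.

Lemma dword_idem c i w j f : pathb i w -> src i w != j -> dword c w (idem j * f) = 0.
Proof.
elim: w i f => [|a w IH] i f //= /andP[_ p] ne.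
rewrite -mulrA (IH (tl a)) // addr0; case: eqP => // _.
by rewrite mulrA mono_idem -[src _ _]/(src i (a :: w)) (negPf ne) scale0r mul0r.
Qed.

(** The double derivation sends [u = x c y] to the tensor of x and y, contracted here to y f x. On
    potentials [f = 1] gives the cyclic derivative; a general [f] is what the chain rule inserts. *)
Definition dderiv c f u : A :=
  lin_ext (fun x : qpath Q => dword c (pword x) (f * idem (ptgt x))) u.

Let growth c f n (x : qpath Q) :
  (n.*2 <= plen x)%N -> mpow n (dword c (pword x) (f * idem (ptgt x))).
Proof.
move=> le; have := @dword_mpow c (pword x) _ _ (mpow0 (f * idem (ptgt x))).
apply: mpow_le; rewrite addn0; apply: leq_trans (_ : n.*2.-1 <= _)%N.
  by case: (n) => // m; rewrite doubleS /= -addnn ltnS leq_addr.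
by rewrite -!subn1 leq_sub2r.
Qed.

Lemma dderiv_linear c f : linear (dderiv c f).
Proof. exact: lin_ext_linear. Qed.

Lemma dderiv_cont c f : madic_continuous (dderiv c f).
Proof. exact: lin_ext_cont. Qed.

Lemma dderiv_mono c f i w : pathb i w ->
  dderiv c f (mono i w) = dword c w (f * idem i).
Proof.
move=> p; have := lin_ext_qmono (@growth c f) (exist _ (i, w) p).
by rewrite /qmono /ptgt /pword /=.
Qed.

Lemma dderiv_linear_arg c u : linear (fun f => dderiv c f u).
Proof.
apply: lin_ext_linear_arg => x t f g.
by rewrite mulrDl -cpa_scaleAl dword_linear.
Qed.

Lemma dderiv_cont_arg c u : madic_continuous (fun f => dderiv c f u).
Proof.
move=> n; exists n => f hf; apply: lin_ext_mpow => x.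
have := @dword_mpow c (pword x) _ _ (mpowMr (idem (ptgt x)) hf).
by apply: mpow_le; rewrite leq_addl.
Qed.

(** Leibniz rule: for an occurrence of [c] inside [u], the factor [v] belongs to the part after it
    and meets [f] on the left; for one inside [v], the factor [u] meets [f] on the right. *)
Lemma dderivM c f u v : dderiv c f (u * v) = dderiv c (v * f) u + dderiv c (f * u) v.
Proof.
pose F v := dderiv c f (u * v); pose G v := dderiv c (v * f) u + dderiv c (f * u) v.
have lF : linear F by apply: comp_linear (dderiv_linear _ _); apply: mull_linear.
have lG : linear G.
  move=> t x y; rewrite /G dderiv_linear mulrDl -cpa_scaleAl.
  by rewrite (dderiv_linear_arg c u) scalerDr addrACA.
have cF : madic_continuous F by apply: cont_comp (dderiv_cont _ _); apply: cont_mull.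
have cG : madic_continuous G.
  move=> n; have [m1 h1] := dderiv_cont_arg c u n.
  have [m2 h2] := dderiv_cont c (f * u) n.
  exists (maxn m1 m2) => x hx; apply: mpowD.
    by apply: h1; apply: mpowMr; apply: mpow_le hx; apply: leq_maxl.
  by apply: h2; apply: mpow_le hx; apply: leq_maxr.
rewrite -/(F v) -/(G v); apply: density_eq => // x _.
rewrite /F /G {F G lF lG cF cG v}; case: x => -[j w2] p2.
rewrite /qmono /ptgt /pword /= in p2 *; set v := Defs.mono _ _ _.
pose F u := dderiv c f (u * v); pose G u := dderiv c (v * f) u + dderiv c (f * u) v.
have lF : linear F by apply: comp_linear (dderiv_linear _ _); apply: mulr_linear.
have cF : madic_continuous F by apply: cont_comp (dderiv_cont _ _); apply: cont_mulr.
have lG : linear G.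
  move=> t x y; rewrite /G dderiv_linear mulrDr -cpa_scaleAr.
  by rewrite (dderiv_linear_arg c v) scalerDr addrACA.
have cG : madic_continuous G.
  move=> n; have [m1 h1] := dderiv_cont c (v * f) n.
  have [m2 h2] := dderiv_cont_arg c v n.
  exists (maxn m1 m2) => x hx; apply: mpowD.
    by apply: h1; apply: mpow_le hx; apply: leq_maxl.
  by apply: h2; apply: mpowMl; apply: mpow_le hx; apply: leq_maxr.
rewrite -/(F u) -/(G u); apply: density_eq => // x _.
rewrite /F /G {F G lF lG cF cG u}; case: x => -[i w1] p1.
rewrite /qmono /ptgt /pword /= in p1 *.
rewrite (dderiv_mono c _ p1) (dderiv_mono c _ p2) -!mulrA mono_idem.
(* If the two paths do not compose, all three terms vanish because of the idempotents at their
   ends. *)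
have [ej|ne] := eqVneq (src i w1) j.
  subst j.
  have p : pathb i (w1 ++ w2) by rewrite pathb_cat p1.
  by rewrite scale1r /v mono_cat // dderiv_mono // dword_cat // !mulrA.
rewrite scale0r mulr0 (lin0 (dword_linear c w2)) addr0.
have -> : v = idem j * v by rewrite /v idem_mono eqxx scale1r.
by rewrite -!mulrA (dword_idem _ _ p1 ne) mulrA mono_idem (negPf ne) scale0r mul0r
  (lin0 (dderiv_linear c f)).
Qed.

Lemma dword_sum c i w f : pathb i w -> dword c w (f * idem i) =
  \sum_(n < size w)
    if nth c w n == c then mono (tl c) (drop n.+1 w) * f * mono i (take n w) else 0.
Proof.
elim: w i f => [|a w IH] i f; first by rewrite big_ord0.
move=> /= /andP[/eqP <- p]; rewrite big_ord_recl /= drop0; congr (_ + _).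
  by case: eqP => [->|//]; rewrite mulrA.
rewrite -mulrA idem_arrK -(arr_idemK K a) mulrA IH //; apply: eq_bigr => n _.
by case: eqP => // _; rewrite mono_arrM !mulrA.
Qed.

Lemma cyc_deriv_mono c i w : pathb i w -> (0 < size w)%N -> src i w = i ->
  dd c (mono i w) = dword c w (idem i).
Proof.
move=> p w0 cl; rewrite -[idem i]mul1r dword_sum //.
have pm : potential (mono i w).
  apply/potentialP => j z; rewrite coef_mono // xpair_eqE.
  by case: (j =P i) (z =P w) => [->|_] [->|_] //=; rewrite eqxx.
apply: cpaP => j q; rewrite (coef_cyc_deriv [::]) // coef_sum /=.
have wcE z : wcoef (mono i w) z = (z == w)%:R.
  case: (w) w0 p => [//|a v] _ /= /andP[/eqP <- p'].
  by rewrite wcoef_mono p'.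
have cw n : (n < size w)%N -> nth c w n = c -> rot n w = c :: drop n.+1 w ++ take n w.
  by move=> lt e; rewrite /rot (drop_nth c) // e.
(* The derivative counts the rotations of [c :: q] equal to [w]; [rotsum_eq_sym] turns them into
   rotations of [w] equal to [c :: q], each bringing an occurrence of [c] to the front. *)
transitivity (\sum_(n < size w) ((j == tl c) && (rot n w == c :: q))%:R : K).
  case: eqP => _ /=; last by rewrite big1.
  rewrite -[RHS]/(rotsum (fun z => (z == c :: q)%:R) w) -rotsum_eq_sym.
  by apply: eq_bigr => n _; rewrite wcE.
apply: eq_bigr => -[n lt] _ /=; case: (nth c w n =P c) => [e|ne]; last first.
  rewrite coef0; case: (rot n w =P _) => [h|_]; last by rewrite andbF.
  case: ne.
  by move: h; rewrite /rot (drop_nth c) // => -[].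
have cy : cycle composable (rot n w).
  rewrite rot_cycle; case: (w) p cl => [//|a v] p cl.
  have /andP[/eqP ha pv] : (hd a == i) && pathb (tl a) v := p.
  by rewrite cycle_pathb pv /= -[src (tl a) v]/(src i (a :: v)) cl ha.
have pc : pathb (tl c) (drop n.+1 w) && pathb (src (tl c) (drop n.+1 w)) (take n w).
  by move: cy; rewrite cw // cycle_pathb -pathb_cat => /andP[].
have /andP[p1 p2] := pc.
have ei : src (tl c) (drop n.+1 w) = i.
  rewrite -[RHS]cl -[in RHS](cat_take_drop n w) src_cat (drop_nth c lt) e.
  by [].
rewrite mulr1 -ei mono_cat // coef_mono ?pathb_cat // cw // eqseq_cons eqxx /=.
by rewrite xpair_eqE [q == _]eq_sym.
Qed.

(** Puts the starting value in a form independent of the base point, which the induction of the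
    chain rule can generalize to an arbitrary series. *)
Lemma dword_closed c i w : pathb i w -> (0 < size w)%N -> src i w = i ->
  dword c w (idem i) = dword c w 1.
Proof.
case: w => [//|a w] p _ cl; have /andP[/eqP ha pw] : (hd a == i) && pathb (tl a) w := p.
rewrite /= mul1r -ha idem_arrK mulr1 mono_idem ha.
by rewrite -[src (tl a) w]/(src i (a :: w)) cl eqxx scale1r.
Qed.

Lemma cyc_deriv_dderiv c u : potential u -> dd c u = dderiv c 1 u.
Proof.
move=> pu; apply: density_eq => [|||| x /pu[sx cl]].
- exact: cyc_deriv_linear.
- exact: dderiv_linear.
- exact: cyc_deriv_cont.
- exact: dderiv_cont.
case: x sx cl => -[i w] p; rewrite /qmono /psrc /plen /ptgt /pword /= => sx cl.
by rewrite dderiv_mono // mul1r cyc_deriv_mono.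
Qed.

Lemma dderiv_idem c f i : dderiv c f (idem i) = 0.
Proof. by rewrite dderiv_mono. Qed.
End DoubleDerivative.

(** This form mentions only idempotents, products and the filtration, all respected by the algebra
    morphisms considered below. *)
Lemma potential_idem_sum (K : fieldType) (V : finType) (Q : quiver V) (u : cpa K Q) :
  potential u <-> mpow 1 u /\ forall i j, i != j -> idem K i * u * idem K j = 0.
Proof.
split=> [/potentialP h|[/mpow_coefP h0 h]]; [split|apply/potentialP] => [|i j ne|i w].
- apply/mpow_coefP => i w; rewrite ltnS leqn0 size_eq0 => /eqP ->.
  by apply/eqP; apply: contraT => /h[].
- apply: cpaP => l w; rewrite coef_idemMr coef_idemM coef0.
  have [->|/h[_ e]] := eqVneq (coef u l w) 0; first by rewrite !mulr0.
  rewrite e; have [ej|_] := eqVneq l j; last by rewrite mul0r.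
  by rewrite ej eq_sym (negPf ne) mul0r mulr0.
- move=> nz; split; first by rewrite lt0n; apply: contraNN nz => /eqP e; rewrite h0 // e.
  apply/eqP; apply: contraNT nz => ne.
  have ne' : i != src i w by rewrite eq_sym.
  have := congr1 (fun v : cpa K Q => coef v i w) (h _ _ ne').
  by rewrite coef_idemMr coef_idemM !eqxx !mul1r coef0 => ->.
Qed.

Lemma potential0 (K : fieldType) (V : finType) (Q : quiver V) : potential (0 : cpa K Q).
Proof. by move=> x; rewrite -[_ x]/(0 : K) eqxx. Qed.

Lemma potentialD (K : fieldType) (V : finType) (Q : quiver V) (u v : cpa K Q) :
  potential u -> potential v -> potential (u + v).
Proof.
move=> pu pv x; rewrite -[(u + v) x]/(u x + v x).
by have [->|/pu //] := eqVneq (u x) 0; rewrite add0r => /pv.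
Qed.

Section ChainRule.
Variables (K : fieldType) (V : finType) (Q Q' : quiver V).
Variable phi : cpa K Q -> cpa K Q'.
Hypotheses (phi_lin : linear phi) (phi_mon : monoid_morphism phi).
Hypothesis phi_idem : forall i, phi (idem K i) = idem K i.

(* No arrow is a loop, so phi maps arrows into the arrow ideal. *)
Lemma mpow_morphism n u : loop_free Q -> mpow n u -> mpow n (phi u).
Proof.
move=> lf; have phi_arr a : mpow 1 (phi (arr K a)).
  rewrite -(idem_arrK _ a) -(arr_idemK _ a) !phi_mon.2 !phi_idem.
  apply/mpow_coefP => i w; rewrite ltnS leqn0 size_eq0 => /eqP ->.
  rewrite coef_idemM coef_idemMr mulrA -natrM mulnb /src /=.
  have [->|] := eqVneq i (hd a); last by rewrite mul0r.
  by rewrite (negPf (lf a)) mul0r.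
elim: n u => [//|n IH] u hu; rewrite (left_quotE (mpow_le _ hu)) //.
rewrite (lin_sum phi_lin); apply: mpow_sum => a _; rewrite phi_mon.2 -add1n.
by apply: mpowM => //; apply: IH; apply: mpow_left_quot.
Qed.

Lemma morphism_cont : loop_free Q -> madic_continuous phi.
Proof. by move=> lf n; exists n => u; apply: mpow_morphism. Qed.

Lemma potential_morphism (u : cpa K Q) : loop_free Q -> potential u -> potential (phi u).
Proof.
move=> lf /potential_idem_sum[u1 h]; apply/potential_idem_sum.
split; first exact: mpow_morphism.
by move=> i j ne; rewrite -!phi_idem -!phi_mon.2 (h _ _ ne) (lin0 phi_lin).
Qed.

Hypothesis lf : loop_free Q.

(** By density it suffices to differentiate a cyclic path, to which [phi] applies letter by letter;
    the Leibniz rule distributes the derivative over the letters. *)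
Lemma cyc_deriv_chain c S : potential S ->
  cyc_deriv [:: c] (phi S) =
    \sum_a dderiv c (phi (cyc_deriv [:: a] S)) (phi (arr K a)).
Proof.
move=> pS; rewrite cyc_deriv_dderiv; last exact: potential_morphism.
pose F u := dderiv c 1 (phi u).
pose G u := \sum_a dderiv c (phi (cyc_deriv [:: a] u)) (phi (arr K a)).
have lG1 a : linear (fun u => dderiv c (phi (cyc_deriv [:: a] u)) (phi (arr K a))).
  apply: (comp_linear _ (dderiv_linear_arg c _)).
  by apply: comp_linear phi_lin; apply: cyc_deriv_linear.
have cG1 a : madic_continuous (fun u => dderiv c (phi (cyc_deriv [:: a] u)) (phi (arr K a))).
  apply: (cont_comp (G := fun f => dderiv c f _)); last exact: dderiv_cont_arg.
  by apply: cont_comp (morphism_cont lf); apply: cyc_deriv_cont.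
rewrite -/(F S) -/(G S); apply: density_eq => [|||| x /pS[sx cl]].
- by apply: comp_linear (dderiv_linear _ _).
- move=> t u v; rewrite /G scaler_sumr -big_split; apply: eq_bigr => a _.
  exact: lG1.
- by apply: cont_comp (dderiv_cont _ _); apply: morphism_cont.
- move=> n; have [m hm] := choice (cG1^~ n).
  exists (\max_a m a)%N => u hu; apply: mpow_sum => a _; apply: hm.
  by apply: mpow_le hu; apply: leq_bigmax.
case: x sx cl => -[i w] p; rewrite /qmono /psrc /plen /ptgt /pword /= => sx cl.
rewrite /F /G {F G lG1 cG1}.
under eq_bigr => a _ do rewrite cyc_deriv_mono // dword_closed //.
(* The induction runs over arbitrary paths, with an arbitrary series in place of 1 in which the
   letters already read accumulate. *)
rewrite -{1}phi_mon.1; move: p (1 : cpa K Q) {sx cl}.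
elim: w i => [|a0 w IH] i /= => [_|/andP[/eqP <- p]] f.
  rewrite phi_idem dderiv_idem big1 // => a _.
  by rewrite (lin0 phi_lin) (lin0 (dderiv_linear_arg c _)).
rewrite mono_arrM phi_mon.2 dderivM -!phi_mon.2 IH //.
rewrite (bigD1 a0) //= [RHS](bigD1 a0) //= eqxx (linD phi_lin).
rewrite (linD (dderiv_linear_arg c _)) addrA; congr (_ + _).
by apply: eq_bigr => a ne; rewrite eq_sym (negPf ne) add0r.
Qed.

End ChainRule.

(** The chain rule writes the derivative in terms y phi(d_a S) x, with x c y running over the paths
    in phi(a), and [phi'] sends such terms into the ideal of [S]. *)
Lemma jac_inverse_deriv (K : fieldType) (V : finType) (Q Q' : quiver V)
    (phi : cpa K Q -> cpa K Q') (phi' : cpa K Q' -> cpa K Q) (S : cpa K Q) c :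
  loop_free Q -> loop_free Q' ->
  linear phi -> monoid_morphism phi -> (forall i, phi (idem K i) = idem K i) ->
  linear phi' -> monoid_morphism phi' -> (forall i, phi' (idem K i) = idem K i) ->
  cancel phi phi' -> potential S ->
  phi' (cyc_deriv [:: c] (phi S)) \in jac_pred S.
Proof.
move=> lf lf' l1 m1 i1 lphi' mphi' iphi' phiK pS; rewrite cyc_deriv_chain // (lin_sum lphi').
apply: rpred_sum => a _; set f := phi _; move: (phi (arr K a)) => u.
have fJ : phi' f \in jac_pred S by rewrite phiK jac_gen.
pose F u := phi' (dderiv c f u).
have lF : linear F by apply: comp_linear lphi'; apply: dderiv_linear.
have cF : madic_continuous F.
  by apply: cont_comp (dderiv_cont _ _) _; apply: morphism_cont.
rewrite -/(F u); apply: (density_jac lF cF) => -[[i w] p] _.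
rewrite /F /qmono /ptgt /pword /= dderiv_mono //.
have : phi' (f * idem K i) \in jac_pred S by rewrite mphi'.2 jac_predMr.
elim: w (f * _) {p fJ F lF cF} => [|b w IH] g gJ /=; first by rewrite (lin0 lphi') rpred0.
rewrite (linD lphi') rpredD ?IH //; last by rewrite mphi'.2 jac_predMr.
by case: eqP => _; rewrite ?(lin0 lphi') ?rpred0 // mphi'.2 jac_predMl.
Qed.

Lemma jac_inverse (K : fieldType) (V : finType) (Q Q' : quiver V)
    (phi : cpa K Q -> cpa K Q') (phi' : cpa K Q' -> cpa K Q) (S : cpa K Q) u :
  loop_free Q -> loop_free Q' ->
  linear phi -> monoid_morphism phi -> (forall i, phi (idem K i) = idem K i) ->
  linear phi' -> monoid_morphism phi' -> (forall i, phi' (idem K i) = idem K i) ->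
  cancel phi phi' -> potential S ->
  u \in jac_pred (phi S) -> phi' u \in jac_pred S.
Proof.
move=> lf lf' l1 m1 i1 l2 m2 i2 phiK pS; move: u; apply: (jac_ind l2).
  exact: morphism_cont.
move=> a x y; rewrite !m2.2 jac_predMr // jac_predMl //.
exact: (jac_inverse_deriv _ lf lf' l1 m1 i1 l2 m2 i2 phiK pS).
Qed.

(** * Substituting words for arrows *)

Section SplitSums.
Variable Z : nmodType.

(** Common shape of products and of rotation sums, so that one comparison along a substitution,
    [split_unfold], serves both. *)
Definition split_sum (L : eqType) (G : seq L -> seq L -> Z) (w : seq L) : Z :=
  \sum_(n < (size w).+1) G (take n w) (drop n w).

Lemma split_sum_nil (L : eqType) (G : seq L -> seq L -> Z) : split_sum G [::] = G [::] [::].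
Proof. by rewrite /split_sum big_ord_recl big_ord0 addr0. Qed.

Lemma split_sum_cons (L : eqType) (G : seq L -> seq L -> Z) a w :
  split_sum G (a :: w) = G [::] (a :: w) + split_sum (fun x => G (a :: x)) w.
Proof. by rewrite /split_sum big_ord_recl. Qed.

Lemma eq_split_sum (L : eqType) (G H : seq L -> seq L -> Z) w :
  (forall x y, w = x ++ y -> G x y = H x y) -> split_sum G w = split_sum H w.
Proof. by move=> e; apply: eq_bigr => n _; apply: e; rewrite cat_take_drop. Qed.

(** The rotation [y ++ x] comes from the splitting [x ++ y]. The splitting with [y] empty would
    repeat the trivial rotation and is given the value 0. *)
Lemma rotsum_split (L : eqType) (g : seq L -> Z) w :
  rotsum g w = split_sum (fun x y => if y == [::] then 0 else g (y ++ x)) w.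
Proof.
rewrite /split_sum big_ord_recr /= drop_size eqxx addr0; apply: eq_bigr => n _.
by rewrite -size_eq0 size_drop subn_eq0 leqNgt ltn_ord.
Qed.
End SplitSums.

Section Unfolding.
Variables (K : fieldType) (V : finType) (Q Q' : quiver V).
Variables (f : arrow Q' -> option (seq (arrow Q))) (B : pred (arrow Q)).
Local Notation unf := (unfold_word f).
Local Notation uns := (@unfold_series K V Q Q' f).

(* Each arrow stands for an arrow or for a product of two arrows meeting at a
   vertex where the factorizations to be compared vanish, as expressed by B. *)
Definition unfoldable := forall a u, f a = Some u ->
  (exists b, [/\ u = [:: b], hd b = hd a & tl b = tl a]) \/
  (exists b c, [/\ u = [:: b; c], hd b = hd a, tl c = tl a, tl b = hd c & B b]).
Hypothesis Hf : unfoldable.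

Lemma unfold_cat x y : unf (x ++ y) =
  if unf x is Some x' then if unf y is Some y' then Some (x' ++ y') else None else None.
Proof.
elim: x => [|a x IH] /=; first by case: unf.
by rewrite IH; case: (f a) => [u|//]; case: (unf x) => [x'|//]; case: (unf y) => [y'|//];
  rewrite catA.
Qed.

Lemma unfold_path i w w' : unf w = Some w' -> pathb i w' = pathb i w /\ src i w' = src i w.
Proof.
elim: w i w' => [|a w IH] i w' /=; first by case=> <-.
case e: (f a) => [u|//]; case: (unf w) IH => [v|//] IH [<-].
have [IH1 IH2] := IH (tl a) v erefl.
case: (Hf e) => [[b [-> eh et]]|[b [c [-> eh et em _]]]] /=.
  rewrite eh et IH1; split=> //.
  by rewrite -[LHS]/(src (tl b) v) -[RHS]/(src (tl a) w) et.
rewrite eh et em eqxx IH1; split=> //.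
by rewrite -[LHS]/(src (tl c) v) -[RHS]/(src (tl a) w) et.
Qed.

Lemma unfold_size w w' : unf w = Some w' -> (size w <= size w' <= (size w).*2)%N.
Proof.
elim: w w' => [|a w IH] w' /=; first by case=> <-.
case e: (f a) => [u|//]; case: (unf w) IH => [v|//] IH [<-].
have /andP[IH1 IH2] := IH v erefl; rewrite size_cat doubleS.
by case: (Hf e) => [[b [-> _ _]]|[b [c [-> _ _ _ _]]]] /=;
  rewrite ?add1n ?add2n !ltnS ?IH1 ?IH2 ?(leqW IH1) ?(leqW IH2).
Qed.

Lemma coef_unfold (u : cpa K Q) i w :
  coef (uns u) i w = if unf w is Some w' then coef u i w' else 0.
Proof.
have [p|np] := boolP (pathb i w); first by rewrite (coefF _ p).
rewrite coef_out //; case e: (unf w) => [w'|//].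
by rewrite coef_out // (unfold_path i e).1.
Qed.

Lemma unfold_linear : linear uns.
Proof.
move=> c u v; apply: cpaP => i w; rewrite coefD coefZ !coef_unfold.
by case: (unf w) => [w'|]; rewrite ?coefD ?coefZ // mulr0 addr0.
Qed.

Lemma unfold_cont : madic_continuous uns.
Proof.
move=> n; exists n.*2 => u /mpow_coefP h; apply/mpow_coefP => i w lw.
rewrite coef_unfold; case e: (unf w) => [w'|//]; rewrite h //.
by have /andP[_ le] := unfold_size e; apply: leq_ltn_trans le _; rewrite ltn_double.
Qed.

Lemma unfold_nil w w' : unf w = Some w' -> (w' == [::]) = (w == [::]).
Proof.
move=> e; rewrite -!size_eq0; have /andP[l1 l2] := unfold_size e.
by apply/eqP/eqP => s; apply/eqP; rewrite -leqn0; [rewrite -s|move: l2; rewrite s].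
Qed.

Lemma unfold1 : uns 1 = 1.
Proof.
apply: cpaP => i w; rewrite coef_unfold coef1.
case e: (unf w) => [w'|]; last by case: w e.
by rewrite coef1 (unfold_nil e).
Qed.

Lemma unfold_idem i : uns (idem K i) = idem K i.
Proof.
apply: cpaP => j w; rewrite coef_unfold !coef_mono // !xpair_eqE.
case e: (unf w) => [w'|]; last by case: w e => [//|a w] _; rewrite andbF.
by rewrite coef_mono // xpair_eqE (unfold_nil e).
Qed.

(** A cut of the unfolded word either comes from a cut of [w] or falls inside a two-letter word
    after its first letter, where the summand vanishes because of [B]. *)
Lemma split_unfold (G : seq (arrow Q) -> seq (arrow Q) -> K) w w' :
  (forall x b y, B b -> G (rcons x b) y = 0) -> unf w = Some w' ->
  split_sum G w' =
  split_sum (fun x y => if unf x is Some x' then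
    if unf y is Some y' then G x' y' else 0 else 0) w.
Proof.
elim: w w' G => [|a w IH] w' G hG /=; first by case=> <-; rewrite !split_sum_nil.
case e: (f a) => [u|//]; case e': (unf w) IH => [v|//] IH [<-].
rewrite split_sum_cons /= e e'.
case: (Hf e) => [[b [-> _ _]]|[b [c [-> _ _ _ Bb]]]] /=.
  rewrite split_sum_cons (IH v) //; last by move=> x d y; apply: (hG (b :: x)).
  by congr (_ + _); apply: eq_split_sum => x y _; case: (unf x).
rewrite !split_sum_cons (hG [::]) // add0r (IH v) //.
  by congr (_ + _); apply: eq_split_sum => x y _; case: (unf x).
by move=> x d y; apply: (hG [:: b, c & x]).
Qed.

Lemma unfold_None (z : seq (arrow Q) -> seq (arrow Q) -> K) x y :
  unf (x ++ y) = None ->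
  (if unf x is Some x' then if unf y is Some y' then z x' y' else 0 else 0) = 0.
Proof. by rewrite unfold_cat; case: (unf x) => // ?; case: (unf y). Qed.

Lemma conv_split (Q0 : quiver V) (g h : V -> seq (arrow Q0) -> K) i w :
  conv g h i w = split_sum (fun x y => g i x * h (src i x) y) w.
Proof. by []. Qed.

(** The condition says that no path of the left factor stops after the first letter of a two-letter
    word. *)
Lemma unfoldM u v : (forall i x b, B b -> coef u i (rcons x b) = 0) ->
  uns (u * v) = uns u * uns v.
Proof.
move=> hu; apply: cpaP => i w; rewrite coef_unfold coefM.
transitivity (split_sum (fun x y => if unf x is Some x' then
    if unf y is Some y' then coef u i x' * coef v (src i x') y' else 0 else 0) w).
  case e: (unf w) => [w'|].
    rewrite coefM conv_split (split_unfold _ e) // => x b y Bb.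
    by rewrite hu // mul0r.
  rewrite /split_sum big1 // => n _; apply: (unfold_None (fun x y => _)).
  by rewrite cat_take_drop.
rewrite conv_split; apply: eq_split_sum => x y _; rewrite !coef_unfold.
case e: (unf x) => [x'|]; last by rewrite mul0r.
by rewrite (unfold_path i e).2; case: (unf y) => [//|]; rewrite mulr0.
Qed.

Lemma wcoef_unfold u w :
  wcoef (uns u) w = if unf w is Some w' then wcoef u w' else 0.
Proof.
case: w => [//|a w]; rewrite [LHS]coef_unfold /=.
case e: (f a) => [x|//]; case: (unf w) => [v|//].
by case: (Hf e) => [[b [-> <- _]]|[b [c [-> <- _ _ _]]]].
Qed.

Lemma rotsum_unfold S w : (forall x b, B b -> wcoef S (rcons x b) = 0) ->
  rotsum (wcoef (uns S)) w = if unf w is Some w' then rotsum (wcoef S) w' else 0.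
Proof.
move=> hS; rewrite rotsum_split.
transitivity (split_sum (fun x y => if unf x is Some x' then
    if unf y is Some y' then if y' == [::] then 0 else wcoef S (y' ++ x') else 0 else 0) w).
  apply: eq_split_sum => x y _; rewrite wcoef_unfold unfold_cat.
  case ey: (unf y) => [y'|]; case: (unf x) => [x'|]; rewrite ?if_same //.
  by rewrite -(unfold_nil ey).
case e: (unf w) => [w'|].
  rewrite rotsum_split (split_unfold _ e) // => x b y Bb.
  by rewrite -rcons_cat hS // if_same.
rewrite /split_sum big1 // => n _; apply: (unfold_None (fun x y => _)).
by rewrite cat_take_drop.
Qed.

Lemma unfold_potential S : potential S -> potential (uns S).
Proof.
move=> /potentialP pS; apply/potentialP => i w; rewrite coef_unfold.
case e: (unf w) => [w'|]; last by rewrite eqxx.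
case/pS; rewrite (unfold_path i e).2 => s ->; split=> //.
by have /andP[_] := unfold_size e; case: (w) s => // ; case: (w').
Qed.

(** Differentiating by a letter amounts to differentiating by the word it stands for; for a
    two-letter word this is the second-order derivative. *)
Lemma cyc_deriv_unfold S a : potential S ->
  (forall x b, B b -> wcoef S (rcons x b) = 0) ->
  cyc_deriv [:: a] (uns S) = if f a is Some p then uns (cyc_deriv p S) else 0.
Proof.
move=> pS hS; apply: cpaP => i w; rewrite (coef_cyc_deriv [::]); last exact: unfold_potential.
rewrite rotsum_unfold //= ; case e: (f a) => [p|]; last by rewrite coef0 if_same.
rewrite coef_unfold; case: (unf w) => [w'|]; last by rewrite if_same.
case: (Hf e) => [[b [-> _ <-]]|[b [c [-> _ <- _ _]]]].
  by rewrite (coef_cyc_deriv [::]).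
by rewrite (coef_cyc_deriv [:: b]).
Qed.

Lemma unfold_mono a i p : pathb i p -> hd a = i -> f a = Some p ->
  (forall w, unf w = Some p -> w = [:: a]) -> uns (mono K i p) = arr K a.
Proof.
move=> pp ha fa inj; apply: cpaP => j w; rewrite coef_unfold coef_mono /= ?eqxx //.
rewrite xpair_eqE ha; case e: (unf w) => [w'|].
  rewrite coef_mono // xpair_eqE; congr (_ && _)%:R.
  apply/eqP/eqP => [h|h]; first by apply: inj; rewrite e h.
  by move: e; rewrite h /= fa cats0 => -[].
by case: (w =P [:: a]) => [h|]; rewrite ?andbF //; move: e; rewrite h /= fa.
Qed.

End Unfolding.

(** * Splitting off a trivial potential *)

Section JacobianMaps.
Variables (K : fieldType) (V : finType).

Lemma jpi_eq (Q : quiver V) (S u v : cpa K Q) : jpi S u = jpi S v <-> u - v \in jac_pred S.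
Proof. exact: lprojP. Qed.

Lemma jpi_eq0 (Q : quiver V) (S u : cpa K Q) : jpi S u = 0 <-> u \in jac_pred S.
Proof. by rewrite -[0](raddf0 (jpi S)) jpi_eq subr0. Qed.

Lemma jpiK (Q : quiver V) (S : cpa K Q) (x : jac S) : jpi S (lrepr x) = x.
Proof. exact: lreprK. Qed.

Variables (Q1 Q2 : quiver V) (S1 : cpa K Q1) (S2 : cpa K Q2).
Variable F : cpa K Q1 -> cpa K Q2.
Hypotheses (lF : linear F) (FJ : forall u, u \in jac_pred S1 -> F u \in jac_pred S2).

Definition jac_lift (x : jac S1) : jac S2 := jpi S2 (F (lrepr x)).

Lemma jac_liftE u : jac_lift (jpi S1 u) = jpi S2 (F u).
Proof. by apply/jpi_eq; rewrite -(linB lF) FJ //; apply/jpi_eq; apply: jpiK. Qed.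

Lemma jac_lift_linear : linear jac_lift.
Proof.
move=> c x y; rewrite -[x]jpiK -[y]jpiK -linearP !jac_liftE lF.
exact: linearP.
Qed.
End JacobianMaps.

Section Splitting.
Variables (K : fieldType) (V : finType) (Q C : quiver V).
Variables (S : cpa K Q) (T : cpa K C).
Local Notation D := (dsum_quiver Q C).
Local Notation W := (dsum_pot S T).
Hypotheses (pS : potential S) (pT : potential T) (tT : trivial_pot T).

Local Notation dsum_inl := (@dsum_inl K V Q C).
Local Notation dsum_inr := (@dsum_inr K V Q C).

Definition inl_word (a : arrow D) := if a is inl b then Some [:: b] else None.
Definition inr_word (a : arrow D) := if a is inr b then Some [:: b] else None.
Definition proj_word (b : arrow Q) : option (seq (arrow D)) := Some [:: inl b].
(** The projection that sets the arrows of [C] to 0: unfolding along the inclusion of words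
    restricts a series to the words in [Q]. *)
Definition dsum_proj : cpa K D -> cpa K Q := @unfold_series K V D Q proj_word.

Lemma unfoldable_inl : @unfoldable V Q D inl_word pred0.
Proof. by case=> // b u [<-]; left; exists b. Qed.
Let unl := unfoldable_inl.
Let unr : @unfoldable V C D inr_word pred0.
Proof. by case=> // b u [<-]; left; exists b. Qed.
Let unp : @unfoldable V D Q proj_word pred0.
Proof. by move=> b u [<-]; left; exists (inl b). Qed.

Lemma dsum_inl_linear : linear dsum_inl. Proof. exact: unfold_linear unl. Qed.
Lemma dsum_proj_linear : linear dsum_proj. Proof. exact: unfold_linear unp. Qed.
Lemma dsum_inr_linear : linear dsum_inr. Proof. exact: unfold_linear unr. Qed.

Lemma dsum_inl_cont : madic_continuous dsum_inl. Proof. exact: (unfold_cont K unl). Qed.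
Lemma dsum_proj_cont : madic_continuous dsum_proj. Proof. exact: (unfold_cont K unp). Qed.

Lemma dsum_inlM u v : dsum_inl (u * v) = dsum_inl u * dsum_inl v.
Proof. exact: (unfoldM unl). Qed.
Lemma dsum_projM u v : dsum_proj (u * v) = dsum_proj u * dsum_proj v.
Proof. exact: (unfoldM unp). Qed.

Lemma dsum_inl1 : dsum_inl 1 = 1. Proof. exact: (unfold1 K unl). Qed.
Lemma dsum_inl_idem i : dsum_inl (idem K i) = idem K i.
Proof. exact: (unfold_idem K unl). Qed.

Lemma dsum_inl_arr b : dsum_inl (arr K b) = arr K (inl b : arrow D).
Proof.
apply: (unfold_mono K unl (a := inl b) (i := hd b) (p := [:: b])) => //=; first by rewrite eqxx.
case=> [|[b'|c'] w] //=; case e: unfold_word => [v|//] [-> v0].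
by have := unfold_size unl e; rewrite v0; case: (w).
Qed.

Lemma dsum_inr_arr c : dsum_inr (arr K c) = arr K (inr c : arrow D).
Proof.
apply: (unfold_mono K unr (a := inr c) (i := hd c) (p := [:: c])) => //=; first by rewrite eqxx.
case=> [|[b'|c'] w] //=; case e: unfold_word => [v|//] [-> v0].
by have := unfold_size unr e; rewrite v0; case: (w).
Qed.

Lemma dsum_inlK : cancel dsum_inl dsum_proj.
Proof.
move=> u; apply: cpaP => i w; rewrite (coef_unfold unp).
have -> : unfold_word proj_word w = Some (map inl w).
  by elim: w => //= a w ->.
rewrite (coef_unfold unl); suff -> : unfold_word inl_word (map inl w) = Some w by [].
by elim: w => //= a w ->.
Qed.

Lemma dsum_proj_inr u : mpow 1 u -> dsum_proj (dsum_inr u) = 0.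
Proof.
move=> /mpow_coefP hu; apply: cpaP => i w; rewrite (coef_unfold unp) coef0.
have -> : unfold_word proj_word w = Some (map inl w).
  by elim: w => //= a w ->.
by rewrite (coef_unfold unr); case: w => [|a w] //=; apply: hu.
Qed.

Lemma cyc_deriv_inl a : cyc_deriv [:: inl a : arrow D] W = dsum_inl (cyc_deriv [:: a] S).
Proof.
rewrite (linD (cyc_deriv_linear _)) (cyc_deriv_unfold unl) //.
by rewrite (cyc_deriv_unfold unr) //= addr0.
Qed.

Lemma cyc_deriv_inr a : cyc_deriv [:: inr a : arrow D] W = dsum_inr (cyc_deriv [:: a] T).
Proof.
rewrite (linD (cyc_deriv_linear _)) (cyc_deriv_unfold unl) //.
by rewrite (cyc_deriv_unfold unr) //= add0r.
Qed.

Lemma jac_inl u : u \in jac_pred S -> dsum_inl u \in jac_pred W.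
Proof.
move: u; apply: (jac_ind dsum_inl_linear dsum_inl_cont) => a x y.
by rewrite !dsum_inlM -cyc_deriv_inl jac_predMr // jac_predMl // jac_gen.
Qed.

(** The derivatives of [T] are homogeneous of degree 1 in the arrows of [C], so the projection
    annihilates them. *)
Lemma jac_proj u : u \in jac_pred W -> dsum_proj u \in jac_pred S.
Proof.
move: u; apply: (jac_ind dsum_proj_linear dsum_proj_cont) => a x y.
rewrite !dsum_projM; case: a => a; last first.
  rewrite cyc_deriv_inr dsum_proj_inr ?mulr0 ?mul0r ?rpred0 // => z lz.
  have h1 : homogeneous 1 (cyc_deriv [:: a] T).
    rewrite -tT.2; exists [:: (1, cyc_deriv [:: a] T)]; last by rewrite big_seq1 scale1r.
    by move=> t; rewrite inE => /eqP ->; exists a.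
  by apply/eqP; apply: contraT => /h1 e; rewrite e in lz.
by rewrite cyc_deriv_inl dsum_inlK jac_predMr // jac_predMl // jac_gen.
Qed.

(** Triviality writes each arrow of [C] as a combination of derivatives of [T]. *)
Lemma jac_arr_inr c : arr K (inr c : arrow D) \in jac_pred W.
Proof.
have : homogeneous 1 (arr K c).
  move=> x; rewrite /arr /Defs.mono; case: (val x =P _) => [e _|_]; last by rewrite eqxx.
  by rewrite /plen /pword e.
rewrite -tT.2 => -[s hs e]; rewrite -dsum_inr_arr e (lin_sum dsum_inr_linear).
rewrite big_seq rpred_sum // => t /hs[a _ <-].
by rewrite (linZ dsum_inr_linear) rpredZ // -cyc_deriv_inr jac_gen.
Qed.

(** On a path the letters are treated from left to right: arrows of [Q] are fixed and those of [C]
    lie in the ideal. *)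
Lemma jac_inl_proj u : u - dsum_inl (dsum_proj u) \in jac_pred W.
Proof.
pose F u := u - dsum_inl (dsum_proj u).
have lF : linear F.
  move=> c x y; rewrite /F dsum_proj_linear dsum_inl_linear opprD addrACA.
  by rewrite scalerBr.
have cF : madic_continuous F.
  have cc : madic_continuous (fun u => dsum_inl (dsum_proj u)).
    exact: cont_comp dsum_proj_cont dsum_inl_cont.
  move=> n; have [m hm] := cc n; exists (maxn m n) => x hx; apply: mpowB.
    by apply: mpow_le hx; apply: leq_maxr.
  by apply: hm; apply: mpow_le hx; apply: leq_maxl.
rewrite -/(F u); apply: (density_jac lF cF) => -[[i w] p] _.
rewrite /F /qmono /ptgt /pword /= in p *; elim: w i p => [|a w IH] i /= => [_|].
  by rewrite /dsum_proj (unfold_idem K unp) dsum_inl_idem subrr rpred0.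
case/andP => /eqP <- p; rewrite mono_arrM dsum_projM dsum_inlM.
case: a p => a p; last first.
  rewrite rpredB // ?jac_predMr ?jac_arr_inr //.
  by rewrite -dsum_inr_arr dsum_proj_inr ?(lin0 dsum_inl_linear) ?mul0r ?rpred0 //; apply: mpow_arr.
rewrite -dsum_inl_arr dsum_inlK -mulrBr jac_predMl //.
exact: IH.
Qed.

End Splitting.

(** * The Jacobian algebra of the reduced part *)

Section ReducedPart.
Variables (K : fieldType) (V : finType) (Qt Q' C : quiver V).
Variables (St : cpa K Qt) (S' : cpa K Q') (T : cpa K C).
Variable phi : cpa K Qt -> cpa K (dsum_quiver Q' C).
Hypotheses (lf : loop_free Qt) (pSt : potential St) (red : is_reduced_part St S' T phi).

(** Modulo the Jacobian ideals, the inclusion followed by the inverse of [phi] is inverted by [phi]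
    followed by the projection. *)
Lemma reduced_part_iso : exists psi : jac_hom S' St,
  [/\ is_induced phi psi, bijective psi & forall i, psi (jpi S' (idem K i)) = jpi St (idem K i)].
Proof.
case: red => -[lf' pS'] _ [lfC pT] tT [lphi mphi [phi' phiK phi'K] iphi cyc].
have lfD : loop_free (dsum_quiver Q' C) by case=> a; [apply: lf'|apply: lfC].
have lphi' : linear phi'.
  by move=> c x y; rewrite -{1}[x]phi'K -{1}[y]phi'K -lphi phiK.
have mphi' : monoid_morphism phi'.
  split; first by rewrite -mphi.1 phiK.
  by move=> x y; rewrite -{1}[x]phi'K -{1}[y]phi'K -mphi.2 phiK.
have iphi' i : phi' (idem K i) = idem K i by rewrite -iphi phiK.
set W := dsum_pot S' T in cyc.
have JW u : (u \in jac_pred W) = (u \in jac_pred (phi St)).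
  exact: esym (jac_pred_equivalent cyc u).
have phi'J u : u \in jac_pred W -> phi' u \in jac_pred St.
  by rewrite JW; apply: jac_inverse.
(* The same inversion lemma with the roles of [phi] and [phi'] exchanged, for the potential
   [phi St]. *)
have phiJ u : u \in jac_pred St -> phi u \in jac_pred W.
  rewrite JW -{1}[St]phiK; apply: jac_inverse => //.
  exact: potential_morphism.
pose F u := phi' (dsum_inl (C := C) u); pose G u := dsum_proj (C := C) (phi u).
have lF : linear F by exact: (comp_linear (@dsum_inl_linear K V Q' C) lphi').
have lG : linear G by exact: (comp_linear lphi (@dsum_proj_linear K V Q' C)).
have FJ u : u \in jac_pred S' -> F u \in jac_pred St.
  by move=> uJ; apply: phi'J; apply: jac_inl.
have GJ u : u \in jac_pred St -> G u \in jac_pred S'.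
  by move=> uJ; apply: (jac_proj pS' pT tT); apply: phiJ.
have m_lift : monoid_morphism (jac_lift (S1 := S') St F).
  split.
    transitivity (jpi St (F 1)); first exact: (jac_liftE lF FJ 1).
    by rewrite /F dsum_inl1 mphi'.1.
  move=> x y; rewrite -[x]jpiK -[y]jpiK -jpiM !jac_liftE // -jpiM.
  by rewrite /F dsum_inlM mphi'.2.
exists (JacHom (jac_lift_linear lF FJ) m_lift); split => /=.
- by move=> u w e; rewrite [LHS](jac_liftE lF FJ) /F -e phiK.
- exists (jac_lift (S1 := St) S' G) => x; case: (jpi_surj x) => u ->.
    rewrite (jac_liftE lF FJ) (jac_liftE lG GJ).
    by rewrite /F /G phi'K dsum_inlK.
  rewrite (jac_liftE lG GJ) (jac_liftE lF FJ).
  apply/jpi_eq; rewrite -[X in _ - X]phiK -(linB lphi') phi'J //.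
  by rewrite -opprB rpredN /G jac_inl_proj.
- by move=> i; rewrite [LHS](jac_liftE lF FJ) /F dsum_inl_idem iphi'.
Qed.
End ReducedPart.

(** * Premutation of a potential *)

Lemma sum_sub (T : finType) (P : pred T) (Z : nmodType) (E : T -> Z) :
  (forall t, ~~ P t -> E t = 0) -> \sum_t E t = \sum_(t : {t | P t}) E (val t).
Proof.
move=> h; rewrite (bigID P) /= [X in _ + X]big1 ?addr0; last by move=> t /h.
rewrite (reindex_omap (val : {t | P t} -> T) insub) => [|t Pt]; last by rewrite insubT.
by apply: eq_bigl => t; rewrite (valP t) valK eqxx.
Qed.

Section SecondDerivatives.
Variables (K : fieldType) (V : finType) (Q : quiver V) (S : cpa K Q).
Hypotheses (lf : loop_free Q) (pS : potential S).

Lemma cyc_deriv2_eq0 a b : tl b != hd a -> cyc_deriv [:: b; a] S = 0.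
Proof.
move=> ne; apply: cpaP => i w; rewrite (coef_cyc_deriv [:: b]) // coef0.
case: eqP => // _; rewrite rotsum_acyclic //= /composable.
by case: (w) => [|c z] /=; rewrite (negPf ne).
Qed.

Lemma cyc_deriv2_idemr b a : cyc_deriv [:: b; a] S * idem K (hd b) = cyc_deriv [:: b; a] S.
Proof.
apply: cpaP => i w; rewrite coef_idemMr (coef_cyc_deriv [:: b]) //.
case: (i =P _) => [->|_]; last by rewrite mulr0.
have [cy|ncy] := boolP (cycle composable [:: b, a & w]); last first.
  by rewrite rotsum_acyclic // mulr0.
move: cy; rewrite cycle_pathb /= => /andP[/andP[/eqP ha pw] /eqP sr].
have -> : src (tl a) w = hd b := sr.
by rewrite eqxx mul1r.
Qed.

Lemma cyc_deriv2_ideml b a : idem K (tl a) * cyc_deriv [:: b; a] S = cyc_deriv [:: b; a] S.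
Proof. by apply: idemM => x; apply: cyc_deriv_tgt. Qed.

Lemma cyc_deriv_ideml a : idem K (tl a) * cyc_deriv [:: a] S = cyc_deriv [:: a] S.
Proof.
apply: cpaP => i w; rewrite coef_idemM (coef_cyc_deriv [::]) //.
by case: (i =P _) => _; rewrite ?mul1r ?mulr0.
Qed.

Lemma cyc_deriv_idemr a : cyc_deriv [:: a] S * idem K (hd a) = cyc_deriv [:: a] S.
Proof.
rewrite cyc_deriv_right // mulr_suml; apply: eq_bigr => b _.
have [e|ne] := eqVneq (tl b) (hd a); last by rewrite cyc_deriv2_eq0 // !mul0r.
by rewrite -mulrA -e arr_idemK.
Qed.

(** A constant term would come from a 2-cycle [ba]. Without one, the series substituted for a* b*
    lies in the arrow ideal, which makes that substitution continuous. *)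
Lemma cyc_deriv2_mpow b a : no_2cycle_at Q (tl b) -> mpow 1 (cyc_deriv [:: b; a] S).
Proof.
move=> no2; apply/mpow_coefP => i w; rewrite ltnS leqn0 size_eq0 => /eqP ->.
rewrite (coef_cyc_deriv [:: b]) //; case: eqP => // _; rewrite rotsum_acyclic //=.
apply/negP; rewrite /composable => /and3P[/eqP e1 /eqP e2 _].
by apply: (no2 a b); split; rewrite ?e1 ?e2 ?eqxx.
Qed.

(** Accounts for the cubic terms b* [ba] a* of the premutation. *)
Lemma cyc_deriv_3cycle (x p q r : arrow Q) : tl p = hd q -> tl q = hd r -> tl r = hd p ->
  cyc_deriv [:: x] (mono K (hd p) [:: p; q; r]) =
  (if p == x then arr K q * arr K r else 0) +
  (if q == x then arr K r * arr K p else 0) +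
  (if r == x then arr K p * arr K q else 0).
Proof.
move=> e1 e2 e3.
have pt : pathb (hd p) [:: p; q; r] by rewrite /= e1 e2 !eqxx.
rewrite cyc_deriv_mono // /= addr0 addrA idem_arrK.
congr (_ + _ + _).
- case: eqP => // _; rewrite e1 mono_arrM e2 -[mono K (hd r) [:: r]]/(arr K r).
  by rewrite -e3 -!mulrA arr_idemK.
- by case: eqP => // _; rewrite e2 -[mono K (hd r) [:: r]]/(arr K r).
- case: eqP => // _; rewrite e3 -[mono K _ [::]]/(idem K (Q := Q) (hd p)) mulrA.
  by rewrite idem_arrK.
Qed.
End SecondDerivatives.

Section Premutation.
Variables (K : fieldType) (V : finType) (Q : quiver V) (S : cpa K Q) (k : V).
Hypotheses (lf : loop_free Q) (pS : potential S) (no2 : no_2cycle_at Q k).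
Hypothesis Sk : no_term_at k S.
Local Notation Qt := (premut_quiver Q k).
Local Notation St := (premut_pot k S).
Local Notation A := (cpa K Q).
Local Notation At := (cpa K Qt).
Local Notation in_arrow := (in_arrow Q k).
Local Notation out_arrow := (out_arrow Q k).
Local Notation kept_arrow := (kept_arrow Q k).

Definition kA (c : kept_arrow) : arrow Qt := kept c.
Definition bA (b : out_arrow) (a : in_arrow) : arrow Qt := bracket (b, a).
Definition iA (a : in_arrow) : arrow Qt := in_star a.
Definition oA (b : out_arrow) : arrow Qt := out_star b.

Lemma hd_in (a : in_arrow) : hd (val a) = k. Proof. exact/eqP/(valP a). Qed.
Lemma tl_out (b : out_arrow) : tl (val b) = k. Proof. exact/eqP/(valP b). Qed.
Lemma tl_in (a : in_arrow) : tl (val a) != k.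
Proof. by have := lf (val a); rewrite hd_in eq_sym. Qed.
Lemma hd_out (b : out_arrow) : hd (val b) != k.
Proof. by have := lf (val b); rewrite tl_out. Qed.
Lemma hd_kept (c : kept_arrow) : hd (val c) != k. Proof. by case/andP: (valP c). Qed.
Lemma tl_kept (c : kept_arrow) : tl (val c) != k. Proof. by case/andP: (valP c). Qed.

Lemma tl_iA a : tl (iA a) = k. Proof. exact: hd_in. Qed.
Lemma hd_oA b : hd (oA b) = k. Proof. exact: tl_out. Qed.

Lemma premut_loop_free : loop_free Qt.
Proof.
case=> [[c|[b a]]|[a|b]] /=.
- exact: lf.
- apply/eqP => e; apply: (no2 (a := val a) (b := val b)).
  by rewrite hd_in tl_out e eqxx.
- by rewrite eq_sym; apply: lf.
- by rewrite eq_sym; apply: lf.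
Qed.

(** The possible first letters of hooks: a cut right after such a letter is a cut at k. *)
Definition at_k : pred (arrow Q) := fun b => tl b == k.
Local Notation br := (@unfold_series K V Q Qt (@unbracket V Q k)).

Lemma unfoldable_unbracket : unfoldable (@unbracket V Q k : arrow Qt -> _) at_k.
Proof.
case=> [[c|[b a]]|//] u [<-]; [left|right]; first by exists (val c).
by exists (val b), (val a); split; rewrite // ?hd_in ?tl_out // /at_k tl_out.
Qed.
Local Notation unb := unfoldable_unbracket.

Lemma br_linear : linear br. Proof. exact: unfold_linear unb. Qed.
Lemma br_cont : madic_continuous br. Proof. exact: (unfold_cont K unb). Qed.

(** A hook cut between the two factors would lose its bracket, so the left factor must have no path
    starting at k. *)
Lemma brM u v : u * idem K k = 0 -> br (u * v) = br u * br v.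
Proof.
move=> h; apply: (unfoldM unb) => i x b bk.
have := congr1 (fun z : A => coef z i (rcons x b)) h.
by rewrite coef_idemMr src_rcons (eqP bk) eqxx mul1r coef0.
Qed.

(** No term of [S] has its base point inside a hook; this is the condition of [cyc_deriv_unfold]. *)
Lemma wcoef_S x b : at_k b -> wcoef S (rcons x b) = 0.
Proof.
move=> bk; case e: (rcons x b) => [//|c z]; rewrite /= -e.
have [p|/coef_out //] := boolP (pathb (hd c) (rcons x b)).
rewrite (coefF _ p); apply/eqP; apply: contraT => /Sk.
by rewrite /psrc /ptgt /pword /= src_rcons (eqP bk) eqxx.
Qed.

Lemma br_idem i : br (idem K i) = idem K i. Proof. exact: (unfold_idem K unb). Qed.

Lemma br_kept c : br (arr K (val c)) = arr K (kA c).
Proof.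
apply: (unfold_mono K unb (a := kA c) (i := hd (val c)) (p := [:: val c])) => //=.
  by rewrite eqxx.
case=> [|[[c'|[b a]]|//] w] //=; case e: unfold_word => [v|//].
  by case=> /val_inj -> v0; have := unfold_size unb e; rewrite v0; case: (w).
by case=> h; have := tl_kept c; rewrite -[val c]h tl_out eqxx.
Qed.

Lemma br_hook b a : br (arr K (val b) * arr K (val a)) = arr K (bA b a).
Proof.
have -> : arr K (val b) * arr K (val a) = mono K (hd (val b)) [:: val b; val a].
  by rewrite mono_arrM tl_out -[X in mono K X _](hd_in a).
apply: (unfold_mono K unb (a := bA b a)) => //=.
  by rewrite tl_out hd_in !eqxx.
case=> [|[[c|[b' a']]|//] w] //=; case e: unfold_word => [v|//] [].
  by move=> h; have := tl_kept c; rewrite [val c]h tl_out eqxx.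
move=> /val_inj -> /val_inj -> v0.
by have := unfold_size unb e; rewrite v0; case: (w).
Qed.

Lemma cyc_deriv_premut x : cyc_deriv [:: x] St =
  (if unbracket x is Some p then br (cyc_deriv p S) else 0) +
  \sum_b \sum_a ((if oA b == x then arr K (bA b a) * arr K (iA a) else 0) +
    (if bA b a == x then arr K (iA a) * arr K (oA b) else 0) +
    (if iA a == x then arr K (oA b) * arr K (bA b a) else 0)).
Proof.
rewrite (linD (cyc_deriv_linear _)) (cyc_deriv_unfold unb) //; last exact: wcoef_S.
rewrite pair_big (lin_sum (cyc_deriv_linear _)) /=; congr (_ + _).
apply: eq_bigr => -[b a] _ /=.
rewrite -[X in mono K X _](hd_oA b) (@cyc_deriv_3cycle _ _ _ _ (oA b) (bA b a) (iA a)) //.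
by rewrite tl_iA hd_oA.
Qed.

Lemma cyc_deriv_kept c : cyc_deriv [:: kA c] St = br (cyc_deriv [:: val c] S).
Proof.
rewrite cyc_deriv_premut [X in _ + X]big1 ?addr0 // => b _.
by rewrite big1 // => a _; rewrite !addr0.
Qed.

Lemma cyc_deriv_bracket b a : cyc_deriv [:: bA b a] St =
  br (cyc_deriv [:: val b; val a] S) + arr K (iA a) * arr K (oA b).
Proof.
rewrite cyc_deriv_premut; congr (_ + _).
rewrite (bigD1 b) //= [X in _ + X]big1 ?addr0 => [|b' ne].
  rewrite (bigD1 a) //= [X in _ + X]big1 ?addr0 => [|a' ne].
    by rewrite eqxx add0r.
  by rewrite -[bA b a' == _]/((b == b) && (a' == a)) (negPf ne) andbF !addr0.
rewrite big1 // => a' _.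
by rewrite -[bA b' a' == _]/((b' == b) && (a' == a)) (negPf ne) !addr0.
Qed.

Lemma cyc_deriv_in_star a : cyc_deriv [:: iA a] St =
  \sum_b arr K (oA b) * arr K (bA b a).
Proof.
rewrite cyc_deriv_premut add0r; apply: eq_bigr => b _.
rewrite (bigD1 a) //= [X in _ + X]big1 ?addr0 => [|a' ne]; first by rewrite eqxx !add0r.
by rewrite -[iA a' == _]/(a' == a) (negPf ne) !addr0.
Qed.

Lemma cyc_deriv_out_star b : cyc_deriv [:: oA b] St =
  \sum_a arr K (bA b a) * arr K (iA a).
Proof.
rewrite cyc_deriv_premut add0r (bigD1 b) //= [X in _ + X]big1 ?addr0 => [|b' ne].
  by apply: eq_bigr => a _; rewrite eqxx !addr0.
rewrite big1 // => a _.
by rewrite -[oA b' == _]/(b' == b) (negPf ne) !addr0.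
Qed.

Lemma premut_potential : potential St.
Proof.
apply: (potentialD (unfold_potential unb pS)).
elim/big_rec: _ => [|[b a] u _ pu]; first exact: potential0.
apply: (potentialD _ pu) => x; rewrite /Defs.mono.
case: (val x =P _) => [e _|_]; last by rewrite eqxx.
by rewrite /plen /psrc /ptgt /pword e; split=> //; apply: tl_iA.
Qed.

(** * The corners away from k and the maps between them *)

Definition off (Q0 : quiver V) : cpa K Q0 := 1 - idem K k.
Arguments off : clear implicits.

Lemma idem_off (Q0 : quiver V) i : idem K i * off Q0 = (i != k)%:R *: idem K i.
Proof.
rewrite /off mulrBr mulr1 idem_idem; case: eqP => [->|_]; rewrite ?scale1r ?scale0r.
  by rewrite subrr.
by rewrite subr0.
Qed.

Lemma off_idem (Q0 : quiver V) i : off Q0 * idem K i = (i != k)%:R *: idem K i.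
Proof.
rewrite /off mulrBl mul1r idem_idem eq_sym; case: eqP => [->|_]; rewrite ?scale1r ?scale0r.
  by rewrite subrr.
by rewrite subr0.
Qed.

Lemma off_idemk (Q0 : quiver V) : off Q0 * idem K k = 0.
Proof. by rewrite off_idem eqxx scale0r. Qed.

Lemma idemk_off (Q0 : quiver V) : idem K k * off Q0 = 0.
Proof. by rewrite idem_off eqxx scale0r. Qed.

Lemma offK (Q0 : quiver V) : off Q0 * off Q0 = off Q0.
Proof. by rewrite {1}/off mulrBl mul1r idemk_off subr0. Qed.

Lemma offL (Q0 : quiver V) i (u : cpa K Q0) : i != k -> idem K i * u = u -> off Q0 * u = u.
Proof. by move=> ne <-; rewrite mulrA off_idem ne scale1r. Qed.

Lemma offR (Q0 : quiver V) i (u : cpa K Q0) : i != k -> u * idem K i = u -> u * off Q0 = u.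
Proof. by move=> ne <-; rewrite -mulrA idem_off ne scale1r. Qed.

(** Cutting down to the corner inside the definition gives a linear continuous map on the whole
    algebra, multiplicative across a middle factor [off Q]. *)
Definition brh (u : A) : At := br (off Q * u * off Q).

Lemma brh_linear : linear brh.
Proof.
exact: comp_linear (comp_linear (mull_linear (off Q)) (mulr_linear (off Q))) br_linear.
Qed.

Lemma brh_cont : madic_continuous brh.
Proof.
by apply: cont_comp br_cont; apply: cont_comp (cont_mulr _); apply: cont_mull.
Qed.

Lemma brhM u v : brh (u * off Q * v) = brh u * brh v.
Proof.
rewrite /brh -brM; last by rewrite -mulrA off_idemk mulr0.
by congr br; rewrite !mulrA -(mulrA _ (off Q) (off Q)) offK.
Qed.

Lemma brhE u : off Q * u = u -> u * off Q = u -> brh u = br u.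
Proof. by rewrite /brh => -> ->. Qed.

Lemma br_idemMl i u : br (idem K i * u) = idem K i * br u.
Proof.
apply: cpaP => j w; rewrite coef_idemM !(coef_unfold unb).
by case: (unfold_word _ w) => [w'|]; rewrite ?coef_idemM ?mulr0.
Qed.

Lemma br_idemMr i u : br (u * idem K i) = br u * idem K i.
Proof.
apply: cpaP => j w; rewrite coef_idemMr !(coef_unfold unb).
case e: (unfold_word _ w) => [w'|]; rewrite ?mulr0 //.
by rewrite coef_idemMr (unfold_path unb j e).2.
Qed.

Lemma off_brh u : off Qt * brh u = brh u.
Proof.
rewrite {1}/off mulrBl mul1r -br_idemMl !mulrA idemk_off !mul0r (lin0 br_linear).
by rewrite subr0.
Qed.

Lemma brh_idemMl i u : i != k -> brh (idem K i * u) = idem K i * brh u.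
Proof. by move=> ne; rewrite /brh -br_idemMl !mulrA off_idem idem_off ne !scale1r. Qed.

Lemma brh_idem i : i != k -> brh (idem K i) = idem K i.
Proof.
by move=> ne; rewrite brhE ?br_idem // ?off_idem ?idem_off ne scale1r.
Qed.

Implicit Types (c : kept_arrow) (a : in_arrow) (b : out_arrow).

Lemma off_kept c : off Q * arr K (val c) = arr K (val c).
Proof. exact: offL (hd_kept c) (idem_arrK _ _). Qed.
Lemma kept_off c : arr K (val c) * off Q = arr K (val c).
Proof. exact: offR (tl_kept c) (arr_idemK _ _). Qed.
Lemma off_out b : off Q * arr K (val b) = arr K (val b) :> A.
Proof. exact: offL (hd_out b) (idem_arrK _ _). Qed.
Lemma in_off a : arr K (val a) * off Q = arr K (val a) :> A.
Proof. exact: offR (tl_in a) (arr_idemK _ _). Qed.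

Lemma brh_kept c : brh (arr K (val c)) = arr K (kA c).
Proof. by rewrite brhE ?off_kept ?kept_off ?br_kept. Qed.

Lemma brh_hook b a : brh (arr K (val b) * arr K (val a)) = arr K (bA b a).
Proof. by rewrite brhE ?br_hook // ?mulrA ?off_out // -mulrA in_off. Qed.

Lemma off_deriv2 b a : off Q * cyc_deriv [:: val b; val a] S = cyc_deriv [:: val b; val a] S.
Proof. exact: offL (tl_in a) (cyc_deriv2_ideml _ _ _). Qed.

Lemma deriv2_off b a : cyc_deriv [:: val b; val a] S * off Q = cyc_deriv [:: val b; val a] S.
Proof. exact: offR (hd_out b) (cyc_deriv2_idemr _ _ _). Qed.

Lemma brh_deriv2 b a : brh (cyc_deriv [:: val b; val a] S) =
  cyc_deriv [:: bA b a] St - arr K (iA a) * arr K (oA b).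
Proof. by rewrite brhE ?off_deriv2 ?deriv2_off // cyc_deriv_bracket addrK. Qed.

Lemma brh_deriv c : brh (cyc_deriv [:: val c] S) = cyc_deriv [:: kA c] St.
Proof.
rewrite brhE ?cyc_deriv_kept //.
  exact: offL (tl_kept c) (cyc_deriv_ideml _ _).
exact: offR (hd_kept c) (cyc_deriv_idemr _ _ _).
Qed.

Lemma cyc_deriv_left_out b :
  cyc_deriv [:: val b] S = \sum_(a : in_arrow) arr K (val a) * cyc_deriv [:: val b; val a] S.
Proof.
rewrite (cyc_deriv_left _ lf pS) (sum_sub (P := fun x => hd x == k)) // => a ne.
by rewrite cyc_deriv2_eq0 ?mulr0 // tl_out eq_sym.
Qed.

Lemma cyc_deriv_right_in a :
  cyc_deriv [:: val a] S = \sum_(b : out_arrow) cyc_deriv [:: val b; val a] S * arr K (val b).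
Proof.
rewrite (cyc_deriv_right _ lf pS) (sum_sub (P := fun x => tl x == k)) // => b ne.
by rewrite cyc_deriv2_eq0 ?mul0r // hd_in.
Qed.

(** This is the image of b' d_b S. Modulo the derivative at [ba], the bracketed derivative is - a*
    b*, and the sum becomes minus the derivative at b'* multiplied by b*. *)
Lemma jac_hook_deriv b b' :
  \sum_a arr K (bA b' a) * brh (cyc_deriv [:: val b; val a] S) \in jac_pred St.
Proof.
under eq_bigr => a _ do rewrite brh_deriv2 mulrBr mulrA.
rewrite sumrB -mulr_suml -cyc_deriv_out_star rpredB //.
  by apply: rpred_sum => a _; rewrite jac_predMl ?jac_gen.
by rewrite jac_predMr ?jac_gen.
Qed.

(** The mirror statement, for d_a S followed by a': the sum becomes minus a* times the derivative at
    a'*. *)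
Lemma jac_deriv_hook a a' :
  \sum_b brh (cyc_deriv [:: val b; val a] S) * arr K (bA b a') \in jac_pred St.
Proof.
under eq_bigr => b _ do rewrite brh_deriv2 mulrBl -mulrA.
rewrite sumrB -mulr_sumr -cyc_deriv_in_star rpredB //.
  by apply: rpred_sum => b _; rewrite jac_predMr ?jac_gen.
by rewrite jac_predMl ?jac_gen.
Qed.

Lemma kept_or_in (x : arrow Q) : hd x != k ->
  (exists c, x = val c) \/ (exists b, x = val b).
Proof.
move=> hx; have [tx|tx] := boolP (tl x == k); first by right; exists (Sub x tx).
have p : (hd x != k) && (tl x != k) by rewrite hx.
by left; exists (Sub x p).
Qed.

Lemma off_mono (Q0 : quiver V) i w : i != k -> off Q0 * mono K i w = mono K i w.
Proof. by move=> ne; apply: (offL ne); rewrite idem_mono eqxx scale1r. Qed.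

Lemma mono_off (Q0 : quiver V) i (w : seq (arrow Q0)) : src i w != k ->
  mono K i w * off Q0 = mono K i w.
Proof. by move=> ne; apply: (offR ne); rewrite mono_idem eqxx scale1r. Qed.

Lemma brh_kl u : brh (idem K k * u) = 0.
Proof. by rewrite /brh !mulrA off_idemk !mul0r (lin0 br_linear). Qed.

Lemma brh_kr u : brh (u * idem K k) = 0.
Proof. by rewrite /brh -!mulrA idemk_off !mulr0 (lin0 br_linear). Qed.

(** A derivative at an arrow incident to k has an end at k. Inside the corner it occurs only next to
    a further arrow at k, and expanding it to second order produces hooks. *)
Lemma brh_jac u : u \in jac_pred S -> brh u \in jac_pred St.
Proof.
move: u; apply: (jac_ind brh_linear brh_cont) => x [[i w] pw] [[j z] pz].
rewrite /qmono /ptgt /pword /=; set x0 := Defs.mono _ _ _; set y0 := Defs.mono _ _ _.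
have y0E : idem K j * y0 = y0 by rewrite /y0 idem_mono eqxx scale1r.
have x0E : x0 * idem K (src i w) = x0 by rewrite /x0 mono_idem eqxx scale1r.
have [ik|ik] := eqVneq i k.
  have -> : x0 = idem K k * x0 by rewrite /x0 idem_mono ik eqxx scale1r.
  by rewrite -!mulrA brh_kl rpred0.
have [zk|zk] := eqVneq (src j z) k.
  have -> : y0 = y0 * idem K k by rewrite /y0 mono_idem zk eqxx scale1r.
  by rewrite mulrA brh_kr rpred0.
(* If [x] enters k, then [y0] must begin with an arrow a' into k, which forms hooks with the last
   arrows of the derivative. *)
have [hx|hx] := boolP (hd x == k).
  pose a : in_arrow := Sub x hx; rewrite -[x]/(val a).
  have [sk|sk] := eqVneq (src i w) k.
    rewrite -x0E sk -(mulrA x0) -(cyc_deriv_ideml pS) (mulrA (idem K k)) idem_idem.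
    by rewrite eq_sym (negPf (tl_in a)) scale0r mul0r mulr0 mul0r (lin0 brh_linear) rpred0.
  have x0f : x0 * off Q = x0 by apply: mono_off.
  have [jk|jk] := eqVneq j k; last first.
    rewrite -y0E mulrA -(mulrA x0) -(cyc_deriv_idemr lf pS) -(mulrA _ (idem K _)) idem_idem.
    rewrite hd_in eq_sym (negPf jk) scale0r !mulr0 mul0r.
    by rewrite (lin0 brh_linear) rpred0.
  case: z pz @y0 y0E zk => [|x' z] pz y0 y0E zk; first by rewrite -[src _ _]/j jk eqxx in zk.
  have /andP[hx' pz'] : (hd x' == j) && pathb (tl x') z := pz.
  rewrite jk in hx'; pose a' : in_arrow := Sub x' hx'.
  have -> : y0 = arr K (val a') * (off Q * mono K (tl (val a')) z).
    rewrite off_mono ?tl_in // /y0 -[z in RHS]/z -mono_arrM hd_in jk //.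
  rewrite cyc_deriv_right_in mulr_sumr mulr_suml (lin_sum brh_linear).
  have E b : brh (x0 * (cyc_deriv [:: val b; val a] S * arr K (val b)) *
        (arr K (val a') * (off Q * mono K (tl (val a')) z))) =
      brh x0 * (brh (cyc_deriv [:: val b; val a] S) * arr K (bA b a')) *
        brh (mono K (tl (val a')) z).
    rewrite -brh_hook -!brhM; congr brh; rewrite !mulrA x0f.
    by rewrite -(mulrA x0 _ (off Q)) deriv2_off.
  under eq_bigr => b _ do rewrite E.
  by rewrite -mulr_suml -mulr_sumr jac_predMr // jac_predMl // jac_deriv_hook.
have [sk|sk] := eqVneq (src i w) k; last first.
  have x0f : x0 * off Q = x0 by apply: mono_off.
  have [[c ->]|[b ->]] := kept_or_in hx; last first.
    rewrite -x0E -(mulrA x0) -(cyc_deriv_ideml pS) (mulrA (idem K _)) idem_idem.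
    by rewrite tl_out (negPf sk) scale0r mul0r mulr0 mul0r (lin0 brh_linear) rpred0.
  have -> : x0 * cyc_deriv [:: val c] S * y0 =
      x0 * off Q * (cyc_deriv [:: val c] S * off Q * y0).
    rewrite x0f mulrA; congr (_ * _ * _).
    by rewrite (offR (hd_kept c)) // cyc_deriv_idemr.
  by rewrite !brhM brh_deriv jac_predMl // jac_predMr // jac_gen.
(* Now [x0] ends with an arrow b' out of k, which forms hooks with the first arrows of the
   derivative when [x] leaves k. *)
case/lastP: w pw @x0 x0E sk => [|w x'] pw x0 x0E sk.
  by move: ik; rewrite -[src _ _]/i in sk; rewrite sk eqxx.
move: pw sk; rewrite pathb_rcons src_rcons => /andP[pw /eqP hx'] /eqP tx'.
pose b' : out_arrow := Sub x' tx'.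
have -> : x0 = mono K i w * off Q * arr K (val b').
  rewrite mono_off; last by rewrite -hx'; apply: (hd_out b').
  by rewrite /x0 mono_rcons.
have [[c ec]|[b ->]] := kept_or_in hx.
  rewrite ec -(mulrA _ (arr K _)) -(arr_idemK _ (val b')) tl_out -(cyc_deriv_ideml pS).
  rewrite -(mulrA (arr K _)) (mulrA (idem K k)) idem_idem eq_sym (negPf (tl_kept c)).
  by rewrite scale0r mul0r !mulr0 mul0r (lin0 brh_linear) rpred0.
rewrite cyc_deriv_left_out mulr_sumr mulr_suml (lin_sum brh_linear).
have E a : brh (mono K i w * off Q * arr K (val b') *
      (arr K (val a) * cyc_deriv [:: val b; val a] S) * y0) =
    brh (mono K i w) * (arr K (bA b' a) * brh (cyc_deriv [:: val b; val a] S)) * brh y0.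
  rewrite -brh_hook -!brhM; congr brh; rewrite !mulrA.
  by rewrite -(mulrA _ (arr K (val a)) (off Q)) in_off -(mulrA _ _ (off Q)) deriv2_off.
under eq_bigr => a _ do rewrite E.
by rewrite -mulr_suml -mulr_sumr jac_predMr // jac_predMl // jac_hook_deriv.
Qed.

(* The substitution a* b* |-> - d_{ba} S, [ba] |-> b a, inverse to brackets modulo
   the Jacobian ideals; it is only meaningful away from the vertex k. *)
Fixpoint unmut_word (i : V) (w : seq (arrow Qt)) {struct w} : A :=
  match w with
  | [::] => idem K i
  | inl (inl c) :: w' => arr K (val c) * unmut_word (tl (val c)) w'
  | inl (inr h) :: w' =>
      arr K (val h.1) * arr K (val h.2) * unmut_word (tl (val h.2)) w'
  | inr (inl a) :: inr (inr b) :: w' =>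
      - cyc_deriv [:: val b; val a] S * unmut_word (hd (val b)) w'
  | _ => 0
  end.

(** Follows the recursion of [unmut_word], which consumes two letters at a* b*; the last three cases
    are those where it returns 0. *)
Lemma unmut_word_ind (P : V -> seq (arrow Qt) -> Prop) :
  (forall i, P i [::]) ->
  (forall i c w, P (tl (val c)) w -> P i (kA c :: w)) ->
  (forall i b a w, P (tl (val a)) w -> P i (bA b a :: w)) ->
  (forall i a b w, P (hd (val b)) w -> P i (iA a :: oA b :: w)) ->
  (forall i a, P i [:: iA a]) ->
  (forall i a x w, (forall b, x <> oA b) -> P i (iA a :: x :: w)) ->
  (forall i b w, P i (oA b :: w)) ->
  forall i w, P i w.
Proof.
move=> h1 h2 h3 h4 h5 h6 h7 i w; have [n] := ubnP (size w).
elim: n i w => // n IH i [|[[c|[b a]]|[a|b]] w] //= lw.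
- by apply: (h2 i c w); apply: IH.
- by apply: (h3 i b a w); apply: IH.
- case: w lw => [|[[c|[b a']]|[a'|b]] w] lw; first exact: (h5 i a).
  + by apply: (h6 i a (kA c)).
  + by apply: (h6 i a (bA b a')).
  + by apply: (h6 i a (iA a')).
  by apply: (h4 i a b); apply: IH; apply: ltnW.
- exact: (h7 i b w).
Qed.

Lemma unmut_word_in_star i a x w : (forall b, x <> oA b) ->
  unmut_word i (iA a :: x :: w) = 0.
Proof. by case: x => [[c|[b a']]|[a'|b]] // nb; have /(_ erefl) := nb b. Qed.

(** Each step consumes at most two letters and produces a factor in the arrow ideal; for a* b* this
    is the absence of 2-cycles at k. *)
Lemma unmut_word_mpow i w : mpow (uphalf (size w)) (unmut_word i w).
Proof.
move: i w; apply: unmut_word_ind => //.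
- move=> i c w IH; apply: (mpow_le (n := 1 + uphalf (size w))).
    by rewrite add1n ltnS uphalf_half leq_addl.
  by apply: mpowM => //; apply: mpow_arr.
- move=> i b a w IH; apply: (mpow_le (n := 1 + uphalf (size w))).
    by rewrite add1n ltnS uphalf_half leq_addl.
  by apply: mpowM => //; apply: mpowMr; apply: mpow_arr.
- move=> i a b w IH; rewrite /= -add1n; apply: mpowM => //; apply: mpowN.
  by apply: cyc_deriv2_mpow => //; rewrite tl_out.
- by move=> i a x w nb; rewrite unmut_word_in_star.
Qed.

Definition unmut : At -> A := lin_ext (fun x : qpath Qt => unmut_word (ptgt x) (pword x)).

Let growth n (x : qpath Qt) : (n.*2 <= plen x)%N -> mpow n (unmut_word (ptgt x) (pword x)).
Proof.
move=> le; apply: (mpow_le _ (@unmut_word_mpow _ _)).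
by rewrite -(doubleK n) -/(plen x) uphalf_half; apply: leq_trans (half_leq le) (leq_addl _ _).
Qed.

Lemma unmut_linear : linear unmut. Proof. exact: lin_ext_linear. Qed.
Lemma unmut_cont : madic_continuous unmut. Proof. exact: lin_ext_cont. Qed.

Lemma unmut_mono i w : pathb i w -> unmut (mono K i w) = unmut_word i w.
Proof. by move=> p; apply: (lin_ext_qmono growth (exist _ (i, w) p)). Qed.

Lemma unmut_word_ideml i w : pathb i w -> idem K i * unmut_word i w = unmut_word i w.
Proof.
move: i w; apply: unmut_word_ind => //.
- by move=> i; rewrite idemK.
- by move=> i c w _ /andP[/eqP <- _]; rewrite /= mulrA idem_arrK.
- by move=> i b a w _ /andP[/eqP <- _]; rewrite /= !mulrA idem_arrK.
- move=> i a b w _ /andP[/eqP <- _]; rewrite /= !mulrA mulrN.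
  by rewrite cyc_deriv2_ideml.
- by move=> *; rewrite /= mulr0.
- by move=> i a x w nb _; rewrite [unmut_word _ _]unmut_word_in_star // mulr0.
- by move=> *; rewrite /= mulr0.
Qed.

(** A cut at a vertex other than k never separates a* from b*. *)
Lemma unmut_word_cat i w1 w2 : i != k -> pathb i (w1 ++ w2) -> src i w1 != k ->
  unmut_word i (w1 ++ w2) = unmut_word i w1 * unmut_word (src i w1) w2.
Proof.
move: i w1; apply: unmut_word_ind.
- by move=> i _ p _; rewrite /= unmut_word_ideml.
- by move=> i c w IH _ /andP[_ p] s; rewrite /= IH ?tl_kept // mulrA.
- by move=> i b a w IH _ /andP[_ p] s; rewrite /= IH ?tl_in // mulrA.
- by move=> i a b w IH _ /andP[_ /andP[_ p]] s; rewrite /= IH ?hd_out // mulrA.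
- by move=> i a _ _; rewrite -[src _ _]/(hd (val a)) hd_in eqxx.
- by move=> i a x w nb _ _ _; rewrite ![unmut_word _ [:: _, _ & _]]unmut_word_in_star // mul0r.
- by move=> *; rewrite /= mul0r.
Qed.

Definition unm (u : At) : A := unmut (off Qt * u * off Qt).

Lemma unm_linear : linear unm.
Proof.
exact: comp_linear (comp_linear (mull_linear (off Qt)) (mulr_linear (off Qt))) unmut_linear.
Qed.

Lemma unm_cont : madic_continuous unm.
Proof. by apply: cont_comp unmut_cont; apply: cont_comp (cont_mulr _); apply: cont_mull. Qed.

Lemma unm_kl u : unm (idem K k * u) = 0.
Proof. by rewrite /unm !mulrA off_idemk !mul0r (lin0 unmut_linear). Qed.

Lemma unm_kr u : unm (u * idem K k) = 0.
Proof. by rewrite /unm -!mulrA idemk_off !mulr0 (lin0 unmut_linear). Qed.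

Lemma unm_mono i w : pathb i w -> i != k -> src i w != k ->
  unm (mono K i w) = unmut_word i w.
Proof. by move=> p ik sk; rewrite /unm off_mono // mono_off // unmut_mono. Qed.

Lemma unmM_mono (i j : V) (w1 w2 : seq (arrow Qt)) : pathb i w1 -> pathb j w2 ->
  unm (mono K i w1 * off Qt * mono K j w2) = unm (mono K i w1) * unm (mono K j w2).
Proof.
move=> p1 p2.
have [ik|ik] := eqVneq i k.
  have -> : mono K i w1 = idem K k * mono K i w1 by rewrite idem_mono ik eqxx scale1r.
  by rewrite -!mulrA !unm_kl mul0r.
have [jk|jk] := eqVneq j k.
  have -> : mono K j w2 = idem K k * mono K j w2 by rewrite idem_mono jk eqxx scale1r.
  by rewrite unm_kl mulr0 mulrA -(mulrA (mono K i w1)) off_idemk mulr0 mul0r (lin0 unm_linear).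
have [s1|s1] := eqVneq (src i w1) k.
  have -> : mono K i w1 = mono K i w1 * idem K k by rewrite mono_idem s1 eqxx scale1r.
  by rewrite unm_kr mul0r -(mulrA _ (idem K k)) idemk_off mulr0 mul0r (lin0 unm_linear).
have [s2|s2] := eqVneq (src j w2) k.
  have -> : mono K j w2 = mono K j w2 * idem K k by rewrite mono_idem s2 eqxx scale1r.
  by rewrite mulrA !unm_kr mulr0.
rewrite mono_off // !unm_mono //.
have e1 : unmut_word i w1 = unmut_word i w1 * idem K (src i w1).
  by rewrite -{1}[w1]cats0 unmut_word_cat // cats0.
have [e|ne] := eqVneq (src i w1) j.
  rewrite -e in jk s2 p2 *; rewrite mono_cat // unm_mono ?src_cat ?pathb_cat ?p1 //.
  by rewrite unmut_word_cat ?pathb_cat ?p1.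
have -> : mono K i w1 * mono K j w2 = 0.
  have -> : mono K j w2 = idem K j * mono K j w2 by rewrite idem_mono eqxx scale1r.
  by rewrite mulrA mono_idem (negPf ne) scale0r mul0r.
rewrite (lin0 unm_linear) e1 -(unmut_word_ideml p2) -mulrA (mulrA (idem K _)).
by rewrite idem_idem (negPf ne) scale0r mul0r mulr0.
Qed.

Lemma unmM u v : unm (u * off Qt * v) = unm u * unm v.
Proof.
pose F u := unm (u * off Qt * v); pose G u := unm u * unm v.
rewrite -/(F u) -/(G u); apply: density_eq => [||||[[i w1] p1] _].
- exact: comp_linear (comp_linear (mulr_linear (off Qt)) (mulr_linear v)) unm_linear.
- exact: comp_linear unm_linear (mulr_linear (unm v)).
- exact: cont_comp (cont_comp (cont_mulr (off Qt)) (cont_mulr v)) unm_cont.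
- exact: cont_comp unm_cont (cont_mulr (unm v)).
rewrite /F /G {F G u} /qmono /ptgt /pword /=; set u := Defs.mono _ _ _.
pose F v := unm (u * off Qt * v); pose G v := unm u * unm v.
rewrite -/(F v) -/(G v); apply: density_eq => [||||[[j w2] p2] _].
- exact: comp_linear (mull_linear (u * off Qt)) unm_linear.
- exact: comp_linear unm_linear (mull_linear (unm u)).
- exact: cont_comp (cont_mull (u * off Qt)) unm_cont.
- exact: cont_comp unm_cont (cont_mull (unm u)).
exact: unmM_mono.
Qed.

Lemma unm_idem i : i != k -> unm (idem K i) = idem K i.
Proof. by move=> ik; rewrite unm_mono. Qed.

Lemma unm_kA c : unm (arr K (kA c)) = arr K (val c).
Proof.
rewrite unm_mono /= ?eqxx ?hd_kept ?tl_kept //.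
exact: arr_idemK.
Qed.

Lemma unm_bA b a : unm (arr K (bA b a)) = arr K (val b) * arr K (val a).
Proof.
rewrite unm_mono /= ?eqxx ?hd_out ?tl_in //.
by rewrite -mulrA arr_idemK.
Qed.

Lemma unm_stars a b :
  unm (arr K (iA a) * arr K (oA b)) = - cyc_deriv [:: val b; val a] S.
Proof.
have p : pathb (hd (iA a)) [:: iA a; oA b] by rewrite /= eqxx tl_out hd_in eqxx.
have -> : arr K (iA a) * arr K (oA b) = mono K (hd (iA a)) [:: iA a; oA b].
  by rewrite mono_arrM tl_iA -[X in mono K X _](hd_oA b).
rewrite unm_mono ?tl_in ?hd_out //=.
by rewrite mulNr cyc_deriv2_idemr.
Qed.

(** On the corner this is an exact identity, not only one modulo the Jacobian ideal, because
    brackets introduce no starred arrow. *)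
Lemma unm_brh u : unm (brh u) = off Q * u * off Q.
Proof.
pose F u := unm (brh u); pose G u := off Q * u * off Q.
rewrite -/(F u) -/(G u); apply: density_eq => [||||[[i w] p] _].
- exact: comp_linear brh_linear unm_linear.
- exact: comp_linear (mull_linear (off Q)) (mulr_linear (off Q)).
- exact: cont_comp brh_cont unm_cont.
- exact: cont_comp (cont_mull (off Q)) (cont_mulr (off Q)).
rewrite /F /G {F G u} /qmono /ptgt /pword /= in p *.
have [ik|ik] := eqVneq i k.
  have -> : mono K i w = idem K k * mono K i w by rewrite idem_mono ik eqxx scale1r.
  by rewrite brh_kl (lin0 unm_linear) !mulrA off_idemk !mul0r.
have [sk|sk] := eqVneq (src i w) k.
  have -> : mono K i w = mono K i w * idem K k by rewrite mono_idem sk eqxx scale1r.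
  by rewrite brh_kr (lin0 unm_linear) -!mulrA idemk_off !mulr0.
rewrite off_mono // mono_off //; have [n] := ubnP (size w).
elim: n i w p ik sk => // n IH i [|x w] p ik sk lw.
  by rewrite brh_idem // unm_idem.
have /andP[/eqP hx pw] : (hd x == i) && pathb (tl x) w := p.
rewrite -hx mono_arrM; rewrite -hx in ik.
have {}sk : src (tl x) w != k := sk.
(* The target being different from k, the leftmost letter is a kept arrow or the first letter of a
   hook, completed below by the next letter. *)
have [[c e]|[b e]] := kept_or_in ik; rewrite {}e in pw sk *.
  rewrite -kept_off brhM brh_kept -off_brh mulrA unmM unm_kA IH ?tl_kept ?kept_off //.
case: w pw sk lw {p} => [|y w] pw sk lw; first by rewrite -[src _ _]/(tl (val b)) tl_out eqxx in sk.
have /andP[/eqP hy {}pw] : (hd y == tl (val b)) && pathb (tl y) w := pw.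
have yk : hd y == k by rewrite hy tl_out.
pose a : in_arrow := Sub y yk; rewrite -[y]/(val a) in pw sk *.
have {}sk : src (tl (val a)) w != k := sk.
have -> : mono K (tl (val b)) (val a :: w) = arr K (val a) * mono K (tl (val a)) w.
  by rewrite tl_out -mono_arrM hd_in.
set m := mono K (tl (val a)) w.
have E : arr K (val b) * (arr K (val a) * m) = arr K (val b) * arr K (val a) * off Q * m.
  by rewrite -(mulrA _ _ (off Q)) in_off mulrA.
rewrite E brhM brh_hook -off_brh mulrA unmM unm_bA IH ?tl_in //; last exact: ltnW.
by rewrite -(mulrA _ _ (off Q)) in_off.
Qed.

Lemma star_word (x : arrow Qt) : hd x = k -> exists b, x = oA b.
Proof.
case: x => [[c|[b a]]|[a|b]] /= e; last by exists b.
- by have := hd_kept c; rewrite e eqxx.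
- by have := hd_out b; rewrite e eqxx.
- by have := tl_in a; rewrite e eqxx.
Qed.

Lemma star_word_tl (x : arrow Qt) : tl x = k -> exists a, x = iA a.
Proof.
case: x => [[c|[b a]]|[a|b]] /= e; last first.
- by have := hd_out b; rewrite e eqxx.
- by exists a.
- by have := tl_in a; rewrite e eqxx.
- by have := tl_kept c; rewrite e eqxx.
Qed.

Lemma off_kA c : arr K (kA c) * off Qt = arr K (kA c).
Proof. exact: offR (tl_kept c) (arr_idemK K (kA c)). Qed.
Lemma off_bA b a : arr K (bA b a) * off Qt = arr K (bA b a).
Proof. exact: offR (tl_in a) (arr_idemK K (bA b a)). Qed.
Lemma off_oA b : arr K (oA b) * off Qt = arr K (oA b).
Proof. exact: offR (hd_out b) (arr_idemK K (oA b)). Qed.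

Lemma stars_off a b : arr K (iA a) * arr K (oA b) * off Qt = arr K (iA a) * arr K (oA b).
Proof. by rewrite -[LHS]mulrA; congr (_ * _); apply: off_oA. Qed.

(* Brackets and their inverse are mutually inverse modulo the Jacobian ideal,
   because a* b* + [d_{ba} S] is the cyclic derivative of [ba]. *)
Lemma brh_unm v : off Qt * v * off Qt - brh (unm v) \in jac_pred St.
Proof.
pose F v := off Qt * v * off Qt - brh (unm v).
have lF : linear F.
  have l1 := comp_linear (mull_linear (off Qt)) (mulr_linear (off Qt)).
  have l2 := comp_linear unm_linear brh_linear.
  by move=> c x y; rewrite /F l1 l2 scalerBr opprD addrACA.
have cF : madic_continuous F.
  have c1 := cont_comp unm_cont brh_cont.
  move=> n; have [m hm] := c1 n; exists (maxn m n) => x hx; apply: mpowB.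
    by apply/mpowMr/mpowMl; apply: mpow_le hx; apply: leq_maxr.
  by apply: hm; apply: mpow_le hx; apply: leq_maxl.
rewrite -/(F v); apply: (density_jac lF cF) => -[[i w] p] _.
rewrite /F {F lF cF} /qmono /ptgt /pword /= in p *.
have [ik|ik] := eqVneq i k.
  have -> : mono K i w = idem K k * mono K i w by rewrite idem_mono ik eqxx scale1r.
  by rewrite unm_kl (lin0 brh_linear) !mulrA off_idemk !mul0r subrr rpred0.
have [sk|sk] := eqVneq (src i w) k.
  have -> : mono K i w = mono K i w * idem K k by rewrite mono_idem sk eqxx scale1r.
  by rewrite unm_kr (lin0 brh_linear) -!mulrA idemk_off !mulr0 subrr rpred0.
rewrite off_mono // mono_off //; have [n] := ubnP (size w).
elim: n i w p ik sk => // n IH i [|x w] p ik sk lw.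
  by rewrite unm_idem // brh_idem // subrr rpred0.
have /andP[/eqP hx pw] : (hd x == i) && pathb (tl x) w := p.
rewrite -hx mono_arrM; rewrite -hx in ik.
have {}sk : src (tl x) w != k := sk.
case: x ik {hx p} pw sk lw => [[c|[b a]]|[a|b]] ik pw sk lw.
- rewrite -[inl (inl c)]/(kA c) -off_kA unmM unm_kA -kept_off brhM brh_kept off_kA.
  by rewrite -mulrBr jac_predMl // IH // tl_kept.
- rewrite -[inl (inr (b, a))]/(bA b a) -off_bA unmM unm_bA -in_off mulrA brhM brh_hook off_bA.
  by rewrite -mulrBr jac_predMl // IH // tl_in.
- case: w pw sk lw => [|y w] pw sk lw; first by rewrite -[src _ _]/(hd (val a)) hd_in eqxx in sk.
  have /andP[/eqP hy {}pw] : (hd y == hd (val a)) && pathb (tl y) w := pw.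
  have [b eb] : exists b, y = oA b by apply: star_word; rewrite hy hd_in.
  subst y; rewrite -[inr (inl a)]/(iA a); set m := mono K (tl (oA b)) w.
  have -> : mono K (tl (iA a)) (oA b :: w) = arr K (oA b) * m.
    by rewrite tl_iA -mono_arrM hd_oA.
  rewrite mulrA -stars_off unmM unm_stars -[X in - X * unm m]deriv2_off -mulNr brhM.
  (* With [m] the remaining path, the difference becomes the derivative at [ba] times [brh (unm m)],
     plus a* b* times the difference for [m]. *)
  rewrite (linN brh_linear) brh_deriv2 stars_off mulNr opprK mulrBl addrCA -mulrBr.
  apply: rpredD; first by rewrite jac_predMr ?jac_gen.
  by apply/jac_predMl/IH; rewrite ?hd_out //; apply: ltnW.
- by rewrite -[hd _]/(tl (val b)) tl_out eqxx in ik.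
Qed.

(** The two summands of this derivative are sent to d_{ba} S and to its opposite. *)
Lemma unm_deriv_bracket b a : unm (cyc_deriv [:: bA b a] St) = 0.
Proof.
rewrite -(subrK (arr K (iA a) * arr K (oA b)) (cyc_deriv _ _)) -brh_deriv2.
by rewrite (linD unm_linear) unm_stars unm_brh off_deriv2 deriv2_off subrr.
Qed.

Lemma unm_deriv_kept c : unm (cyc_deriv [:: kA c] St) = cyc_deriv [:: val c] S.
Proof.
rewrite -brh_deriv unm_brh (offL (tl_kept c)) ?cyc_deriv_ideml //.
by rewrite (offR (hd_kept c)) // cyc_deriv_idemr.
Qed.

(** The sum of the a'* b* [ba] over b is sent to minus the sum of the d_{ba'} S b a, which is -
    d_{a'} S a. *)
Lemma unm_star_deriv_in a a' :
  unm (arr K (iA a') * cyc_deriv [:: iA a] St) \in jac_pred S.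
Proof.
rewrite cyc_deriv_in_star mulr_sumr (lin_sum unm_linear).
have -> : \sum_b unm (arr K (iA a') * (arr K (oA b) * arr K (bA b a))) =
    - (cyc_deriv [:: val a'] S * arr K (val a)).
  rewrite cyc_deriv_right_in mulr_suml -sumrN; apply: eq_bigr => b _.
  by rewrite mulrA -stars_off unmM unm_stars unm_bA mulNr mulrA.
by rewrite rpredN jac_predMr ?jac_gen.
Qed.

(** The sum of the [ba] a* b'* over a is sent to - b d_{b'} S. *)
Lemma unm_deriv_out_star b b' :
  unm (cyc_deriv [:: oA b] St * arr K (oA b')) \in jac_pred S.
Proof.
rewrite cyc_deriv_out_star mulr_suml (lin_sum unm_linear).
have -> : \sum_a unm (arr K (bA b a) * arr K (iA a) * arr K (oA b')) =
    - (arr K (val b) * cyc_deriv [:: val b'] S).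
  rewrite cyc_deriv_left_out mulr_sumr -sumrN; apply: eq_bigr => a _.
  by rewrite -mulrA -off_bA unmM unm_stars unm_bA mulrN mulrA.
by rewrite rpredN jac_predMl ?jac_gen.
Qed.

(** Only the derivatives at starred arrows have an end at k, and in the corner they occur next to
    another starred arrow. *)
Lemma unm_jac v : v \in jac_pred St -> unm v \in jac_pred S.
Proof.
have pSt := premut_potential; have lft := premut_loop_free.
move: v; apply: (jac_ind unm_linear unm_cont) => x [[i w] pw] [[j z] pz].
rewrite /qmono /ptgt /pword /=; set x0 := Defs.mono _ _ _; set y0 := Defs.mono _ _ _.
have y0E : idem K j * y0 = y0 by rewrite /y0 idem_mono eqxx scale1r.
have x0E : x0 * idem K (src i w) = x0 by rewrite /x0 mono_idem eqxx scale1r.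
set D := cyc_deriv _ _.
have DL : idem K (tl x) * D = D by apply: cyc_deriv_ideml.
have DR : D * idem K (hd x) = D by apply: cyc_deriv_idemr.
have [ik|ik] := eqVneq i k.
  have -> : x0 = idem K k * x0 by rewrite /x0 idem_mono ik eqxx scale1r.
  by rewrite -!mulrA unm_kl rpred0.
have [zk|zk] := eqVneq (src j z) k.
  have -> : y0 = y0 * idem K k by rewrite /y0 mono_idem zk eqxx scale1r.
  by rewrite mulrA unm_kr rpred0.
have [s|ne] := eqVneq (src i w) (tl x); last first.
  rewrite -x0E -DL -(mulrA x0) (mulrA (idem K _) (idem K _)) idem_idem (negPf ne).
  by rewrite scale0r mul0r mulr0 mul0r (lin0 unm_linear) rpred0.
have [h|ne] := eqVneq (hd x) j; last first.
  rewrite -y0E -DR mulrA -(mulrA x0) -(mulrA D) idem_idem (negPf ne).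
  by rewrite scale0r !mulr0 mul0r (lin0 unm_linear) rpred0.
have [tk|tk] := eqVneq (tl x) k.
  have [a xa] := star_word_tl tk; subst x.
  case/lastP: w pw @x0 x0E s => [|w x'] pw x0 x0E s.
    by move: s ik; rewrite -[src _ _]/i => ->; rewrite tk eqxx.
  move: pw s; rewrite pathb_rcons src_rcons => /andP[pw /eqP hx'] tx'.
  rewrite tk in tx'; have [a' ea] := star_word_tl tx'; subst x'.
  have -> : x0 * D * y0 = mono K i w * off Qt * (arr K (iA a') * D * off Qt * y0).
    rewrite mono_off; last by rewrite -hx' tl_in.
    rewrite -(mulrA (arr K (iA a')) D) (offR (_ : tl (val a) != k) DR) ?tl_in //.
    by rewrite /x0 mono_rcons // !mulrA.
  by rewrite !unmM jac_predMl // jac_predMr // unm_star_deriv_in.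
have [hk|hk] := eqVneq (hd x) k; last first.
  have -> : x0 * D * y0 = x0 * off Qt * (D * off Qt * y0).
    rewrite (offR hk DR) mono_off; last by rewrite s.
    by rewrite mulrA.
  rewrite !unmM jac_predMl // jac_predMr //.
  case: (x) tk hk @D DL DR {h s} => [[c|[b a]]|[a|b]] tk hk /=.
  - by rewrite [unm _](unm_deriv_kept c) jac_gen.
  - by rewrite [unm _](unm_deriv_bracket b a) rpred0.
  - by move: tk; rewrite -[tl _]/(hd (val a)) hd_in eqxx.
  - by move: hk; rewrite -[hd _]/(tl (val b)) tl_out eqxx.
have [b xb] := star_word hk; subst x.
case: z pz @y0 y0E zk => [|x' z] pz y0 y0E zk.
  by move: zk; rewrite -[src _ _]/j -h hk eqxx.
have /andP[/eqP hx' pz'] : (hd x' == j) && pathb (tl x') z := pz.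
have [b' eb] : exists b, x' = oA b by apply: star_word; rewrite hx' -h.
subst x'; set m := mono K (tl (oA b')) z.
have yE : y0 = arr K (oA b') * m by rewrite /y0 -hx' mono_arrM.
have -> : x0 * D * y0 = x0 * off Qt * (D * arr K (oA b') * off Qt * m).
  rewrite mono_off; last by rewrite s hd_out.
  by rewrite -(mulrA D) [X in D * X]off_oA yE !mulrA.
by rewrite !unmM jac_predMl // jac_predMr // unm_deriv_out_star.
Qed.

Lemma left_quot_idem (Q0 : quiver V) (a : arrow Q0) i u :
  left_quot a (idem K i * u) = (hd a == i)%:R *: left_quot a u.
Proof.
apply: cpaP => j w; rewrite coefZ !coef_left_quot coef_idemM.
by case: (j =P _) => // _; rewrite mulr0.
Qed.

Lemma left_quot_sum (Q0 : quiver V) (I : finType) (f : I -> arrow Q0) (u : I -> cpa K Q0) i :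
  injective f -> left_quot (f i) (\sum_j arr K (f j) * u j) = idem K (tl (f i)) * u i.
Proof.
move=> inj; rewrite (lin_sum (@left_quot_linear K V Q0 (f i))) (bigD1 i) //= left_quot_arrM eqxx.
rewrite big1 ?addr0 // => j ne; rewrite left_quot_arrM.
by rewrite (inj_eq inj) (negPf ne).
Qed.

Lemma unm_idemr u l : l != k -> unm (u * idem K l) = unm u * idem K l.
Proof.
by move=> lk; rewrite -(unm_idem lk) -unmM -mulrA off_idem lk scale1r.
Qed.

Lemma unm_idemMl i u : i != k -> unm (idem K i * u) = idem K i * unm u.
Proof. by move=> ik; rewrite -(unm_idem ik) -unmM idem_off ik scale1r. Qed.

Lemma brh_idemMr i u : i != k -> brh (u * idem K i) = brh u * idem K i.
Proof.
by move=> ik; rewrite -(brh_idem ik) -brhM -(mulrA u) off_idem ik scale1r.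
Qed.

Lemma brh_offl u : brh (off Q * u) = brh u.
Proof. by rewrite /brh mulrA offK. Qed.

Lemma unm_brh_corner i j u : i != k -> j != k ->
  unm (brh (idem K i * u * idem K j)) = idem K i * u * idem K j.
Proof.
by move=> ik jk; rewrite unm_brh -!mulrA idem_off jk scale1r !mulrA off_idem ik scale1r.
Qed.

Lemma sum_oA (E : arrow Qt -> At) : (forall x, hd x != k -> E x = 0) ->
  \sum_x E x = \sum_b E (oA b).
Proof.
move=> h; rewrite (bigID (fun x : arrow Qt => hd x == k)) /=.
rewrite [X in _ + X]big1 ?addr0; last by move=> x /h.
rewrite (reindex_omap oA (fun x => if x is inr (inr b) then Some b else None)).
  by apply: eq_bigl => b; rewrite -[premut_hd _]/(tl (val b)) tl_out !eqxx.
by move=> x /eqP /star_word[b ->].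
Qed.

(** * Exactness when a power of the arrow ideal annihilates e_l *)

Section Nilpotent.
Variables (l : V) (N : nat).
Hypothesis nil : forall u, mpow N u -> u * idem K l \in jac_pred S.

(* Exactness of M_out -> M_in -> M_k. Since e_l is annihilated by a power of the
   arrow ideal, elements of the closure of the ideal behave like finite sums. *)
Lemma jac_left_quot u : u \in jac_pred S -> exists y : out_arrow -> A, forall a,
  left_quot (val a) (u * idem K l) -
  \sum_b cyc_deriv [:: val b; val a] S * y b \in jac_pred S.
Proof.
move: u; apply: jac_span_ind => [c u v [y hy] [z hz]||x [[i w] pw] y0].
- exists (fun b => c *: y b + z b) => a.
  rewrite mulrDl -cpa_scaleAl left_quot_linear.
  have -> : \sum_b cyc_deriv [:: val b; val a] S * (c *: y b + z b) =
      c *: (\sum_b cyc_deriv [:: val b; val a] S * y b) +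
      \sum_b cyc_deriv [:: val b; val a] S * z b.
    rewrite scaler_sumr -big_split; apply: eq_bigr => b _.
    by rewrite mulrDr -cpa_scaleAr.
  by rewrite opprD addrACA -scalerBr rpredD ?rpredZ.
- exists N.+1 => u hu; exists (fun _ => 0) => a.
  rewrite big1 ?subr0 => [|b _]; last by rewrite mulr0.
  rewrite left_quotM; last exact: mpow_le hu.
  exact/nil/mpow_left_quot.
move: (qmono K y0) => {}y0; rewrite /qmono /ptgt /pword /= in pw *.
(* Division by [a] takes place in a nontrivial left path and leaves the derivative intact, so the
   quotient already lies in the ideal. *)
case: w pw => [_|x' w] /=; last first.
  move=> _; exists (fun _ => 0) => a.
  rewrite big1 ?subr0 => [|b _]; last by rewrite mulr0.
  rewrite -!(mulrA (mono K i _)) left_quotM; last exact: mpow_mono.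
  by rewrite jac_predMl // -!mulrA jac_predMr // jac_gen.
have [hx|hx] := boolP (tl x == k); last first.
  exists (fun _ => 0) => a.
  rewrite big1 ?subr0 => [|b _]; last by rewrite mulr0.
  rewrite -(cyc_deriv_ideml pS) -[mono K i [::]]/(idem K i) !mulrA idem_idem.
  have [->|_] := eqVneq i (tl x); last first.
    by rewrite scale0r !mul0r (lin0 (@left_quot_linear _ _ _ _)) rpred0.
  rewrite scale1r -!mulrA left_quot_idem hd_in eq_sym (negPf hx) scale0r.
  exact: rpred0.
have {hx}[b0 xb] : exists b0 : out_arrow, x = val b0 by exists (Sub x hx).
rewrite {x}xb -[mono K i [::]]/(idem K i).
(* Only the derivative at an arrow b0 out of k contributes: its quotient by a is d_{b0 a} S,
   followed by the right factor. *)
exists (fun b => if b == b0 then (k == i)%:R *: (y0 * idem K l) else 0) => a.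
rewrite (bigD1 b0) //= eqxx big1 ?addr0; last by move=> b /negPf->; rewrite mulr0.
rewrite -!mulrA left_quot_idem hd_in -cpa_scaleAr -scalerBr rpredZ //.
rewrite cyc_deriv_left_out mulr_suml.
under eq_bigr => a' _ do rewrite -mulrA.
rewrite (left_quot_sum _ _ val_inj) mulrA cyc_deriv2_ideml.
by rewrite subrr rpred0.
Qed.

(* The families (y_b) with sum b* [y_b] = 0 are in the image of beta. *)
Lemma jac_star_quot v : l != k -> v \in jac_pred St -> exists x : A, forall b,
  unm (left_quot (oA b) (v * idem K l)) - arr K (val b) * x \in jac_pred S.
Proof.
move=> lk; move: v; apply: jac_span_ind => [c u v [y hy] [z hz]||x [[i w] pw] y0].
- exists (c *: y + z) => b.
  rewrite mulrDl -cpa_scaleAl left_quot_linear unm_linear mulrDr -cpa_scaleAr.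
  by rewrite opprD addrACA -scalerBr rpredD ?rpredZ.
(* Series in [mpow m] are sent by [unm] into [mpow N]; one more degree is lost to the left
   division. *)
- have [m hm] := unm_cont N; exists m.+1 => u hu; exists 0 => b.
  rewrite mulr0 subr0 left_quotM; last exact: mpow_le hu.
  by rewrite unm_idemr //; apply/nil/hm/mpow_left_quot.
move: (qmono K y0) => {}y0; rewrite /qmono /ptgt /pword /= in pw *.
case: w pw => [_|x' w] /=; last first.
  move=> _; exists 0 => b; rewrite mulr0 subr0.
  rewrite -!(mulrA (mono K i _)) left_quotM; last exact: mpow_mono.
  by rewrite unm_jac // jac_predMl // -!mulrA jac_predMr // jac_gen.
rewrite -[mono K i [::]]/(idem K i).
have [hx|hx] := eqVneq (tl x) k; last first.
  exists 0 => b; rewrite mulr0 subr0.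
  rewrite -(cyc_deriv_ideml premut_potential) !mulrA idem_idem.
  have [->|_] := eqVneq i (tl x); last first.
    by rewrite scale0r !mul0r (lin0 (@left_quot_linear _ _ _ _)) (lin0 unm_linear) rpred0.
  rewrite scale1r -!mulrA left_quot_idem hd_oA eq_sym (negPf hx) scale0r.
  by rewrite (lin0 unm_linear) rpred0.
have [a xa] := star_word_tl hx; subst x.
(* The derivative at a* is the sum of the b* [ba]; its quotient by b* is [ba], sent to [b a], so x
   is [a] times the image of the right factor. *)
exists ((k == i)%:R *: (arr K (val a) * unm (y0 * idem K l))) => b.
rewrite -!mulrA left_quot_idem hd_oA (linZ unm_linear) -cpa_scaleAr -scalerBr rpredZ //.
rewrite cyc_deriv_in_star mulr_suml.
under eq_bigr => b' _ do rewrite -mulrA.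
have inj_oA : injective oA by move=> b1 b2 [].
rewrite (left_quot_sum _ _ inj_oA) mulrA (idem_arrK K (bA b a)).
by rewrite -[arr K (bA b a)]off_bA unmM unm_bA mulrA subrr rpred0.
Qed.

End Nilpotent.
End Premutation.

(** * Finite-dimensional spaces *)

Section FiniteDimension.
Import VectorInternalTheory.
Variable K : fieldType.

(** A subspace of largest dimension among those contained in [U] is all of [U], since a missing
    vector would enlarge it. *)
Lemma linear_closed_vspace (X : vectType K) (U : X -> Prop) :
  U 0 -> (forall c x y, U x -> U y -> U (c *: x + y)) ->
  exists W : {vspace X}, forall x, x \in W <-> U x.
Proof.
move=> U0 lU.
pose D n := `[< exists2 W : {vspace X}, (forall x, x \in W -> U x) & \dim W = n >].
have D0 : exists n, D n.
  exists 0%N; apply/asboolP; exists 0%VS; last exact: dimv0.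
  by move=> x; rewrite memv0 => /eqP ->.
have Db n : D n -> (n <= \dim {:X})%N.
  by case/asboolP => W _ <-; rewrite dimvS ?subvf.
case: (ex_maxnP D0 Db) => _ /asboolP[W WU <-] Wmax.
exists W => x; split; first exact: WU.
move=> Ux; have : D (\dim (W + <[x]>)%VS).
  apply/asboolP; exists (W + <[x]>)%VS => // _ /memv_addP[y yW [_ /vlineP[c ->] ->]].
  by rewrite addrC; apply: lU => //; apply: WU.
move/Wmax => le.
have /eqP -> : W == (W + <[x]>)%VS by rewrite eqEdim addvSl le.
by rewrite memvE addvSr.
Qed.

(** From an index of minimal dimension on, the sequence is constant and equal to its
    intersection. *)
Lemma decreasing_stationary (X : vectType K) (U : nat -> X -> Prop) :
  (forall n, U n 0) -> (forall n c x y, U n x -> U n y -> U n (c *: x + y)) ->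
  (forall m n x, (m <= n)%N -> U n x -> U m x) ->
  (forall x, (forall n, U n x) -> x = 0) ->
  exists n, forall x, U n x -> x = 0.
Proof.
move=> U0 lU dU iU.
have [W hW] := choice (fun n => linear_closed_vspace (U0 n) (lU n)).
have [n nmin] : exists n, forall m, (\dim (W n) <= \dim (W m))%N.
  have ex : exists d, `[< exists n, \dim (W n) = d >].
    by exists (\dim (W 0%N)); apply/asboolP; exists 0%N.
  case: (ex_minnP ex) => _ /asboolP[n <-] h; exists n => m.
  by apply: h; apply/asboolP; exists m.
exists n => x /hW xW; apply: iU => m.
have [le|lt] := leqP m n; first by apply: dU le _; apply/hW.
apply/hW; suff /eqP -> : W m == W n by [].
rewrite eqEdim nmin andbT; apply/subvP => y /hW yU; apply/hW.
by apply: dU yU; apply: ltnW.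
Qed.

Lemma finite_dim_bij (X : vectType K) (W : lmodType K) (h : X -> W) :
  linear h -> bijective h -> finite_dim W.
Proof.
move=> lh [g hK gK]; exists (dim X), (fun w => v2r (g w)); split.
  move=> c x y; rewrite -{1}[x]gK -{1}[y]gK -lh hK.
  exact: linearP.
exists (fun r => h (r2v r)) => w; first by rewrite v2rK.
by rewrite hK r2vK.
Qed.

Lemma inj_surj_bij (T U : Type) (h : T -> U) :
  injective h -> (forall w, exists x, h x = w) -> bijective h.
Proof.
move=> inj /choice[g gK]; exists g => // x; apply: inj; exact: gK.
Qed.

Lemma linear_inj (U W : lmodType K) (h : U -> W) :
  linear h -> (forall x, h x = 0 -> x = 0) -> injective h.
Proof.
move=> lh h0 x y e; apply/eqP; rewrite -subr_eq0; apply/eqP/h0.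
by rewrite (linB lh) e subrr.
Qed.

(** The surjection becomes a bijection on a complement of its kernel. *)
Lemma finite_dim_surj (X : vectType K) (W : lmodType K) (h : X -> W) :
  linear h -> (forall w, exists x, h x = w) -> finite_dim W.
Proof.
move=> lh sh.
have [Kr hKr] : exists Kr : {vspace X}, forall x, x \in Kr <-> h x = 0.
  apply: linear_closed_vspace; first exact: lin0.
  by move=> c x y hx hy; rewrite lh hx hy scaler0 addr0.
pose g (x : subvs_of (Kr^C)%VS) := h (vsval x).
have lg : linear g.
  by move=> c x y; rewrite /g -lh; congr h; apply: linearP.
apply: (finite_dim_bij lg); apply: inj_surj_bij.
  apply: linear_inj => // x /hKr xK; apply: val_inj.
  have : vsval x \in (Kr :&: Kr^C)%VS by rewrite memv_cap xK subvsP.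
  by rewrite capv_compl memv0 => /eqP.
move=> w; have [x <-] := sh w.
have : x \in (Kr + Kr^C)%VS by rewrite addv_complf memvf.
case/memv_addP => y yK [z zC ->].
exists (vsproj (Kr^C)%VS z); rewrite /g vsprojK // (linD lh).
by have -> : h y = 0 by [apply/hKr]; rewrite add0r.
Qed.

End FiniteDimension.

(** * Premutation of a projective *)

Section ProjectiveModule.
Variables (K : fieldType) (V : finType) (Q : quiver V) (S : cpa K Q) (l : V).
Variable fin : finite_dim (projective S l).
Local Notation M := (projective_module fin).
Local Notation A := (cpa K Q).
Local Notation el := (jpi S (idem K l)).

Definition proj_val (m : M) : jac S := projective_val (m : projective S l).

Lemma proj_val_inj : injective proj_val.
Proof. by move=> x y e; apply: (val_inj (sT := projective S l)). Qed.

Lemma proj_val_linear : linear proj_val.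
Proof. by []. Qed.

Lemma proj_val_act x m : proj_val (act M x m) = x * proj_val m.
Proof. by rewrite /proj_val [act M x m]projective_rhoE. Qed.

Lemma proj_memP u : jpi S (u * idem K l) \in projective_pred (S := S) l.
Proof. by apply/projective_predP; exists (jpi S u); rewrite jpiM. Qed.

Definition proj_of (u : A) : M := (Projective (proj_memP u) : projective S l).

Lemma proj_ofK u : proj_val (proj_of u) = jpi S (u * idem K l).
Proof. by []. Qed.

Lemma proj_valE m : exists u, proj_val m = jpi S (u * idem K l).
Proof.
have /projective_predP[y e] := projective_valP (m : projective S l).
by case: (jpi_surj y) e => u -> e; exists u; rewrite jpiM; apply: e.
Qed.

Lemma proj_val_el m : proj_val m * el = proj_val m.
Proof. by have [u ->] := proj_valE m; rewrite -jpiM -mulrA idemK. Qed.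

(** The images in M of the powers of the arrow ideal have intersection 0 because the Jacobian ideal
    is closed. *)
Lemma proj_nilpotent : exists n, forall u : A, mpow n u -> u * idem K l \in jac_pred S.
Proof.
pose U n (m : M) := exists2 u : A, mpow n u & proj_val m = jpi S (u * idem K l).
have [||||n hn] := @decreasing_stationary K M U.
- by move=> n; exists 0; rewrite ?mul0r ?raddf0.
- move=> n c x y [u hu eu] [v hv ev]; exists (c *: u + v).
    by apply: mpowD => //; apply: mpowZ.
  by rewrite proj_val_linear eu ev mulrDl -cpa_scaleAl linearP.
- by move=> m n x le [u hu eu]; exists u => //; apply: mpow_le hu.
- move=> x hx; apply: proj_val_inj; rewrite (lin0 proj_val_linear).
  have [y ey] := proj_valE x; rewrite ey; apply/jpi_eq0; apply: jac_closed => n.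
  have [u hu eu] := hx n; exists (y * idem K l - u * idem K l).
    by apply/jpi_eq; rewrite -ey.
  by rewrite subKr; apply: mpowMr.
exists n => u hu; apply/jpi_eq0.
have : proj_of u = 0 by apply: hn; exists u.
by move/(congr1 proj_val); rewrite proj_ofK (lin0 proj_val_linear).
Qed.

Lemma mem_comp_idem j (m : M) :
  (m \in comp M j) <-> jpi S (idem K j) * proj_val m = proj_val m.
Proof.
split=> [/memv_imgP[x _ ->]|e]; first by rewrite !proj_val_act mulrA -jpiM idemK.
have -> : m = act M (jpi S (idem K j)) m by apply: proj_val_inj; rewrite proj_val_act.
by rewrite memv_img ?memvf.
Qed.

Lemma sum_idem : \sum_i idem K i = 1 :> A.
Proof.
apply: cpaP => i w; rewrite coef_sum coef1 (bigD1 i) //= big1 ?addr0 => [|j ne].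
  by rewrite coef_mono // xpair_eqE eqxx.
by rewrite coef_mono // xpair_eqE eq_sym (negPf ne).
Qed.

(** The idempotents sum to 1, so the components away from k span the kernel of e_k. *)
Lemma mem_rest k (m : M) :
  (m \in rest_space k M) <-> jpi S (idem K k) * proj_val m = 0.
Proof.
split=> [mR|e].
  have : (rest_space k M <= lker (act M (jpi S (idem K k))))%VS.
    apply/subv_sumP => j jk; apply/subvP => x /mem_comp_idem ex; rewrite memv_ker.
    apply/eqP/proj_val_inj; rewrite proj_val_act (lin0 proj_val_linear) -ex mulrA -jpiM.
    by rewrite idem_idem eq_sym (negPf jk) scale0r raddf0 mul0r.
  move/subvP => /(_ _ mR); rewrite memv_ker => /eqP /(congr1 proj_val).
  by rewrite proj_val_act (lin0 proj_val_linear).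
have -> : m = \sum_(j | j != k) act M (jpi S (idem K j)) m.
  apply: proj_val_inj; rewrite (lin_sum proj_val_linear).
  under eq_bigr => j _ do rewrite proj_val_act.
  rewrite -mulr_suml -[LHS]mul1r -[1]/(jpi S 1) -sum_idem raddf_sum (bigD1 k) //=.
  by rewrite mulrDl e add0r.
apply: memv_sumr => j jk; apply/mem_comp_idem.
by rewrite proj_val_act mulrA -jpiM idemK.
Qed.

End ProjectiveModule.

(** * The isomorphism between the premutation of a projective and a projective *)

Section MutationOfProjective.
Variables (K : fieldType) (V : finType) (Q : quiver V) (S S1 : cpa K Q) (k l : V).
Hypotheses (lf : loop_free Q) (pS1 : potential S1).
Hypotheses (no2 : no_2cycle_at Q k) (S1k : no_term_at k S1).
Hypotheses (S1S : cyclically_equivalent S S1) (neq_kl : k != l).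
Variable fin : finite_dim (projective S l).
Local Notation M := (projective_module fin).
Local Notation Qt := (premut_quiver Q k).
Local Notation St := (premut_pot k S1).
Local Notation A := (cpa K Q).
Local Notation At := (cpa K Qt).
Local Notation in_arrow := (in_arrow Q k).
Local Notation out_arrow := (out_arrow Q k).
Local Notation kept_arrow := (kept_arrow Q k).
Local Notation brh := (@brh K V Q k).
Local Notation offQ := (@off K V k Q).
Local Notation offt := (@off K V k Qt).
Local Notation acp u := (act M (jpi S u)).
Implicit Types (c : kept_arrow) (a : in_arrow) (b : out_arrow) (m : M).

Let neq_lk : l != k. Proof. by rewrite eq_sym. Qed.

Lemma jac_predE u : (u \in jac_pred S) = (u \in jac_pred S1).
Proof. exact: jac_pred_equivalent. Qed.

Lemma cyc_derivS p : cyc_deriv p S = cyc_deriv p S1.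
Proof. exact: cyc_deriv_equivalent. Qed.

Let brJ u : u \in jac_pred S -> brh u \in jac_pred St.
Proof. by rewrite jac_predE; apply: brh_jac. Qed.

(** The map from L e_l to L~ e_l induced by brackets; it kills the component at k. *)
Definition lift_val (m : M) : jac St := jac_lift St brh (proj_val m).
Local Notation g := lift_val.

Lemma lift_val_linear : linear g.
Proof.
move=> c x y; rewrite /g proj_val_linear.
exact: jac_lift_linear (@brh_linear K V Q k) brJ c (proj_val x) (proj_val y).
Qed.

Lemma lift_valE m u : proj_val m = jpi S u -> g m = jpi St (brh u).
Proof. by rewrite /g => ->; apply: jac_liftE (@brh_linear K V Q k) brJ u. Qed.

Lemma lift_val_act u m : g (acp (u * offQ) m) = jpi St (brh u) * g m.
Proof.
have [v ev] := proj_valE m; rewrite (lift_valE ev) -jpiM -brhM.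
by apply: lift_valE; rewrite proj_val_act ev -jpiM.
Qed.

Lemma lift_val_kept c m : g (acp (arr K (val c)) m) = jpi St (arr K (kA c)) * g m.
Proof. by rewrite -kept_off lift_val_act brh_kept. Qed.

Lemma lift_val_hook b a m :
  g (acp (arr K (val b)) (acp (arr K (val a)) m)) = jpi St (arr K (bA b a)) * g m.
Proof.
rewrite -brh_hook // -lift_val_act -mulrA in_off //; congr g.
by apply: proj_val_inj; rewrite !proj_val_act mulrA -jpiM.
Qed.

(** The derivative at [ba] turns the entries of [gamma] into - a* b*, which accounts for the sign in
    the action of b* on the premutation. *)
Lemma lift_val_deriv2 b a m : g (acp (cyc_deriv [:: val b; val a] S) m) =
  - (jpi St (arr K (iA a)) * (jpi St (arr K (oA b)) * g m)).
Proof.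
rewrite cyc_derivS -(deriv2_off lf pS1) lift_val_act mulrA -jpiM -mulNr.
congr (_ * _); rewrite -(linN (jpi_is_linear St)); apply/jpi_eq.
by rewrite brh_deriv2 // opprK subrK jac_gen.
Qed.

Lemma lift_val_idem j m : j != k -> g (acp (idem K j) m) = jpi St (idem K j) * g m.
Proof.
move=> jk; have -> : idem K j = idem K j * offQ by rewrite idem_off jk scale1r.
by rewrite lift_val_act brh_idem.
Qed.

Lemma lift_val_off m : jpi St offt * g m = g m.
Proof. by have [v ev] := proj_valE m; rewrite (lift_valE ev) -jpiM off_brh. Qed.

Lemma lift_val_el m : g m * jpi St (idem K l) = g m.
Proof.
have [v ev] := proj_valE m; rewrite (lift_valE ev) -jpiM -br_idemMr.
rewrite /brh -[_ * offQ * _]mulrA off_idem neq_lk scale1r.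
by rewrite -!mulrA idemK idem_off neq_lk scale1r.
Qed.

(** As l differs from k, an element of e_k A e_l has no constant term and is divisible by the arrows
    into k; this is the surjectivity of [alpha]. *)
Lemma comp_k_sum m : m \in comp M k -> exists2 z : in_arrow -> M,
  m = \sum_a acp (arr K (val a)) (z a) & forall a, z a \in comp M (tl (val a)).
Proof.
move=> /mem_comp_idem em; have [u eu] := proj_valE m.
set u' := idem K k * (u * idem K l).
have u1 : mpow 1 u' by apply: mpow_corner.
exists (fun a => proj_of fin (left_quot (val a) u')) => [|a].
  apply: proj_val_inj; rewrite (lin_sum (@proj_val_linear _ _ _ _ _ fin)).
  under eq_bigr => a _ do rewrite proj_val_act proj_ofK -jpiM.
  rewrite -raddf_sum -em eu -jpiM -/u'; congr (jpi S _).
  under eq_bigr => a _ do rewrite mulrA.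
  rewrite -mulr_suml {1}(_ : u' = u' * idem K l); last by rewrite /u' -!mulrA idemK.
  congr (_ * _); rewrite {1}(left_quotE u1) (sum_sub (P := fun x => hd x == k)) // => x hx.
  by rewrite /u' left_quot_idem (negPf hx) scale0r mulr0.
apply/mem_comp_idem; rewrite proj_ofK -jpiM mulrA.
by rewrite left_quot_tgt.
Qed.

(** Makes the map on coker beta well defined: M_k is the image of [alpha], and the sum over b of the
    b* [ba] is the derivative at a*. *)
Lemma lift_val_beta m : m \in comp M k ->
  \sum_b jpi St (arr K (oA b)) * g (acp (arr K (val b)) m) = 0.
Proof.
case/comp_k_sum => z -> _.
have E b : g (acp (arr K (val b)) (\sum_a acp (arr K (val a)) (z a))) =
    \sum_a jpi St (arr K (bA b a)) * g (z a).
  rewrite raddf_sum (lin_sum lift_val_linear); apply: eq_bigr => a _.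
  exact: lift_val_hook.
under eq_bigr => b _ do rewrite E mulr_sumr.
rewrite exchange_big big1 //= => a _.
under eq_bigr => b _ do rewrite mulrA -jpiM.
rewrite -mulr_suml -(lin_sum (jpi_is_linear St)) -(cyc_deriv_in_star pS1 S1k).
have -> : jpi St (cyc_deriv [:: iA a] St) = 0 by apply/jpi_eq0; apply: jac_gen.
by rewrite mul0r.
Qed.

Lemma mem_in_space (x : {ffun in_arrow -> M}) :
  (x \in in_space k M) <-> forall a, x a \in comp M (tl (val a)).
Proof. by split=> [/fam_spaceP//|h]; apply/fam_spaceP. Qed.

Lemma mem_out_space (y : {ffun out_arrow -> M}) :
  (y \in out_space k M) <-> forall b, y b \in comp M (hd (val b)).
Proof. by split=> [/fam_spaceP//|h]; apply/fam_spaceP. Qed.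

Lemma alpha_surj : limg (alpha k M) = fullv.
Proof.
apply/eqP; rewrite eqEsubv subvf; apply/subvP => m _.
have [z ez zc] := comp_k_sum (subvsP m).
have zin : [ffun a => z a] \in in_space k M by apply/mem_in_space => a; rewrite ffunE.
have -> : m = alpha k M (vsproj (in_space k M) [ffun a => z a]).
  apply: val_inj; rewrite [RHS]alphaE vsprojK // [LHS]ez.
  by apply: eq_bigr => a _; rewrite ffunE.
by rewrite memv_img ?memvf.
Qed.

(** An element of ker alpha lifts to an element of the Jacobian ideal, whose quotients by the arrows
    into k are combinations of second-order derivatives modulo the ideal. *)
Lemma homology_eq0 (z : homology k M) : z = 0.
Proof.
have lfU : linear (vsval : ker_alpha k M -> M_in k M) by move=> c x y; apply: linearP.
have [N nil] := proj_nilpotent fin.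
have nil1 u : mpow N u -> u * idem K l \in jac_pred S1 by move/nil; rewrite jac_predE.
rewrite -[z]lreprK -[RHS]/(0 : homology k M); move: (lrepr z) => {z}x.
suff h : x \in (linfun (vsval : ker_alpha k M -> M_in k M) @^-1: limg (gamma k M))%VS.
  by rewrite -(raddf0 (@homology_proj K V Q S k M)); apply/lprojP; rewrite subr0.
rewrite -memv_preim (linfun_linearE lfU); set y := vsval x.
have /eqP ay : alpha k M y == 0 by rewrite -memv_ker; apply: subvsP.
have yc a : vsval y a \in comp M (tl (val a)) by move: a; apply/mem_in_space/subvsP.
have [u hu] := choice (fun a => proj_valE (vsval y a)).
have uJ : \sum_a arr K (val a) * (u a * idem K l) \in jac_pred S1.
  rewrite -jac_predE; apply/jpi_eq0; rewrite (lin_sum (jpi_is_linear S)).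
  move/(congr1 vsval): ay; rewrite alphaE => /(congr1 (@proj_val _ _ _ _ _ fin)).
  rewrite (lin_sum (@proj_val_linear _ _ _ _ _ fin)).
  under eq_bigr => a _ do rewrite proj_val_act hu -jpiM.
  by [].
have [w hw] := jac_left_quot k lf pS1 nil1 uJ.
(* The idempotents move the [w b] into the components M_{h(b)}, without changing the products, since
   d_{ba} S starts at h(b). *)
pose Y : {ffun out_arrow -> M} := [ffun b => proj_of fin (idem K (hd (val b)) * w b)].
have Yin : Y \in out_space k M.
  apply/mem_out_space => b; rewrite ffunE; apply/mem_comp_idem.
  by rewrite proj_ofK -jpiM !mulrA idemK.
have -> : y = gamma k M (vsproj (out_space k M) Y).
  apply: val_inj; rewrite [RHS]gammaE; apply/ffunP => a; rewrite ffunE vsprojK //.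
  apply: proj_val_inj; rewrite (lin_sum (@proj_val_linear _ _ _ _ _ fin)).
  have := hw a; rewrite mulr_suml.
  under eq_bigr => a' _ do rewrite -mulrA.
  rewrite (left_quot_sum _ _ val_inj) -(mulrA (u a)) idemK -jac_predE => /jpi_eq.
  rewrite jpiM -hu; have /mem_comp_idem -> := yc a.
  rewrite (lin_sum (jpi_is_linear S)) -{2}(proj_val_el (vsval y a)) => ->.
  rewrite mulr_suml; apply: eq_bigr => b _.
  rewrite proj_val_act ffunE proj_ofK -!jpiM cyc_derivS !mulrA.
  by rewrite cyc_deriv2_idemr.
by rewrite memv_img ?memvf.
Qed.

Definition star_sum (y : {ffun out_arrow -> M}) : jac St :=
  \sum_b jpi St (arr K (oA b)) * g (y b).

Lemma star_sum_linear : linear star_sum.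
Proof.
move=> c x y; rewrite /star_sum scaler_sumr -big_split; apply: eq_bigr => b _ /=.
by rewrite !ffunE lift_val_linear mulrDr -jac_scalerAr.
Qed.

Definition star_coker (z : coker_beta k M) : jac St := star_sum (vsval (lrepr z)).

Lemma star_cokerE (y : M_out k M) : star_coker (coker_proj y) = star_sum (vsval y).
Proof.
rewrite /star_coker; set y' := lrepr _.
have /lprojP : coker_proj y' = coker_proj y by rewrite /coker_proj lreprK.
case/memv_imgP => m _ e.
apply/eqP; rewrite -subr_eq0 -(linB star_sum_linear).
have -> : vsval y' - vsval y = vsval (beta k M m).
  by have /(congr1 vsval) := e; rewrite raddfB.
rewrite betaE /star_sum; apply/eqP.
under eq_bigr => b _ do rewrite ffunE.
exact/lift_val_beta/subvsP.
Qed.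

Lemma star_coker_linear : linear star_coker.
Proof.
move=> c x y; rewrite -[x]lreprK -[y]lreprK.
have -> : c *: lproj _ (lrepr x) + lproj _ (lrepr y) =
    coker_proj (c *: lrepr x + lrepr y) :> coker_beta k M.
  by rewrite /coker_proj linearP.
rewrite star_cokerE -!/(coker_proj _) !star_cokerE -star_sum_linear.
by congr star_sum.
Qed.

(* The element [m] - sum b* [y_b] of the projective of the premutation, for m
   away from k and (y_b) representing a class in coker beta. *)
Definition mut_val (m : M) (y : {ffun out_arrow -> M}) : jac St := g m - star_sum y.

Lemma mut_val_mem m y : mut_val m y \in projective_pred (S := St) l.
Proof.
apply/projective_predP; exists (mut_val m y).
rewrite mulrBl lift_val_el /star_sum mulr_suml; congr (_ - _).
by apply: eq_bigr => b _; rewrite -mulrA lift_val_el.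
Qed.

Lemma off_star b (x : jac St) : jpi St offt * (jpi St (arr K (oA b)) * x) = 0.
Proof.
rewrite mulrA -jpiM -(idem_arrK K (oA b)) hd_oA mulrA off_idemk mul0r.
by rewrite (lin0 (jpi_is_linear St)) mul0r.
Qed.

(** Multiplication by e keeps the first part and kills the second, whose terms end at k. *)
Lemma mut_val_eq0 m y : mut_val m y = 0 -> g m = 0 /\ star_sum y = 0.
Proof.
move=> e; have gm : g m = 0.
  have := congr1 (fun x => jpi St offt * x) e; rewrite mulr0 mulrBr lift_val_off.
  rewrite mulr_sumr big1 ?subr0 // => b _; exact: off_star.
by split=> //; move: e; rewrite /mut_val gm sub0r => /eqP; rewrite oppr_eq0 => /eqP.
Qed.

(** On the corner [unm] undoes [brh], and [m] lies there because it has no component at k. *)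
Lemma lift_val_eq0 m : m \in rest_space k M -> g m = 0 -> m = 0.
Proof.
move=> /mem_rest em gm; apply: proj_val_inj; rewrite (lin0 (@proj_val_linear _ _ _ _ _ fin)).
have [u eu] := proj_valE m; move: gm; rewrite (lift_valE eu) => /jpi_eq0.
move/(unm_jac lf pS1 no2 S1k); rewrite unm_brh // -jac_predE => /jpi_eq0 <-.
rewrite -!(mulrA offQ) -(mulrA u) idem_off neq_lk scale1r jpiM -eu.
rewrite /off (linB (jpi_is_linear S)) mulrBl em subr0.
by rewrite -[jpi S 1]/(1 : jac S) mul1r.
Qed.

(** Converse of [lift_val_beta]: a relation among the b* comes from the derivatives at the a*, each
    of which contributes an element of im beta. *)
Lemma star_sum_eq0 (y : M_out k M) : star_sum (vsval y) = 0 -> y \in limg (beta k M).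
Proof.
move=> y0; have [N nil] := proj_nilpotent fin.
have nil1 u : mpow N u -> u * idem K l \in jac_pred S1 by move/nil; rewrite jac_predE.
have yc b : vsval y b \in comp M (hd (val b)) by move: b; apply/mem_out_space/subvsP.
have [u hu] := choice (fun b => proj_valE (vsval y b)).
have vJ : \sum_b arr K (oA b) * brh (u b * idem K l) \in jac_pred St.
  apply/jpi_eq0; rewrite (lin_sum (jpi_is_linear St)) -[RHS]y0.
  by apply: eq_bigr => b _; rewrite jpiM -(lift_valE (hu b)).
have [x hx] := jac_star_quot lf pS1 no2 S1k nil1 neq_lk vJ.
pose m := proj_of fin (idem K k * x).
have mk : m \in comp M k by apply/mem_comp_idem; rewrite proj_ofK -jpiM !mulrA idemK.
have -> : y = beta k M (vsproj (comp M k) m).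
  apply: val_inj; rewrite [RHS]betaE; apply/ffunP => b; rewrite ffunE vsprojK //.
  apply: proj_val_inj; rewrite proj_val_act proj_ofK -jpiM !mulrA arr_idem tl_out eqxx scale1r.
  rewrite [RHS]jpiM; have := hx b; rewrite mulr_suml.
  under eq_bigr => b' _ do rewrite -mulrA.
  have inj_oA : injective (@oA V Q k) by move=> b1 b2 [].
  rewrite (left_quot_sum _ _ inj_oA).
  rewrite -brh_idemMr // -brh_idemMl ?hd_out // -mulrA idemK mulrA unm_brh_corner ?hd_out //.
  rewrite -jac_predE => /jpi_eq e.
  have /mem_comp_idem := yc b; rewrite {1}hu -jpiM mulrA e => ->.
  by rewrite proj_val_el.
by rewrite memv_img ?memvf.
Qed.

(** An element of L~ e_l splits into its parts away from k and at k; the latter has no constant term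
    and is divisible by the b*. *)
Lemma mut_val_surj (t : jac St) : t \in projective_pred (S := St) l ->
  exists m, exists y, [/\ m \in rest_space k M, y \in out_space k M & mut_val m y = t].
Proof.
case/projective_predP => t'; case: (jpi_surj t') => v -> {t'}; rewrite -jpiM => ->.
pose v' := idem K k * (v * idem K l); pose L b := left_quot (oA b) v'.
have v1 : mpow 1 v' by apply: mpow_corner.
have Ll b : idem K (hd (val b)) * L b = L b by exact: (left_quot_tgt (oA b) v').
have Lr b : L b * idem K l = L b.
  by rewrite /L -left_quotM // /v' -!mulrA idemK.
pose m := proj_of fin (offQ * unm S1 v).
(* The sign cancels the minus in [mut_val]. *)
pose y := [ffun b => - proj_of fin (idem K (hd (val b)) * unm S1 (L b))].
exists m, y; split.
- apply/mem_rest; rewrite proj_ofK -jpiM !mulrA idemk_off !mul0r.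
  exact: lin0 (jpi_is_linear S).
- apply/mem_out_space => b; rewrite ffunE memvN; apply/mem_comp_idem.
  by rewrite proj_ofK -jpiM !mulrA idemK.
have brh_unmJ u : jpi St (brh (unm S1 u)) = jpi St (offt * u * offt).
  by apply/esym/jpi_eq/brh_unm.
have gm : g m = jpi St (offt * (v * idem K l)).
  rewrite (lift_valE (proj_ofK _ _)) -mulrA brh_offl -unm_idemr // brh_unmJ.
  by rewrite -!mulrA idem_off neq_lk scale1r.
have gy b : g (y b) = - jpi St (L b).
  rewrite ffunE (linN lift_val_linear) (lift_valE (proj_ofK _ _)).
  rewrite -unm_idemMl ?hd_out // Ll -unm_idemr // Lr brh_unmJ -Ll -Lr.
  by rewrite !mulrA off_idem hd_out // scale1r -!mulrA idem_off neq_lk scale1r.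
rewrite /mut_val /star_sum gm.
under eq_bigr => b _ do rewrite gy mulrN -jpiM.
rewrite sumrN opprK -(lin_sum (jpi_is_linear St)) -(linD (jpi_is_linear St)).
have <- : v' = \sum_b arr K (oA b) * L b.
  rewrite {1}(left_quotE v1) sum_oA // => x hx.
  by rewrite /v' left_quot_idem (negPf hx) scale0r mulr0.
by congr (jpi St _); rewrite /off mulrBl mul1r subrK.
Qed.

Variable v : {ffun V -> nat}.
Hypothesis vk : v k = 0%N.

(** The components in ker alpha / im gamma and in K^{v_k} are dropped, both spaces being 0 here. In
    coker beta a representative is taken, on which the value does not depend. *)
Definition mut_iso (x : Mbar k M v) : projective St l :=
  Projective (mut_val_mem (vsval x.1) (vsval (lrepr x.2.1.1))).

Lemma mut_isoE x : val (mut_iso x) = g (vsval x.1) - star_coker x.2.1.1.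
Proof. by []. Qed.

Lemma mut_iso_linear : linear mut_iso.
Proof.
move=> c x y; apply: val_inj; rewrite [LHS]mut_isoE.
rewrite -[RHS]/(c *: val (mut_iso x) + val (mut_iso y)) !mut_isoE.
have -> : vsval (c *: x + y).1 = c *: vsval x.1 + vsval y.1 by apply: linearP.
case: x y => [r [[z h] w]] [r' [[z' h'] w']].
rewrite lift_val_linear; cbn [fst snd].
rewrite -[X in _ - star_coker X]/(c *: z + z' : coker_beta k M) star_coker_linear.
by rewrite scalerBr opprD addrACA.
Qed.

Lemma mut_iso_inj : injective mut_iso.
Proof.
apply: (linear_inj mut_iso_linear) => -[r [[z h] w]] /(congr1 val) e.
have {e}[gr sz] := mut_val_eq0 e.
have r0 : r = 0 by apply: val_inj; apply: lift_val_eq0 gr; apply: subvsP.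
have z0 : z = 0.
  have e : coker_proj (lrepr z) = coker_proj (0 : M_out k M).
    by apply/lprojP; rewrite subr0; apply: star_sum_eq0 sz.
  by rewrite -[z]lreprK [LHS]e /coker_proj linear0.
have h0 : h = 0 by apply: homology_eq0.
have w0 : w = 0 by apply/rowP => j; have := ltn_ord j; rewrite [X in (_ < X)%N]vk.
by subst r z h w.
Qed.

Lemma mut_iso_surj (t : projective St l) : exists x, mut_iso x = t.
Proof.
have [m [y [mR yO e]]] := mut_val_surj (valP t).
exists (vsproj (rest_space k M) m, (coker_proj (vsproj (out_space k M) y), 0, 0)).
by apply: val_inj; rewrite mut_isoE /= star_cokerE !vsprojK.
Qed.

Lemma comp_rest j m : j != k -> m \in comp M j -> m \in rest_space k M.
Proof. by move=> jk; apply/subvP; apply: sumv_sup (subvv _). Qed.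

Lemma mem_comp_hd (x : arrow Q) m : acp (arr K x) m \in comp M (hd x).
Proof. by apply/mem_comp_idem; rewrite proj_val_act mulrA -jpiM idem_arrK. Qed.

Lemma arr_star_coker (x : arrow Qt) (z : coker_beta k M) : tl x != k ->
  jpi St (arr K x) * star_coker z = 0.
Proof.
move=> xk; rewrite /star_coker /star_sum mulr_sumr big1 // => b _.
by rewrite mulrA -jpiM arr_arr0 ?hd_oA // (lin0 (jpi_is_linear St)) mul0r.
Qed.

Lemma k_lift_val u m : u = u * idem K k -> jpi St u * g m = 0.
Proof.
move=> ->; rewrite -lift_val_off mulrA -jpiM -mulrA idemk_off mulr0.
by rewrite (lin0 (jpi_is_linear St)) mul0r.
Qed.

Lemma idem_star_coker j (z : coker_beta k M) :
  jpi St (idem K j) * star_coker z = (j == k)%:R *: star_coker z.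
Proof.
rewrite /star_coker /star_sum mulr_sumr scaler_sumr; apply: eq_bigr => b _.
by rewrite mulrA -jpiM idem_arr hd_oA eq_sym jpiZ jac_scalerAl.
Qed.

Lemma mut_iso_idem j x :
  val (mut_iso (Mbar_idem j x)) = jpi St (idem K j) * val (mut_iso x).
Proof.
rewrite !mut_isoE mulrBr idem_star_coker /Mbar_idem.
case: eqP => [->|/eqP jk]; cbn [fst snd].
  move: (vsval x.1) (x.2.1.1) => m z.
  by rewrite (k_lift_val (u := idem K k)) ?idemK // raddf0 (lin0 lift_val_linear) scale1r.
move: (vsval x.1) (x.2.1.1) => m z; rewrite scale0r -lift_val_idem // vsprojK.
  by congr (_ - _); apply: lin0 star_coker_linear.
apply: (comp_rest jk); apply/mem_comp_idem.
by rewrite proj_val_act mulrA -jpiM idemK.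
Qed.

Lemma mut_iso_arrow (sigma : {linear homology k M -> ker_alpha k M}) (c : arrow Qt) x :
  val (mut_iso (Mbar_arrow sigma c x)) = jpi St (arr K c) * val (mut_iso x).
Proof.
have s0 h : vsval (sigma h) = 0 by rewrite (homology_eq0 h) linear0 raddf0.
have c0 : star_coker 0 = 0 := lin0 star_coker_linear.
rewrite !mut_isoE mulrBr; case: c => [[c|[b a]]|[a|b]]; rewrite /Mbar_arrow /in_star_map;
  cbn [fst snd]; move: (vsval x.1) (x.2.1.1) (x.2.1.2) => m z h.
- rewrite vsprojK; last exact: comp_rest (hd_kept c) (mem_comp_hd _ _).
  rewrite [star_coker 0]c0 lift_val_kept.
  by rewrite [X in _ = _ - X](arr_star_coker (x := kA c)) // tl_kept.
- rewrite vsprojK; last exact: comp_rest (hd_out lf b) (mem_comp_hd _ _).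
  rewrite [star_coker 0]c0 lift_val_hook.
  by rewrite [X in _ = _ - X](arr_star_coker (x := bA b a)) // tl_in.
(* For a*, the entries of [gamma] become - a* b*, and this sign is the one in front of
   [star_coker]. *)
- rewrite s0 addr0 /gamma_bar gammaE ffunE vsprojK; last first.
    apply: (comp_rest (tl_in lf a)); apply: memv_suml => b _; apply/mem_comp_idem.
    by rewrite proj_val_act mulrA -jpiM cyc_deriv2_ideml.
  rewrite [star_coker 0]c0 subr0 (lin_sum lift_val_linear) (k_lift_val (u := arr K (iA a))).
    rewrite sub0r /star_coker /star_sum mulr_sumr -sumrN; apply: eq_bigr => b _.
    exact: lift_val_deriv2.
  by rewrite arr_idem tl_iA eqxx scale1r.
(* For b*, the minus in [out_star_map] cancels the one in front of [star_coker]. *)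
- rewrite raddf0 (lin0 lift_val_linear) sub0r (linN star_coker_linear) opprK star_cokerE.
  rewrite [X in _ = _ - X](arr_star_coker (x := oA b)) ?subr0; last exact: hd_out.
  rewrite /out_inj vsprojK; last first.
    apply/mem_out_space => b'; rewrite ffunE; case: eqP => [->|_]; last exact: mem0v.
    by apply/mem_comp_idem; rewrite proj_val_act mulrA -jpiM idemK.
  rewrite /star_sum (bigD1 b) //= big1 ?addr0 => [|b' ne]; last first.
    by rewrite ffunE (negPf ne) (lin0 lift_val_linear) mulr0.
  by rewrite ffunE eqxx lift_val_idem ?hd_out // mulrA -jpiM (arr_idemK K (oA b)).
Qed.

(** Surjectivity alone bounds the dimension, so arbitrary families in M are allowed, without passing
    to M_out or to coker beta. *)
Lemma finite_dim_premut : finite_dim (projective St l).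
Proof.
pose X : vectType K := (M * {ffun out_arrow -> M})%type.
pose h (x : X) : projective St l := Projective (mut_val_mem x.1 x.2).
apply: (finite_dim_surj (X := X) (h := h)) => [c x y|t].
  apply: val_inj; rewrite -[RHS]/(c *: mut_val x.1 x.2 + mut_val y.1 y.2).
  rewrite -[LHS]/(mut_val (c *: x.1 + y.1) (c *: x.2 + y.2)) /mut_val.
  by rewrite lift_val_linear star_sum_linear scalerBr opprD addrACA.
have [m [y [_ _ e]]] := mut_val_surj (valP t).
by exists (m, y); apply: val_inj.
Qed.

(** As [alpha] is onto, ker beta lies in its image. *)
Lemma vbar_eq0 : vbar k M [ffun=> 0%N] = [ffun=> 0%N].
Proof.
apply/ffunP => j; rewrite !ffunE; case: eqP => // _.
by rewrite alpha_surj capvf subnn.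
Qed.

Lemma is_premutation_projective (fint : finite_dim (projective St l))
    (sigma : {linear homology k M -> ker_alpha k M}) :
  @is_premutation K V Q S k (DecoratedRep M v) sigma S1
    (DecoratedRep (projective_module fint) (vbar k M v)).
Proof.
split=> //=.
pose lm := GRing.isLinear.Build K (Mbar k M v) (projective_module fint) _
  (mut_iso : Mbar k M v -> projective_module fint) mut_iso_linear.
pose f : {linear Mbar k M v -> projective_module fint} :=
  HB.pack_for {linear Mbar k M v -> projective_module fint}
    (mut_iso : Mbar k M v -> projective_module fint) lm.
exists f; split.
- exact: inj_surj_bij mut_iso_inj mut_iso_surj.
- move=> j x; apply: (@proj_val_inj _ _ _ _ _ fint).
  by rewrite proj_val_act; apply: mut_iso_idem.
- move=> c x; apply: (@proj_val_inj _ _ _ _ _ fint).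
  by rewrite proj_val_act; apply: mut_iso_arrow.
Qed.

End MutationOfProjective.

(** * Transport of a projective along an isomorphism of Jacobian algebras *)

Section RestrictProjective.
Variables (K : fieldType) (V : finType) (Q Q' : quiver V) (S : cpa K Q) (S' : cpa K Q').
Variables (l : V) (psi : jac_hom S' S).
Hypothesis psi_bij : bijective psi.
Hypothesis psi_el : psi (jpi S' (idem K l)) = jpi S (idem K l).
Variable fin : finite_dim (projective S l).
Local Notation M := (projective_module fin).

(** The inverse of [psi] identifies the two projectives because [psi] matches the idempotents at
    l. *)
Lemma projective_restrict_iso : exists fin' : finite_dim (projective S' l),
  exists2 f : 'Hom(restrict psi M, projective_module fin'),
    bijective f & forall x m, f (act (restrict psi M) x m) = act (projective_module fin') x (f m).
Proof.
have [chi psiK chiK] := psi_bij.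
have chiM x y : chi (x * y) = chi x * chi y.
  by rewrite -{1}[x]chiK -{1}[y]chiK -(jac_hom_monoid psi).2 psiK.
have lchi : linear chi.
  by move=> c x y; rewrite -{1}[x]chiK -{1}[y]chiK -(jac_hom_linear psi) psiK.
have chi_mem (t : projective S l) : chi (val t) \in projective_pred (S := S') l.
  apply/projective_predP; have /projective_predP[y ->] := valP t.
  by exists (chi y); rewrite chiM -psi_el psiK.
pose h (t : projective S l) := Projective (chi_mem t).
have lh : linear h by move=> c x y; apply: val_inj; apply: lchi.
have bh : bijective h.
  apply: inj_surj_bij => [x y /(congr1 val) e|t].
    by apply: val_inj; apply: (can_inj chiK).
  have tm : psi (val t) \in projective_pred (S := S) l.
    apply/projective_predP; have /projective_predP[y ->] := valP t.
    by exists (psi y); rewrite (jac_hom_monoid psi).2 psi_el.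
  by exists (Projective tm); apply: val_inj; apply: psiK.
have fin' : finite_dim (projective S' l) by apply: (finite_dim_bij (X := M) (h := h)).
exists fin'.
pose f : 'Hom(restrict psi M, projective_module fin') := linfun (h : M -> projective_module fin').
have fE m : f m = h m by apply: linfun_linearE.
exists f.
  apply: (eq_bij bh) => m; exact/esym/fE.
move=> x m; rewrite !fE; apply: (@proj_val_inj _ _ _ _ _ fin').
rewrite proj_val_act -[LHS]/(chi (proj_val (act M (psi x) m))) proj_val_act chiM psiK.
by [].
Qed.
End RestrictProjective.

Theorem theorem2p1 (R : realType) (V : finType) (Q : quiver V) (S : cpa R[i] Q)
    (k l : V) (QS : is_QP S) (neq_kl : k != l) (no2 : no_2cycle_at Q k)
    (S1 : cpa R[i] Q) (S1pot : potential S1) (S1S : cyclically_equivalent S S1)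
    (S1k : no_term_at k S1)
    (Q' C : quiver V) (S' : cpa R[i] Q') (T : cpa R[i] C)
    (phi : cpa R[i] (premut_quiver Q k) -> cpa R[i] (dsum_quiver Q' C))
    (red : is_reduced_part (premut_pot k S1) S' T phi)
    (fin : finite_dim (projective S l)) :
  exists fin' : finite_dim (projective S' l),
    let P := DecoratedRep (projective_module fin) [ffun=> 0%N] in
    let P' := DecoratedRep (projective_module fin') [ffun=> 0%N] in
    forall sigma : {linear homology k (dmod P) -> ker_alpha k (dmod P)},
      is_section sigma ->
      exists2 N : decorated_rep S',
        is_mutation S1 phi sigma N & decorated_iso N P'.
Proof.
have [lf pS] := QS.
have pSt := premut_potential S1pot (k := k).
have [psi [psi_ind psi_bij psi_idem]] := reduced_part_iso (premut_loop_free lf no2) pSt red.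
have fint := finite_dim_premut lf S1pot no2 S1k S1S neq_kl fin.
have [fin' [f f_bij f_act]] := projective_restrict_iso psi_bij (psi_idem l) fint.
exists fin' => P P' sigma _.
(* The decoration is written with [vbar], as the definition of premutation demands; [vbar_eq0]
   identifies it with 0. *)
pose Mt := DecoratedRep (projective_module fint) (vbar k (dmod P) (dvec P)).
exists (DecoratedRep (restrict psi (dmod Mt)) (dvec Mt)); last first.
  by split; [exists f|apply: vbar_eq0].
exists psi, Mt; split=> //.
by apply: is_premutation_projective => //; rewrite ffunE.
Qed.
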